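(* Let $X$ be a computable Polish space, $\nu$ a computable Borel probability measure on $X$, $(\mathscr F_n)$ an increasing sequence of sub-$\sigma$-algebras of the Borel sets, and $p\ge1$ a computable real. Suppose $E[\cdot\mid n](\cdot):\mathbb L^+_p(\nu)\times X\to[0,\infty]$ is such that for every $f\in\mathbb L^+_p(\nu)$ and $n$, $E[f\mid n]$ is a version of the conditional expectation of $f$ given $\mathscr F_n$, and define $f^\flat(x)=\sup_nE[f\mid n](x)$. Let $\mathsf{XR}^\nu\supseteq\mathsf{SR}^\nu$. Assume: (I) each $E[\cdot\mid n]$ maps nonnegative lsc functions to nonnegative lsc functions (uniformly); (II) on $\mathsf{XR}^\nu$: (a) if $f\le g$ on $\mathsf{XR}^\nu$ then $E[f\mid n]\le E[g\mid n]$ on $\mathsf{XR}^\nu$; (b) $cE[f\mid n]=E[cf\mid n]$ on $\mathsf{XR}^\nu$ for $c\in\mathbb R^{\ge0}$; (c) $E[f+g\mid n]=E[f\mid n]+E[g\mid n]$ on $\mathsf{XR}^\nu$; (III) both $E[\cdot\mid n]$ and $\cdot^\flat$ send the countable dense set of $L^+_p(\nu)$ uniformly to computable points of $L^+_p(\nu)$; (IV) the $L_p(\nu)$ Schnorr tests are approximated from below on $\mathsf{XR}^\nu$ by a class $\mathcal C$ of $L_p(\nu)$ Schnorr tests such that $\lim_nE[f\mid n]=f$ on $\mathsf{XR}^\nu$ for every $f\in\mathcal C$. Then for $x\in X$ the following are equivalent: (1) $x\in\mathsf{SR}^\nu$; (2) $x\in\mathsf{XR}^\nu$ and $\lim_nE[f\mid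 n](x)=f(x)$ for every $L_p(\nu)$ Schnorr test $f$; (3) $x\in\mathsf{XR}^\nu$, $\lim_nE[f\mid n](x)$ exists for every $L_p(\nu)$ Schnorr test $f$, and $\lim_nE[I_U\mid n](x)=I_U(x)$ for every c.e. open $U$ with $\nu(U)$ computable. Moreover: (i) every Borel set $B$ is equal on $\mathsf{SR}^\nu$ to a Borel set $B'$ in the $\sigma$-algebra generated by $\bigcup_n\mathscr F_n$; (ii) if in addition in (IV) every $x\in\mathsf{SR}^\nu$ weakly computes a rate of convergence for $E[f\mid n](x)\to f(x)$ uniformly in $f\in\mathcal C$, then for every $x\in\mathsf{SR}^\nu$ and every $L_p(\nu)$ Schnorr test $f$, $x$ weakly computes a rate of convergence for $E[f\mid n](x)\to f(x)$. (Limits are required to exist and be finite.)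
   Context: A computable Polish space is a Polish space $X$ with a distinguished dense sequence $x_0,x_1,\dots$ and a compatible complete metric $d$ with $d(x_i,x_j)$ uniformly computable. An open set is c.e. open if it equals $\bigcup_i B(x_{n(i)},r_i)$ for computable $n(\cdot)$ and a computable sequence of positive rationals $r_i$; complements are effectively closed. $f:X\to(-\infty,\infty]$ is lower semi-computable (lsc) if the sets $f^{-1}(q,\infty]$, $q\in\mathbb Q$, are uniformly c.e. open; $f$ is upper semi-computable (usc) if $-f$ is lsc. $\nu$ computable means $\nu(U)$ is left-c.e. uniformly in c.e. open $U$. An $L_p(\nu)$ Schnorr test is an lsc $f:X\to[0,\infty]$ with $\|f\|_p$ computable. $\mathsf{SR}^\nu$ is the set of $x$ with $f(x)<\infty$ for every $L_1(\nu)$ Schnorr test $f$. $\mathbb L^+_p(\nu)$ denotes pointwise-defined Borel $f:X\to[0,\infty]$ with $\|f\|_p<\infty$, $L^+_p(\nu)$ the corresponding equivalence classes mod $\nu$-a.s. equality. A $\nu$-computable basis is a computable sequence of c.e. open sets such that every c.e. open set is effectively a union of its members, finite unions of members have uniformly computable $\nu$-measure, and each member is uniformly paired with an effectively closed superset of equal $\nu$-measure. $L_p(\nu)$ is a computable Polish space with the $\|\cdot\|_p$ metric and countable dense set the simple functions $\sum_{i\le k}q_iI_{A_i}$ with $q_i$ rational and $A_i$ in the algebra generated by a $\nu$-computable basis; $L^+_p(\nu)$ uses those with $q_i\ge0$. A computable point is a limit of a computable sequence $(g_n)$ from the dense set with $\|g_n-g\|_p\le2^{-n}$. The $L_p(\nu)$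 Schnorr tests are approximated from below on $\mathsf{XR}^\nu$ by $\mathcal C$ if from an index for an $L_p(\nu)$ Schnorr test $f$ one can compute an index for a sequence $(f_s)$ of $L_p(\nu)$ Schnorr tests in $\mathcal C$ with $f_s\le f_{s+1}$ on $\mathsf{XR}^\nu$, $f=\sup_sf_s$ on $\mathsf{XR}^\nu$, $\|f_s-f\|_p\le2^{-s}$, together with an index for a sequence of nonnegative usc functions $\breve f_s$ equal to $f_s$ on $\mathsf{XR}^\nu$. A rate of convergence for $y_n\to y$ is $m:\mathbb Q^{>0}\to\mathbb N$ with $|y_n-y|<\epsilon$ for all rational $\epsilon>0$ and $n\ge m(\epsilon)$. A point $x$ weakly computes an object with a property if for every $i\mapsto n(i)$ with $d(x_{n(i)},x)\le2^{-i}$ for all $i$, some such object is Turing reducible to $i\mapsto n(i)$. *)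

(* Defs.v *)
From HB Require Import structures.
From Stdlib Require Cantor.
From mathcomp Require Import all_boot all_order all_algebra.
From mathcomp Require Import all_classical all_reals all_analysis.
From mathcomp Require Import measurable_realfun.

Set Implicit Arguments.
Unset Strict Implicit.
Unset Printing Implicit Defensive.

Import Order.TTheory GRing.Theory Num.Theory.
Import numFieldNormedType.Exports.

Local Open Scope classical_set_scope.
Local Open Scope ring_scope.

(* Kleene's partial recursive functions relative to an oracle [o]; arguments
   are packed with the Cantor pairing, so that every function is unary. *)

Definition pr (x y : nat) : nat := Cantor.to_nat (x, y).
Definition unpr (z : nat) : nat * nat := Cantor.of_nat z.

Inductive code : Type :=
| CZero
| CSucc
| CFst
| CSnd
| COracle
| CPair of code & code
| CComp of code & code
| CPrec of code & code
| CMin of code.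

Fixpoint code_num (c : code) : nat :=
  (match c with
  | CZero => 0
  | CSucc => 1
  | CFst => 2
  | CSnd => 3
  | COracle => 4
  | CPair c d => 5 + 4 * pr (code_num c) (code_num d)
  | CComp c d => 6 + 4 * pr (code_num c) (code_num d)
  | CPrec c d => 7 + 4 * pr (code_num c) (code_num d)
  | CMin c => 8 + 4 * code_num c
  end)%N.

(* h(a,0) = P(a),  h(a,n+1) = Q(a,(n,h(a,n))) *)
Fixpoint prec_rel (P Q : nat -> nat -> Prop) (a n y : nat) : Prop :=
  if n is n'.+1 then exists2 z, prec_rel P Q a n' z & Q (pr a (pr n' z)) y
  else P a y.

(* [eval o c x y]: on input x, the program c with oracle o halts with output y;
   [CMin c] searches for the least z with c(x,z) = 0. *)
Fixpoint eval (o : nat -> nat) (c : code) (x y : nat) : Prop :=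
  match c with
  | CZero => y = 0%N
  | CSucc => y = x.+1
  | CFst => y = (unpr x).1
  | CSnd => y = (unpr x).2
  | COracle => y = o x
  | CPair c d => exists z t, [/\ eval o c x z, eval o d x t & y = pr z t]
  | CComp c d => exists2 z, eval o d x z & eval o c z y
  | CPrec c d =>
      prec_rel (eval o c) (eval o d) (unpr x).1 (unpr x).2 y
  | CMin c => eval o c (pr x y) 0 /\
      forall z, (z < y)%N -> exists t, eval o c (pr x z) t.+1
  end.

(* The e-th partial computable function maps x to y. *)
Definition phi (e x y : nat) : Prop :=
  exists2 c, code_num c = e & eval (fun=> 0%N) c x y.

(* The e-th partial computable function is defined at x, and Q holds of its
   value. *)
Definition yields (e x : nat) (Q : nat -> Prop) : Prop :=
  exists2 y, phi e x y & Q y.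

(* Surjective numberings, k = <a,<b,c>> |-> (a - b)/(c + 1) for the rationals
   and k = <a,b> |-> (a + 1)/(b + 1) for the positive ones. *)
Definition qnum (k : nat) : rat :=
  ((unpr k).1%:R - (unpr (unpr k).2).1%:R) / (unpr (unpr k).2).2.+1%:R.

Definition qpos (k : nat) : rat := (unpr k).1.+1%:R / (unpr k).2.+1%:R.

Definition seq_num (s : seq nat) : nat := foldr (fun x k => (pr x k).+1) 0%N s.

Section computable_reals.
Context {R : realType}.

Definition real_index (e : nat) (y : R) : Prop :=
  forall n, yields e n (fun k => `|ratr (qnum k) - y| <= 2 ^- n).

Definition ereal_index (e : nat) (y : \bar R) : Prop :=
  exists2 r : R, y = r%:E & real_index e r.

Definition computable_real (y : R) : Prop := exists e, real_index e y.

(* The left cut of y is the domain of the e-th partial computable function. *)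
Definition lce_index (e : nat) (y : \bar R) : Prop :=
  forall k, yields e k (fun=> True) <-> ((ratr (qnum k))%:E < y)%E.

End computable_reals.

(* The base point (any point will do: the space is nonempty) is only there
   because measurable types are required to be pointed. *)
#[short(type="completePointedMetricType")]
HB.structure Definition CompletePointedMetric (R : realType) :=
  {X of Metric R X & Complete X & Pointed X}.

HB.mixin Record isComputablePolish (R : realType) X
    & CompletePointedMetric R X := {
  ideal : nat -> X ;
  dense_ideal : dense (range ideal) ;
  computable_mdist : exists e, forall i j, yields e (pr i j)
    (fun e' => real_index e' (mdist (ideal i) (ideal j) : R))
}.

#[short(type="computablePolishType")]
HB.structure Definition ComputablePolish (R : realType) :=
  {X of CompletePointedMetric R X & isComputablePolish R X}.

Notation Borel X := (g_sigma_algebraType (@open X)).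

Section computable_topology.
Context {R : realType} {X : computablePolishType R}.
Implicit Types (U : set X) (f : X -> \bar R).

(* The balls are indexed by the domain of a partial computable function rather
   than by all of nat, so that the empty set is c.e. open. *)
Definition open_index (e : nat) U : Prop :=
  U = [set x | exists i, yields e i (fun k =>
        mdist (ideal (unpr k).1) x < ratr (qpos (unpr k).2) :> R)].

Definition ce_open U : Prop := exists e, open_index e U.

Definition eff_closed_index (e : nat) U : Prop := open_index e (~` U).

Definition lsc_index (e : nat) f : Prop :=
  (forall x, f x != -oo%E) /\
  forall k, yields e k
    (fun j => open_index j [set x | ((ratr (qnum k))%:E < f x)%E]).

Definition usc_index (e : nat) f : Prop := lsc_index e (fun x => - f x)%E.

Definition is_name (a : nat -> nat) (x : X) : Prop :=
  forall i, mdist (ideal (a i)) x <= 2 ^- i :> R.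

End computable_topology.

Section computable_measure.
Context {R : realType} {X : computablePolishType R}.
Variable nu : probability (Borel X) R.
Implicit Types (p : R) (f g : X -> \bar R) (B : nat -> set X).

Definition computable_measure : Prop :=
  exists h, forall e U, open_index e U ->
    yields h e (fun j => lce_index j (nu U)).

Definition Lp_plus p f : Prop :=
  [/\ measurable_fun [set: Borel X] (f : Borel X -> \bar R),
      forall x, (0 <= f x)%E & ('N[nu]_p%:E[f] < +oo)%E].

(* An index of a test is an index of it as a lower semi-computable function
   together with an index of its norm. *)
Definition test_index p (e : nat) f : Prop :=
  [/\ forall x, (0 <= f x)%E,
      lsc_index (unpr e).1 f & ereal_index (unpr e).2 'N[nu]_p%:E[f]%E].

Definition schnorr_test p f : Prop := exists e, test_index p e f.

Definition SR : set X :=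
  [set x | forall f, schnorr_test 1 f -> (f x < +oo)%E].

Definition computable_basis B : Prop :=
  [/\ exists h, forall n, yields h n (fun e => open_index e (B n)),
      exists h, forall e U, open_index e U -> yields h e (fun j =>
        U = \bigcup_(n in [set n | yields j n (fun=> True)]) B n),
      exists h, forall s : seq nat, yields h (seq_num s)
        (fun e => ereal_index e (nu (\bigcup_(n in [set` s]) B n))) &
      exists h, forall n, yields h n (fun e => exists V : set X,
        [/\ eff_closed_index e V, B n `<=` V & nu V = nu (B n)])].

(* The sets [aset B t] are the members of the algebra generated by the B n. *)
Inductive aterm : Type :=
| ABase of nat
| ACompl of aterm
| AUnion of aterm & aterm.

Fixpoint aset B (t : aterm) : set X :=
  match t with
  | ABase n => B n
  | ACompl t => ~` aset B t
  | AUnion t u => aset B t `|` aset B u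
  end.

Fixpoint aterm_num (t : aterm) : nat :=
  (match t with
  | ABase n => 3 * n
  | ACompl t => 1 + 3 * aterm_num t
  | AUnion t u => 2 + 3 * pr (aterm_num t) (aterm_num u)
  end)%N.

(* [:: (k_0, t_0); ...] stands for the sum of the qnum k_i times the indicator
   of aset B t_i. *)
Definition simple_num (s : seq (nat * aterm)) : nat :=
  seq_num [seq pr kt.1 (aterm_num kt.2) | kt <- s].

Definition simple_nneg (s : seq (nat * aterm)) : bool :=
  all (fun kt => 0 <= qnum kt.1) s.

Definition simple_fun B (s : seq (nat * aterm)) (x : X) : \bar R :=
  (\sum_(kt <- s) ratr (qnum kt.1) * \1_(aset B kt.2) x)%:E.

(* [e] computes a fast sequence of nonnegative simple functions converging
   to g in L_p. *)
Definition Lp_point_index B p (e : nat) g : Prop :=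
  Lp_plus p g /\
  forall m, yields e m (fun k => exists s, [/\ simple_num s = k, simple_nneg s &
    ('N[nu]_p%:E[(fun x => simple_fun B s x - g x)] <= (2 ^- m)%:E)%E]).

Definition approximated_from_below (XR : set X) p (C : set (X -> \bar R)) :
    Prop :=
  exists h h', forall e f, test_index p e f ->
    exists f_ g_ : nat -> X -> \bar R,
    [/\ yields h e (fun d => forall s, yields d s
          (fun j => test_index p j (f_ s))),
        forall s, C (f_ s),
        forall x, XR x -> (forall s, (f_ s x <= f_ s.+1 x)%E) /\
          f x = ereal_sup (range (f_ ^~ x)),
        forall s, ('N[nu]_p%:E[(fun x => f_ s x - f x)] <= (2 ^- s)%:E)%E &
        yields h' e (fun d => forall s, yields d s
          (fun j => usc_index j (g_ s))) /\
        forall s, (forall x, (0 <= g_ s x)%E) /\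
          (forall x, XR x -> g_ s x = f_ s x)].

Definition filtration (F : nat -> set (set X)) : Prop :=
  (forall n, sigma_algebra [set: X] (F n) /\
     F n `<=` (measurable : set (set (Borel X)))) /\
  (forall n, F n `<=` F n.+1).

Definition cond_exp_version (G : set (set X)) f g : Prop :=
  (forall A : set (\bar R), measurable A -> G (g @^-1` A)) /\
  (forall A : set (Borel X), G A ->
     (\int[nu]_(x in A) g x = \int[nu]_(x in A) f x)%E).

End computable_measure.

Section convergence.
Context {R : realType}.
Implicit Types (u : nat -> \bar R) (l : \bar R).

Definition finite_lim u l : Prop := l \is a fin_num /\ u @ \oo --> l.

Definition is_rate u l (m : rat -> nat) : Prop :=
  forall eps : rat, 0 < eps -> forall n, (m eps <= n)%N ->
    (`|u n - l| < (ratr eps)%:E)%E.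

End convergence.

Definition flat (R : realType) (X : Type)
    (E : nat -> (X -> \bar R) -> X -> \bar R) (f : X -> \bar R) (x : X) :
    \bar R :=
  ereal_sup (range (fun n => E n f x)).

Definition weakly_computes (R : realType) (X : computablePolishType R) (x : X)
    (P : (rat -> nat) -> Prop) : Prop :=
  forall a, is_name a x ->
    exists2 m, P m & exists c, forall k, eval a c k (m (qpos k)).

(* One functional, depending on the name of x only, serves all f in C and takes
   any index of f as an additional argument. *)
Definition weakly_computes_rates (R : realType) (X : computablePolishType R)
    (nu : probability (Borel X) R) (p : R)
    (E : nat -> (X -> \bar R) -> X -> \bar R) (C : set (X -> \bar R)) (x : X) :
    Prop :=
  forall a, is_name a x -> exists c, forall e f, C f -> test_index nu p e f ->
    exists2 m, is_rate (fun n => E n f x) (f x) m &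
      forall k, eval a c (pr e k) (m (qpos k)).

(* Main.v *)
(** Off the boundaries of the basic sets a simple function is decided by
    finitely many bits, so the integrals of simple functions, and with them
    those of all the functions below, are computable.  Let [f] be an [L_p] test
    with approximations [f_s] from below and remainders [h_s = f - f_s], so
    that [h_s] has norm at most [2^-s].  The values of [flat] on simple
    functions are computable points of [L_p], and Doob's maximal inequality
    controls [flat] on what is left of [h_s] after subtracting a simple
    function; hence the integrals of [min (2^s flat(h_(4s))) 1] are
    computable, and their sum over [s] is an [L_1] Schnorr test.  So
    [flat(h_(4s)) x < 2^-s] for almost all [s] whenever [x] is in [SR], and
    as [|E[f|n] - f| <= |E[f_s|n] - f_s| + flat(h_s)], convergence and rates
    pass from the [f_s] to [f].

    Conversely, if an [L_1] test [t] is infinite at [x], then [t^(1/p)] is an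
    [L_p] test that is at least [a^(1/p)] times the indicator of an open set
    [U] of computable measure containing [x], for every [a].  If
    [E[1_U|n] x] tends to [1], then [E[t^(1/p)|n] x] cannot have a finite
    limit.

    Finally, the limits of [E[1_B|n]] for basic [B] recover [B] on [SR] from
    the [F n], and the basic sets generate the Borel sets. *)

Require Import Defs.
From Stdlib Require Cantor.
From mathcomp Require Import all_boot all_order all_algebra.
From mathcomp Require Import all_classical all_reals all_analysis.
From mathcomp Require Import measurable_realfun.
From mathcomp Require Import zify ring lra.

Set Implicit Arguments.
Unset Strict Implicit.
Unset Printing Implicit Defensive.

Import Order.TTheory GRing.Theory Num.Theory.
Import numFieldNormedType.Exports.

Local Open Scope nat_scope.

(** * Recursive functions and c.e. predicates *)

(** Indices are hardly ever manipulated directly. Uniform families are handled through recursive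
    functions ([rec]), c.e. predicates ([ce]) and left cuts ([lcut]), which are closed under the
    operations that occur; indices are converted on entry by [yields_select] and on exit by the
    s-m-n construction. A real is computable when both of its cuts are c.e.; the integral of a
    nonnegative lsc function has a c.e. lower cut automatically, so the work lies in the upper one.

    Two obstacles shape the analytic part. The maximal inequality is of weak type only, and for
    [p = 1] the maximal function of an integrable function need not be integrable; truncation at 1
    keeps the integrals finite and small. For [p > 1] the norm of [f_s] is not its integral; the
    upper cut of the integral is obtained from the usc companion [g_s], because [max(M - g_s, 0)] is
    lsc and equals [M - min(f_s, M)] almost everywhere. The same companion makes the remainder
    [f - f_s] lsc, so that the hypothesis on lsc functions applies to it. *)

Notation "z ~l" := (fst (unpr z)) (at level 1, left associativity, format "z ~l").
Notation "z ~r" := (snd (unpr z)) (at level 1, left associativity, format "z ~r").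

Lemma eval_det o c x y z : Defs.eval o c x y -> Defs.eval o c x z -> y = z.
Proof.
elim: c x y z => [||||| c IHc d IHd|c IHc d IHd|c IHc d IHd|c IHc] x y z /=;
  try by move=> -> ->.
- move=> [a] [b] [ca db ->] [a'] [b'] [ca' db' ->].
  by rewrite (IHc _ _ _ ca ca') (IHd _ _ _ db db').
- move=> [a da ca] [a' da' ca'].
  by move: ca'; rewrite -(IHd _ _ _ da da'); exact: IHc.
- move: (unpr x) => [a n] /=; elim: n y z => [|n IHn] y z /=; first exact: IHc.
  move=> [u hu qu] [u' hu' qu'].
  by move: qu'; rewrite -(IHn _ _ hu hu'); exact: IHd.
- move=> [cy hy] [cz hz]; have [yz|zy|//] := ltngtP y z.
    by have [t ht] := hz _ yz; have := IHc _ _ _ cy ht.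
  by have [t ht] := hy _ zy; have := IHc _ _ _ cz ht.
Qed.

Lemma unprK x y : unpr (pr x y) = (x, y).
Proof. exact: Cantor.cancel_of_to. Qed.

Lemma prK z : pr z~l z~r = z.
Proof. by rewrite /pr -surjective_pairing; exact: Cantor.cancel_to_of. Qed.

Lemma unpr1K x y : (pr x y)~l = x. Proof. by rewrite unprK. Qed.
Lemma unpr2K x y : (pr x y)~r = y. Proof. by rewrite unprK. Qed.

Lemma pr_inj a b c d : pr a b = pr c d -> a = c /\ b = d.
Proof. by move=> /(congr1 unpr); rewrite !unprK => -[]. Qed.

Lemma leq_pr a b : a <= pr a b /\ b <= pr a b.
Proof. have := Cantor.to_nat_non_decreasing a b; rewrite -/(pr a b); lia. Qed.

(* One program serves all oracles, so that recursive functions can be used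
   in computations relative to a name of a point. *)
Definition rec (f : nat -> nat) := exists c, forall o x, Defs.eval o c x (f x).

Lemma rec_ext f g : f =1 g -> rec f -> rec g.
Proof. by move=> fg [c hc]; exists c => o x; rewrite -fg. Qed.

Lemma rec_id : rec (fun n => n).
Proof.
by exists (CPair CFst CSnd) => o x /=; exists x~l, x~r; rewrite prK.
Qed.

Lemma rec_comp f g : rec f -> rec g -> rec (fun n => f (g n)).
Proof. by move=> [c hc] [d hd]; exists (CComp c d) => o x /=; exists (g x). Qed.

Lemma rec_zero : rec (fun=> 0). Proof. by exists CZero. Qed.

Lemma rec_S f : rec f -> rec (fun n => (f n).+1).
Proof. by apply: (@rec_comp S); exists CSucc. Qed.

Lemma rec_const k : rec (fun=> k).
Proof. by elim: k => [|k]; [exact: rec_zero|exact: rec_S]. Qed.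

Lemma rec_fst f : rec f -> rec (fun n => (f n)~l).
Proof. by apply: (@rec_comp (fun z => z~l)); exists CFst. Qed.

Lemma rec_snd f : rec f -> rec (fun n => (f n)~r).
Proof. by apply: (@rec_comp (fun z => z~r)); exists CSnd. Qed.

Lemma rec_pr f g : rec f -> rec g -> rec (fun n => pr (f n) (g n)).
Proof.
move=> [c hc] [d hd]; exists (CPair c d) => o x /=.
by exists (f x), (g x); split.
Qed.

Lemma rec_comp2 (h : nat -> nat -> nat) f g :
  rec (fun z => h z~l z~r) -> rec f -> rec g ->
  rec (fun n => h (f n) (g n)).
Proof.
move=> hh hf hg; have := rec_comp hh (rec_pr hf hg).
by apply: rec_ext => n; rewrite unprK.
Qed.

Lemma rec_iteri g (s : nat -> nat -> nat -> nat) k :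
  rec g -> rec (fun z => s z~l z~r~l z~r~r) ->
  rec k -> rec (fun n => iteri (k n) (s n) (g n)).
Proof.
move=> [cg hg] [cs hs] hk.
have: rec (fun z => iteri z~r (s z~l) (g z~l)).
  exists (CPrec cg cs) => o x /=; case: (unpr x) => a n /=.
  elim: n => [|n IH] /=; first exact: hg.
  by eexists; first exact: IH; have := hs o (pr a (pr n (iteri n (s a) (g a))));
     rewrite !unprK.
move=> H; have := rec_comp H (rec_pr rec_id hk).
by apply: rec_ext => n; rewrite unprK.
Qed.

Lemma rec_iter g (s : nat -> nat -> nat) k :
  rec g -> rec (fun z => s z~l z~r) -> rec k ->
  rec (fun n => iter (k n) (s n) (g n)).
Proof.
move=> hg hs hk.
have := @rec_iteri g (fun n _ => s n) k hg _ hk.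
have -> : (fun n => iteri (k n) ((fun n0=> fun=> s n0) n) (g n)) =
          (fun n => iter (k n) (s n) (g n)).
  by apply/funext => n; elim: (k n) => //= m ->.
apply; have := rec_comp hs (rec_pr (rec_fst rec_id) (rec_snd (rec_snd rec_id))).
by apply: rec_ext => z; rewrite !unprK.
Qed.

Lemma rec_pred f : rec f -> rec (fun n => (f n).-1).
Proof.
apply: (@rec_comp predn).
have := @rec_iteri (fun=> 0) (fun _ i _ => i) id rec_zero
  (rec_fst (rec_snd rec_id)) rec_id.
by apply: rec_ext => -[|n].
Qed.

Lemma rec_add f g : rec f -> rec g -> rec (fun n => f n + g n).
Proof.
move=> hf hg; have := @rec_iter g (fun _ r => r.+1) f hg
  (rec_S (rec_snd rec_id)) hf.
by apply: rec_ext => n; elim: (f n) => //= m ->; rewrite addSn.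
Qed.

Lemma rec_sub f g : rec f -> rec g -> rec (fun n => f n - g n).
Proof.
move=> hf hg; have := @rec_iter f (fun _ r => r.-1) g hf
  (rec_pred (rec_snd rec_id)) hg.
by apply: rec_ext => n; elim: (g n) => [|m] /=; [rewrite subn0|move=> ->; rewrite subnS].
Qed.

Lemma rec_mul f g : rec f -> rec g -> rec (fun n => f n * g n).
Proof.
move=> hf hg; have := @rec_iter (fun=> 0) (fun n r => g n + r) f rec_zero
  (rec_add (rec_comp hg (rec_fst rec_id)) (rec_snd rec_id)) hf.
by apply: rec_ext => n; elim: (f n) => //= m ->; rewrite mulSn.
Qed.

Lemma rec_exp f g : rec f -> rec g -> rec (fun n => f n ^ g n).
Proof.
move=> hf hg; have := @rec_iter (fun=> 1) (fun n r => f n * r) g (rec_const 1)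
  (rec_mul (rec_comp hf (rec_fst rec_id)) (rec_snd rec_id)) hg.
by apply: rec_ext => n; elim: (g n) => //= m ->; rewrite expnS.
Qed.

Definition dec (b : nat -> bool) := rec (fun n => nat_of_bool (b n)).

Lemma dec_ext b b' : b =1 b' -> dec b -> dec b'.
Proof. by move=> bb; apply: rec_ext => n; rewrite bb. Qed.

Lemma dec_comp b g : dec b -> rec g -> dec (fun n => b (g n)).
Proof. by move=> hb hg; exact: (rec_comp hb hg). Qed.

Lemma dec_const b : dec (fun=> b).
Proof. exact: rec_const. Qed.

Lemma dec_not b : dec b -> dec (fun n => ~~ b n).
Proof.
by move=> hb; apply: rec_ext (rec_sub (rec_const 1) hb) => n; case: (b n).
Qed.

Lemma dec_and b c : dec b -> dec c -> dec (fun n => b n && c n).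
Proof.
by move=> hb hc; apply: rec_ext (rec_mul hb hc) => n; case: (b n); case: (c n).
Qed.

Lemma dec_or b c : dec b -> dec c -> dec (fun n => b n || c n).
Proof.
move=> hb hc; apply: dec_ext (dec_not (dec_and (dec_not hb) (dec_not hc))) => n.
by rewrite negb_and !negbK.
Qed.

Lemma dec_leq f g : rec f -> rec g -> dec (fun n => f n <= g n).
Proof.
move=> hf hg; apply: rec_ext (rec_sub (rec_const 1) (rec_sub hf hg)) => n.
by rewrite /leq; case: (f n - g n).
Qed.

Lemma dec_ltn f g : rec f -> rec g -> dec (fun n => f n < g n).
Proof. by move=> hf; apply: dec_leq; exact: rec_S. Qed.

Lemma dec_eqn f g : rec f -> rec g -> dec (fun n => f n == g n).
Proof.
move=> hf hg; apply: dec_ext (dec_and (dec_leq hf hg) (dec_leq hg hf)) => n.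
by rewrite eqn_leq.
Qed.

Lemma rec_if b f g : dec b -> rec f -> rec g ->
  rec (fun n => if b n then f n else g n).
Proof.
move=> hb hf hg.
apply: rec_ext (rec_add (rec_mul hb hf) (rec_mul (dec_not hb) hg)) => n.
by case: (b n); rewrite /= ?mul1n ?mul0n ?addn0.
Qed.

Definition bex (k : nat) (b : nat -> bool) := has b (iota 0 k).

Lemma bexP k (b : nat -> bool) : reflect (exists2 i, i < k & b i) (bex k b).
Proof.
apply: (iffP hasP) => -[i]; first by rewrite mem_iota => ? ?; exists i.
by move=> ik bi; exists i; rewrite ?mem_iota.
Qed.

Lemma dec_bex (b : nat -> nat -> bool) k :
  dec (fun z => b z~l z~r) -> rec k ->
  dec (fun n => bex (k n) (b n)).
Proof.
move=> hb hk.
have := @rec_iteri (fun=> 0) (fun n i r => if r == 1 then 1 else b n i) k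
  rec_zero _ hk.
have -> : (fun n => iteri (k n) (fun i r => if r == 1 then 1 else b n i) 0) =
          (fun n => nat_of_bool (bex (k n) (b n))).
  apply/funext => n; elim: (k n) => // m IH.
  rewrite /bex -addn1 iotaD has_cat add0n -/(bex m (b n)) addn1 /= IH.
  by case: (bex m (b n)) => //=; rewrite orbF.
apply.
apply: rec_if; first exact: dec_eqn (rec_snd (rec_snd rec_id)) (rec_const 1).
  exact: rec_const.
apply: rec_ext (dec_comp hb (rec_pr (rec_fst rec_id) (rec_fst (rec_snd rec_id)))).
by move=> z /=; rewrite unprK.
Qed.

(** Projections of decidable predicates rather than domains of programs: closure under conjunction
    and quantifiers is then bookkeeping on witnesses, with no reference to the machine model. *)
Definition ce (P : nat -> Prop) :=
  exists2 b, dec b & forall n, P n <-> exists w, b (pr n w).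

Lemma ce_ext (P Q : nat -> Prop) : (forall n, P n <-> Q n) -> ce P -> ce Q.
Proof. by move=> PQ [b hb bP]; exists b => // n; rewrite -PQ. Qed.

Lemma ce_comp P g : ce P -> rec g -> ce (fun n => P (g n)).
Proof.
move=> [b hb bP] hg; exists (fun z => b (pr (g z~l) z~r)).
  by apply: dec_comp hb (rec_pr (rec_comp hg (rec_fst rec_id)) (rec_snd rec_id)).
by move=> n; rewrite bP; split=> -[w h]; exists w; move: h; rewrite unprK.
Qed.

Lemma ce_comp2 (P : nat -> nat -> Prop) f g :
  ce (fun z => P z~l z~r) -> rec f -> rec g ->
  ce (fun n => P (f n) (g n)).
Proof.
move=> hP hf hg; apply: ce_ext (ce_comp hP (rec_pr hf hg)) => n.
by rewrite unprK.
Qed.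

Lemma ce_dec (b : nat -> bool) : dec b -> ce b.
Proof.
move=> hb; exists (fun z => b z~l).
  exact: dec_comp hb (rec_fst rec_id).
by move=> n; split => [|[w]]; [exists 0|]; rewrite unprK.
Qed.

Lemma ce_ex (P : nat -> nat -> Prop) :
  ce (fun z => P z~l z~r) -> ce (fun n => exists m, P n m).
Proof.
move=> [b hb bP].
exists (fun z => b (pr (pr z~l z~r~l) z~r~r)).
  apply: dec_comp hb _; apply: rec_pr; last exact: rec_snd (rec_snd rec_id).
  exact: rec_pr (rec_fst rec_id) (rec_fst (rec_snd rec_id)).
move=> n; split=> [[m]|[w]].
  have := bP (pr n m); rewrite unprK /= => -> [w h].
  by exists (pr m w); rewrite !unprK.
rewrite unprK /= => h; exists w~l.
by have := bP (pr n w~l); rewrite unprK /= => ->; exists w~r.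
Qed.

Lemma ce_and P Q : ce P -> ce Q -> ce (fun n => P n /\ Q n).
Proof.
move=> [b hb bP] [c hc cP].
exists (fun z => b (pr z~l z~r~l) &&
                 c (pr z~l z~r~r)).
  apply: dec_and; apply: dec_comp => //; apply: rec_pr; do ?exact: rec_fst rec_id.
    exact: rec_fst (rec_snd rec_id).
  exact: rec_snd (rec_snd rec_id).
move=> n; rewrite bP cP; split=> [[[w h] [v h']]|[w]].
  by exists (pr w v); rewrite !unprK h h'.
by rewrite unprK => /andP[h h']; split; eexists; eassumption.
Qed.

Lemma ce_or P Q : ce P -> ce Q -> ce (fun n => P n \/ Q n).
Proof.
move=> [b hb bP] [c hc cP]; exists (fun z => b z || c z); first exact: dec_or.
move=> n; rewrite bP cP; split=> [[] [w h]|[w]]; try by exists w; rewrite h ?orbT.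
by move=> /orP[]; [left|right]; exists w.
Qed.

(** Random access into the list codes of [seq_num]; past the end it returns 0. A number thereby
    codes a finite choice function. *)
Definition lk (v i : nat) : nat :=
  (iter i (fun v => v.-1~r) v).-1~l.

Lemma rec_lk f g : rec f -> rec g -> rec (fun n => lk (f n) (g n)).
Proof.
move=> hf hg; apply: rec_fst; apply: rec_pred.
apply: (@rec_iter f (fun=> fun v => v.-1~r)) => //.
exact: rec_snd (rec_pred (rec_snd rec_id)).
Qed.

Lemma lk_seq_num s i : lk (seq_num s) i = nth 0 s i.
Proof.
rewrite /lk; elim: s i => [|x s IH] i; last first.
  by case: i => [|i]; rewrite ?iterSr /= !unprK //= IH.
have -> : iter i (fun v => v.-1~r) (seq_num [::]) = 0.
  by elim: i => //= i ->.
by rewrite nth_nil.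
Qed.

Lemma lk_mkseq (g : nat -> nat) k :
  exists v, forall i, i < k -> lk v i = g i.
Proof.
exists (seq_num (mkseq g k)) => i ik.
by rewrite lk_seq_num nth_mkseq.
Qed.

(** Bounded collection: the finitely many witnesses are packed into one list code. This is why
    bounded universal quantification preserves c.e. predicates. *)
Lemma choice_lk (P : nat -> nat -> Prop) k :
  (forall i, i < k -> exists w, P i w) <->
  exists v, forall i, i < k -> P i (lk v i).
Proof.
split=> [H|[v H] i /H]; last by exists (lk v i).
have /choice[g hg] : forall i, exists w, i < k -> P i w.
  move=> i; have [/H[w]|] := ltnP i k; first by exists w.
  by exists 0.
have [v hv] := lk_mkseq g k.
by exists v => i ik; rewrite hv //; exact: hg.
Qed.

Lemma ce_all (P : nat -> nat -> Prop) k :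
  ce (fun z => P z~l z~r) -> rec k ->
  ce (fun n => forall i, i < k n -> P n i).
Proof.
move=> [b hb bP] hk.
exists (fun z => ~~ bex (k z~l)
   (fun i => ~~ b (pr (pr z~l i) (lk z~r i)))).
  apply: dec_not; apply: dec_bex; last exact: rec_comp hk (rec_fst rec_id).
  apply: dec_not; apply: dec_comp hb _; apply: rec_pr.
    exact: rec_pr (rec_fst (rec_fst rec_id)) (rec_snd rec_id).
  exact: rec_lk (rec_snd (rec_fst rec_id)) (rec_snd rec_id).
have {}bP n i : P n i <-> exists w, b (pr (pr n i) w).
  by have := bP (pr n i); rewrite unprK.
move=> n; transitivity (forall i, i < k n -> exists w, b (pr (pr n i) w)).
  by split=> H i /H; rewrite bP.
rewrite choice_lk; split=> -[v H]; exists v; rewrite !unprK in H *.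
  by apply/negP => /bexP[i /H ->].
by move=> i ik; apply/negP => /negP nb; move/negP: H; apply; apply/bexP; exists i.
Qed.

(** The program pairs the input with the least witness of [P], drops the witness and applies [g];
    the unbounded search for the witness diverges exactly off [P]. *)
Lemma ce_search P g : ce P -> rec g ->
  exists c, forall o n y, Defs.eval o c n y <-> P n /\ y = g n.
Proof.
move=> [b [c hc] bP] [d hd].
have [c' hc'] : dec (fun z => ~~ b z) by apply: dec_not; exists c.
exists (CComp d (CComp CFst (CPair (CPair CFst CSnd) (CMin c')))) => o n y.
have idE m z : Defs.eval o (CPair CFst CSnd) m z <-> z = m.
  split=> /= [[u] [v] [-> ->]|->]; first by rewrite prK.
  by exists m~l, m~r; rewrite prK.
split=> [[m [z [u [v [+ [hv _] zE]]]] mE hm]|[Pn ->]].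
  move=> /idE uE; subst; move: hm; rewrite /= unprK /= => hm.
  have := eval_det hv (hc' o (pr n v)); case bnv: (b _) => //= _.
  split; last exact: eval_det hm (hd o n).
  by apply/bP; exists v.
have ex : exists w, b (pr n w) by apply/bP.
exists n; last exact: hd.
exists (pr n (ex_minn ex)); last by rewrite /= unprK.
exists n, (ex_minn ex); split=> //; first exact/idE.
case: ex_minnP => w bw mw; split=> [|z zw].
  by have := hc' o (pr n w); rewrite bw.
exists 0; have := hc' o (pr n z); case bz: (b _) => //.
by have := mw _ bz; rewrite leqNgt zw.
Qed.

(** Uniformization: the least pair of a value and a witness for it is searched for, and totality of
    [P] makes the search halt. The value found need not respect any equivalence of inputs. *)
Lemma ce_select (P : nat -> nat -> Prop) :
  ce (fun z => P z~l z~r) -> (forall n, exists y, P n y) ->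
  exists2 f, rec f & forall n, P n (f n).
Proof.
move=> [b hb bP] H.
pose Q n := exists w, b (pr (pr n w~l) w~r).
have PQ n : Q n.
  have [y Py] := H n; have [+ _] := bP (pr n y); rewrite unprK => /(_ Py)[w h].
  by exists (pr y w); rewrite unprK.
have [c hc] : dec (fun z => ~~ b (pr (pr z~l z~r~l) z~r~r)).
  apply/dec_not/(dec_comp hb)/rec_pr; last exact: rec_snd (rec_snd rec_id).
  exact: rec_pr (rec_fst rec_id) (rec_fst (rec_snd rec_id)).
exists (fun n => (ex_minn (PQ n))~l).
  apply: rec_fst; exists (CMin c) => o n /=; case: ex_minnP => w bw mw; split.
    by have := hc o (pr n w); rewrite !unprK bw.
  move=> z zw; exists 0; have := hc o (pr n z); rewrite !unprK /=.
  case bz: (b _) => //.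
  by have := mw _ bz; rewrite leqNgt zw.
move=> n; case: ex_minnP => w bw _.
by have [_] := bP (pr n w~l); rewrite unprK; apply; exists w~r.
Qed.

Lemma ce_comp3 (P : nat -> nat -> nat -> Prop) f g k :
  ce (fun z => P z~l z~r~l z~r~r) ->
  rec f -> rec g -> rec k -> ce (fun n => P (f n) (g n) (k n)).
Proof.
move=> hP hf hg hk; apply: ce_ext (ce_comp hP (rec_pr hf (rec_pr hg hk))) => n.
by rewrite !unprK.
Qed.

Lemma ce_eqn f g : rec f -> rec g -> ce (fun n => f n = g n).
Proof.
by move=> hf hg; apply: ce_ext (ce_dec (dec_eqn hf hg)) => n; split => /eqP.
Qed.

(** Not uniform in [P]: which of the two constant programs is correct is decided classically. *)
Lemma ce_const (P : Prop) : ce (fun=> P).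
Proof.
by apply: ce_ext (ce_dec (dec_const `[< P >])) => n; split=> /asboolP.
Qed.

(* [rauto] follows the syntax of a function or predicate; the two hooks are
   redefined when rationals and cuts become available. *)
Ltac rstep_pre := fail.
Ltac rstep_more := fail.
Ltac rstep :=
  first [ assumption | rstep_pre | lazymatch goal with
  | |- rec (fun n => n) => exact rec_id
  | |- rec (fun _ => ?k) => exact (rec_const k)
  | |- rec (fun n => nat_of_bool (@?b n)) => change (dec b)
  | |- rec (fun n => S (@?f n)) => refine (@rec_S f _)
  | |- rec (fun n => predn (@?f n)) => refine (@rec_pred f _)
  | |- rec (fun n => fst (unpr (@?f n))) => refine (@rec_fst f _)
  | |- rec (fun n => snd (unpr (@?f n))) => refine (@rec_snd f _)
  | |- rec (fun n => pr (@?f n) (@?g n)) => refine (@rec_pr f g _ _)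
  | |- rec (fun n => addn (@?f n) (@?g n)) => refine (@rec_add f g _ _)
  | |- rec (fun n => subn (@?f n) (@?g n)) => refine (@rec_sub f g _ _)
  | |- rec (fun n => muln (@?f n) (@?g n)) => refine (@rec_mul f g _ _)
  | |- rec (fun n => expn (@?f n) (@?g n)) => refine (@rec_exp f g _ _)
  | |- rec (fun n => lk (@?f n) (@?g n)) => refine (@rec_lk f g _ _)
  | |- rec (fun n => if _ then _ else _) => apply rec_if
  | |- dec (fun n => ~~ (@?b n)) => refine (@dec_not b _)
  | |- dec (fun n => (@?b n) && (@?c n)) => refine (@dec_and b c _ _)
  | |- dec (fun n => (@?b n) || (@?c n)) => refine (@dec_or b c _ _)
  | |- dec (fun n => leq (S (@?f n)) (@?g n)) => refine (@dec_ltn f g _ _)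
  | |- dec (fun n => leq (@?f n) (@?g n)) => refine (@dec_leq f g _ _)
  | |- dec (fun n => @eq_op _ (@?f n) (@?g n)) => refine (@dec_eqn f g _ _)
  | |- dec (fun n => bex (@?k n) (fun i => @?b n i)) => refine (@dec_bex b k _ _)
  | |- ce (fun _ => ?P) => exact (ce_const P)
  | |- ce (fun n => (@?P n) /\ (@?Q n)) => refine (@ce_and P Q _ _)
  | |- ce (fun n => (@?P n) \/ (@?Q n)) => refine (@ce_or P Q _ _)
  | |- ce (fun n => exists m, @?P n m) => refine (@ce_ex P _)
  | |- ce (fun n => forall i, is_true (i < @?k n) -> @?P n i) => refine (@ce_all P k _ _)
  | |- ce (fun n => is_true (@?b n)) => refine (@ce_dec b _)
  | |- ce (fun n => @eq nat (@?f n) (@?g n)) => refine (@ce_eqn f g _ _)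
  end
  | rstep_more
  | match goal with
  | H : rec ?f |- rec (fun n => ?f (@?g n)) => refine (@rec_comp f g H _)
  | H : rec (fun z => ?h z~l z~r) |- rec (fun n => ?h (@?f n) (@?g n)) =>
      refine (@rec_comp2 h f g H _ _)
  | H : dec ?b |- dec (fun n => ?b (@?g n)) => refine (@dec_comp b g H _)
  | H : dec (fun z => ?h z~l z~r) |- dec (fun n => ?h (@?f n) (@?g n)) =>
      refine (@rec_comp2 (fun x y => nat_of_bool (h x y)) f g H _ _)
  | H : ce ?P |- ce (fun n => ?P (@?g n)) => refine (@ce_comp P g H _)
  | H : ce (fun z => ?h z~l z~r) |- ce (fun n => ?h (@?f n) (@?g n)) =>
      refine (@ce_comp2 h f g H _ _)
  | H : ce (fun z => ?h z~l z~r~l z~r~r) |-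
      ce (fun n => ?h (@?f n) (@?g n) (@?k n)) => refine (@ce_comp3 h f g k H _ _ _)
  end ]; cbv beta.
Ltac rauto := cbv beta; repeat rstep.

(** * The graph of the universal partial computable function is c.e *)

Lemma code_num_inj c d : code_num c = code_num d -> c = d.
Proof.
elim: c d => [||||| c IHc c' IHc'|c IHc c' IHc'|c IHc c' IHc'|c IHc]
  [||||| d d'| d d'| d d'| d] //= E;
  first [lia | congr CMin; apply: IHc; lia
    | by have /pr_inj[/IHc -> /IHc' ->] : pr (code_num c) (code_num c') =
        pr (code_num d) (code_num d') by lia].
Qed.

(** Above 4 the number is [5 + 4 q + r] with [r < 4], and both [q] and its components are smaller.
    Needed because a base case of primitive recursion in a derivation certifies only one of the two
    subprograms; the other number is then still a program. *)
Lemma code_num_surj e : exists c, code_num c = e.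
Proof.
elim/ltn_ind: e => e IH.
have [e4|e4] := leqP e 4.
  move: e4 IH; case: e => [|[|[|[|[|//]]]]] _ _.
  - by exists CZero. - by exists CSucc. - by exists CFst. - by exists CSnd.
  - by exists COracle.
pose q := (e - 5) %/ 4.
have qe : q < e by rewrite /q; lia.
have [ab1 ab2] := leq_pr q~l q~r; rewrite prK in ab1 ab2.
have [|c hc] := IH q~l; first exact: leq_ltn_trans qe.
have [|d hd] := IH q~r; first exact: leq_ltn_trans qe.
have [c' hc'] := IH q qe.
have : [\/ e = 5 + 4 * q, e = 6 + 4 * q, e = 7 + 4 * q | e = 8 + 4 * q].
  have : (e - 5) %% 4 < 4 by lia.
  have : e = 5 + (q * 4 + (e - 5) %% 4) by rewrite /q; lia.
  case: ((e - 5) %% 4) => [|[|[|[|//]]]] -> _.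
  - by constructor 1; lia. - by constructor 2; lia.
  - by constructor 3; lia. - by constructor 4; lia.
case=> ->; [exists (CPair c d)|exists (CComp c d)|exists (CPrec c d)|exists (CMin c')];
  by rewrite /= ?hc ?hd ?prK ?hc'.
Qed.

Lemma phi_det e x y z : phi e x y -> phi e x z -> y = z.
Proof.
move=> [c <- hc] [d /code_num_inj -> hd]; exact: eval_det hc hd.
Qed.

(* [t] is <e,x,y>, where phi_e(x) = y is derived in one step from the
   facts in [S]. *)
Definition step (S : nat -> Prop) (t : nat) : Prop :=
  let e := t~l in let x := t~r~l in
  let y := t~r~r in
  (e = 0 /\ y = 0) \/ (e = 1 /\ y = x.+1) \/ (e = 2 /\ y = x~l) \/
  (e = 3 /\ y = x~r) \/ (e = 4 /\ y = 0) \/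
  (exists a, exists b, e = 5 + 4 * pr a b /\ S (pr a (pr x y~l)) /\
     S (pr b (pr x y~r))) \/
  (exists a, exists b, e = 6 + 4 * pr a b /\
     exists z, S (pr b (pr x z)) /\ S (pr a (pr z y))) \/
  (exists a, exists b, e = 7 + 4 * pr a b /\
     ((x~r = 0 /\ S (pr a (pr x~l y))) \/
      exists n, x~r = n.+1 /\
        exists z, S (pr e (pr (pr x~l n) z)) /\
          S (pr b (pr (pr x~l (pr n z)) y)))) \/
  (exists a, e = 8 + 4 * a /\ S (pr a (pr (pr x y) 0)) /\
     forall z, z < y -> exists t, S (pr a (pr (pr x z) t.+1))).

Lemma step_mono (S S' : nat -> Prop) t :
  (forall u, S u -> S' u) -> step S t -> step S' t.
Proof.
move=> SS' []; [by left|move=> h; right; move: h].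
move=> []; [by left|move=> h; right; move: h].
move=> []; [by left|move=> h; right; move: h].
move=> []; [by left|move=> h; right; move: h].
move=> []; [by left|move=> h; right; move: h].
case=> [[a [b [-> [/SS' h /SS' h']]]]|h]; [by left; exists a, b|right; move: h].
case=> [[a [b [-> [z [/SS' h /SS' h']]]]]|h].
  by left; exists a, b; split=> //; exists z.
right; case: h => [[a [b [-> h]]]|[a [-> [/SS' h h']]]]; [left|right].
  exists a, b; split=> //; case: h => [[x0 /SS' h]|[n [xn [z [/SS' h /SS' h']]]]]; [left|right] => //.
  by exists n; split=> //; exists z.
by exists a; split=> //; split=> // z /h'[u /SS' ?]; exists u.
Qed.

Definition derivation (l : seq nat) :=
  forall i, i < size l -> step (fun u => u \in take i l) (nth 0 l i).

Lemma derivation_cat l l' : derivation l -> derivation l' -> derivation (l ++ l').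
Proof.
move=> hl hl' i; rewrite size_cat nth_cat take_cat => il.
case: ltnP => li; first exact: hl.
by apply: step_mono (hl' (i - size l) _) => [u ul|]; [rewrite mem_cat ul orbT|lia].
Qed.

Lemma derivation_rcons l t :
  derivation l -> step (fun u => u \in l) t -> derivation (rcons l t).
Proof.
move=> hl ht i; rewrite size_rcons nth_rcons ltnS leq_eqVlt => /orP[/eqP ->|il].
  by rewrite ltnn eqxx -cats1 take_size_cat.
by rewrite il -cats1 takel_cat; [exact: hl|exact: ltnW].
Qed.

Lemma derivation_sound l : derivation l ->
  forall i, i < size l ->
  phi (nth 0 l i)~l (nth 0 l i)~r~l (nth 0 l i)~r~r.
Proof.
move=> hl; elim/ltn_ind => i IH il.
have {}IH e x y : pr e (pr x y) \in take i l -> phi e x y.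
  move=> /(nthP 0)[j]; rewrite size_take il => ji.
  rewrite nth_take // => E; have := IH _ ji (ltn_trans ji il).
  by rewrite E !unprK.
have := hl _ il; rewrite /step.
move: (nth 0 l i)~l (nth 0 l i)~r~l
      (nth 0 l i)~r~r => e x y.
case=> [[-> ->]|]; first by exists CZero.
case=> [[-> ->]|]; first by exists CSucc.
case=> [[-> ->]|]; first by exists CFst.
case=> [[-> ->]|]; first by exists CSnd.
case=> [[-> ->]|]; first by exists COracle.
case=> [[a [b [-> [/IH[c <- hc] /IH[d <- hd]]]]]|].
  by exists (CPair c d) => //=; exists y~l, y~r; rewrite prK.
case=> [[a [b [-> [z [/IH[d <- hd] /IH[c <- hc]]]]]]|].
  by exists (CComp c d) => //=; exists z.
case=> [[a [b [-> h]]]|[a [-> [/IH[c <- hc] h]]]].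
  have [c0 c0a] := code_num_surj a; have [d0 d0b] := code_num_surj b.
  exists (CPrec c0 d0); first by rewrite /= c0a d0b.
  case: h => [[x0 /IH[c cE hc]]|[n [xn [z [/IH[p pE hp] /IH[d dE hd]]]]]] /=.
    by rewrite x0 /=; rewrite -c0a in cE; move/code_num_inj: cE => <-.
  rewrite xn /=; exists z; last by rewrite -d0b in dE; move/code_num_inj: dE => <-.
  move: pE hp; rewrite -c0a -d0b => /(@code_num_inj p (CPrec c0 d0)) -> /=.
  by rewrite unprK.
exists (CMin c) => //=; split=> // z /h[t /IH[d /code_num_inj -> hd]].
by exists t.
Qed.

Lemma derivation_complete c x y : Defs.eval (fun=> 0) c x y ->
  exists2 l, derivation l & pr (code_num c) (pr x y) \in l.
Proof.
have one t : step (fun=> False) t -> exists2 l, derivation l & t \in l.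
  move=> ht; exists [:: t]; last by rewrite mem_seq1.
  by move=> [|//] _ /=; apply: step_mono ht.
have add l t : derivation l -> step (fun u => u \in l) t ->
    exists2 l, derivation l & t \in l.
  move=> hl ht; exists (rcons l t); first exact: derivation_rcons.
  by rewrite mem_rcons mem_head.
elim: c x y => [||||| c IHc d IHd|c IHc d IHd|c IHc d IHd|c IHc] x y /=.
- by move=> ->; apply: one; rewrite /step !unprK; left.
- by move=> ->; apply: one; rewrite /step !unprK; right; left.
- by move=> ->; apply: one; rewrite /step !unprK; do 2!right; left.
- by move=> ->; apply: one; rewrite /step !unprK; do 3!right; left.
- by move=> ->; apply: one; rewrite /step !unprK; do 4!right; left.
- move=> [z] [t] [/IHc[l1 hl1 zl1] /IHd[l2 hl2 tl2] ->].
  apply: (add (l1 ++ l2)); first exact: derivation_cat.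
  rewrite /step !unprK; do 5!right; left.
  by do 2!eexists; split; [reflexivity|rewrite !mem_cat zl1 tl2 orbT].
- move=> [z /IHd[l1 hl1 zl1] /IHc[l2 hl2 tl2]].
  apply: (add (l1 ++ l2)); first exact: derivation_cat.
  rewrite /step !unprK; do 6!right; left.
  do 2!eexists; split; [reflexivity|exists z].
  by rewrite !mem_cat zl1 tl2 orbT.
- rewrite -[in pr x y](prK x); move: (unpr x) => [a n] /=.
  elim: n y => [|n IHn] y /= => [/IHc[l hl il]|[z /IHn[l1 hl1 zl1] /IHd[l2 hl2 tl2]]].
    apply: (add l) => //; rewrite /step !unprK; do 7!right; left.
    by do 2!eexists; split; [reflexivity|left].
  apply: (add (l1 ++ l2)); first exact: derivation_cat.
  rewrite /step !unprK; do 7!right; left.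
  do 2!eexists; split; [reflexivity|right].
  by exists n; split=> //; exists z; rewrite !mem_cat zl1 tl2 orbT.
- move=> [/IHc[l hl il] h].
  have [l' hl' hz] : exists2 l', derivation l' &
      forall z, z < y -> exists t, pr (code_num c) (pr (pr x z) t.+1) \in l'.
    elim: y h {l hl il} => [|y IHy] h; first by exists [::].
    have [|l' hl' hz] := IHy; first by move=> z zy; apply: h; exact: ltnW.
    have [t /IHc[l hl il]] := h y (ltnSn _).
    exists (l ++ l'); first exact: derivation_cat.
    move=> z; rewrite ltnS leq_eqVlt => /orP[/eqP ->|/hz[u ul']].
      by exists t; rewrite mem_cat il.
    by exists u; rewrite mem_cat ul' orbT.
  apply: (add (l ++ l')); first exact: derivation_cat.
  rewrite /step !unprK; do 8!right.
  eexists; split; [reflexivity|split; first by rewrite mem_cat il].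
  by move=> z /hz[t tl']; exists t; rewrite mem_cat tl' orbT.
Qed.

Lemma phiE e x y : phi e x y <-> exists v, exists N,
  (forall i, i < N -> step (fun u => exists j, j < i /\ lk v j = u) (lk v i)) /\
  exists i, i < N /\ lk v i = pr e (pr x y).
Proof.
split=> [[c <- /derivation_complete[l hl il]]|[v [N [h [i [iN vi]]]]]].
  exists (seq_num l), (size l); split=> [i il'|].
    rewrite lk_seq_num; apply: step_mono (hl i il') => u /(nthP 0)[j].
    rewrite size_take il' => ji; rewrite nth_take // => <-.
    by exists j; rewrite lk_seq_num.
  move: il => /(nthP 0)[i il' E].
  by exists i; rewrite lk_seq_num.
pose l := mkseq (lk v) N.
have hl : derivation l.
  move=> j; rewrite size_mkseq => jN; rewrite nth_mkseq //.
  apply: step_mono (h j jN) => u [k [kj <-]].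
  apply/(nthP 0); exists k; rewrite ?size_take ?size_mkseq ?jN //.
  by rewrite nth_take // nth_mkseq //; exact: ltn_trans jN.
have := derivation_sound hl (i := i); rewrite size_mkseq => /(_ iN).
by rewrite nth_mkseq // vi !unprK.
Qed.

Lemma ce_step (S : nat -> nat -> Prop) g :
  ce (fun z => S z~l z~r) -> rec g ->
  ce (fun n => step (S n) (g n)).
Proof. by move=> hS hg; rewrite /step /=; rauto. Qed.

Lemma ce_phi : ce (fun z => phi z~l z~r~l z~r~r).
Proof.
apply: ce_ext (fun z => iff_sym (phiE _ _ _)) _.
rauto.
lazymatch goal with
| |- ce (fun z => step (@?S z) (@?g z)) => refine (@ce_step S g _ _)
end; rauto.
Qed.

(** A search finds some value of the program, and since [phi] is single-valued it is the one that
    satisfies [Q]. Every hypothesis that provides indices uniformly enters through this lemma. *)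
Lemma yields_select e r (Q : nat -> nat -> Prop) : rec e -> rec r ->
  (forall n, yields (e n) (r n) (Q n)) -> exists2 f, rec f & forall n, Q n (f n).
Proof.
move=> he hr H.
have [|n|f hf fP] := @ce_select (fun n y => phi (e n) (r n) y).
- by have := ce_phi => ?; rauto.
- by have [y] := H n; exists y.
- exists f => // n; have [y ey Qy] := H n.
  by rewrite (phi_det (fP n) ey).
Qed.

Lemma yieldsT e x : yields e x (fun=> True) <-> exists y, phi e x y.
Proof. by split=> [[y]|[y]]; exists y. Qed.

Lemma ce_yieldsT : ce (fun z => yields z~l z~r (fun=> True)).
Proof.
apply: ce_ext (fun z => iff_sym (yieldsT _ _)) _.
by have := ce_phi => ?; rauto.
Qed.

Fixpoint cconst n := if n is m.+1 then CComp CSucc (cconst m) else CZero.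

Lemma eval_cconst o n x y : Defs.eval o (cconst n) x y <-> y = n.
Proof.
elim: n y => [|n IH] y //=; split=> [[z /IH -> ->]//|->].
by exists n => //; apply/IH.
Qed.

Lemma rec_code_num_cconst : rec (fun n => code_num (cconst n)).
Proof.
have : rec (fun n => iter n (fun r => 6 + 4 * pr 1 r) 0).
  by apply: (@rec_iter _ (fun _ r => 6 + 4 * pr 1 r)); rauto.
by apply: rec_ext; elim=> //= n ->.
Qed.

(** The s-m-n theorem: the program of [ce_search] with the parameter hard-wired as a [cconst], whose
    code is recursive in the parameter. *)
Lemma smn P g : ce P -> rec g -> exists2 J, rec J &
  forall n x y, phi (J n) x y <-> P (pr n x) /\ y = g (pr n x).
Proof.
move=> hP hg; have [c hc] := ce_search hP hg.
pose J n := CComp c (CPair (cconst n) (CPair CFst CSnd)).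
exists (fun n => code_num (J n)).
  by have := rec_code_num_cconst => ?; rewrite /J /=; rauto.
move=> n x y; rewrite -(hc (fun=> 0)).
have h y' : Defs.eval (fun=> 0) (CPair (cconst n) (CPair CFst CSnd)) x y' <-> y' = pr n x.
  split=> [[a] [b] [/eval_cconst -> [u [v [-> -> ->]]] ->]|->]; first by rewrite prK.
  exists n, x; split=> //; first exact/eval_cconst.
  by exists x~l, x~r; rewrite prK.
split=> [[d /code_num_inj ->] [z /h -> //]|hx].
by exists (J n) => //; exists (pr n x) => //; apply/h.
Qed.

Lemma smn_rec f : rec f -> exists2 J, rec J & forall n x, phi (J n) x (f (pr n x)).
Proof.
move=> hf; have [J hJ H] := smn (ce_const True) hf.
by exists J => // n x; apply/H.
Qed.


Local Open Scope classical_set_scope.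
Local Open Scope ring_scope.


(** * Computable sequences of rationals *)

Definition qrec (F : nat -> rat) := exists2 g, rec g & forall n, F n = qnum (g n).

Lemma qrec_ext F G : F =1 G -> qrec F -> qrec G.
Proof. by move=> FG [g hg gE]; exists g => // n; rewrite -FG. Qed.

Lemma qrec_comp F g : qrec F -> rec g -> qrec (fun n => F (g n)).
Proof.
by move=> [f hf fE] hg; exists (fun n => f (g n)); [rauto|move=> n; rewrite fE].
Qed.

Lemma qrec_comp2 (F : nat -> nat -> rat) f g :
  qrec (fun z => F z~l z~r) -> rec f -> rec g ->
  qrec (fun n => F (f n) (g n)).
Proof.
move=> hF hf hg; have := qrec_comp hF (rec_pr hf hg).
by apply: qrec_ext => n; rewrite unprK.
Qed.

Lemma qrec_qnum f : rec f -> qrec (fun n => qnum (f n)).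
Proof. by move=> hf; exists f. Qed.

Lemma qnumE a b c : qnum (pr a (pr b c)) = (a%:R - b%:R) / c.+1%:R.
Proof. by rewrite /qnum !unprK. Qed.

Lemma qnum_def k :
  qnum k = (k~l%:R - k~r~l%:R) / k~r~r.+1%:R.
Proof. by []. Qed.

Lemma qrec_nat f : rec f -> qrec (fun n => (f n)%:R).
Proof.
move=> hf; exists (fun n => pr (f n) (pr 0 0)); first by rauto.
by move=> n; rewrite qnumE subr0 divr1.
Qed.

Lemma qrec_invS f : rec f -> qrec (fun n => (f n).+1%:R^-1).
Proof.
move=> hf; exists (fun n => pr 1 (pr 0 (f n))); first by rauto.
by move=> n; rewrite qnumE subr0 mul1r.
Qed.

Lemma qrec_opp F : qrec F -> qrec (fun n => - F n).
Proof.
move=> [f hf fE].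
exists (fun n => pr (f n)~r~l (pr (f n)~l (f n)~r~r)).
  by rauto.
by move=> n; rewrite fE qnumE /qnum -mulNr opprB.
Qed.

(** Addition of fractions by cross-multiplication; denominators are stored minus one, hence the
    final predecessor. *)
Definition qadd k l := (let c := k~r~r.+1 in let d := l~r~r.+1 in
  pr (k~l * d + l~l * c)
     (pr (k~r~l * d + l~r~l * c) (c * d).-1))%N.

Lemma qnum_qadd k l : qnum (qadd k l) = qnum k + qnum l.
Proof.
rewrite /qadd qnumE prednK // /qnum !natrD !natrM.
by field; rewrite !nat1r !pnatr_eq0.
Qed.

Lemma rec_qadd f g : rec f -> rec g -> rec (fun n => qadd (f n) (g n)).
Proof. by move=> hf hg; rewrite /qadd; rauto. Qed.

Lemma qrec_add F G : qrec F -> qrec G -> qrec (fun n => F n + G n).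
Proof.
move=> [f hf fE] [g hg gE]; exists (fun n => qadd (f n) (g n)).
  exact: rec_qadd.
by move=> n; rewrite qnum_qadd fE gE.
Qed.

Lemma qrec_mul F G : qrec F -> qrec G -> qrec (fun n => F n * G n).
Proof.
move=> [f hf fE] [g hg gE].
pose a n := (f n)~l; pose b n := (f n)~r~l.
pose c n := (f n)~r~r.+1.
pose a' n := (g n)~l; pose b' n := (g n)~r~l.
pose c' n := (g n)~r~r.+1.
exists (fun n => pr (a n * a' n + b n * b' n)%N
  (pr (a n * b' n + b n * a' n)%N (c n * c' n).-1)%N).
  by rewrite /a /b /c /a' /b' /c'; rauto.
move=> n; rewrite qnumE prednK // /qnum fE gE /qnum.
rewrite -/(a n) -/(b n) -/(c n) -/(a' n) -/(b' n) -/(c' n) !natrD !natrM.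
by field; rewrite !pnatr_eq0.
Qed.

Lemma qrec_if b F G : dec b -> qrec F -> qrec G ->
  qrec (fun n => if b n then F n else G n).
Proof.
move=> hb [f hf fE] [g hg gE]; exists (fun n => if b n then f n else g n).
  by rauto.
by move=> n; case: ifP.
Qed.

Lemma qrec_exp2 f : rec f -> qrec (fun n => 2 ^- (f n)).
Proof.
move=> hf; apply: qrec_ext (@qrec_invS (fun n => (2 ^ f n).-1)%N _) => [n|]; last by rauto.
by rewrite prednK ?expn_gt0 // natrX.
Qed.

Lemma qrec_sum (F : nat -> nat -> rat) k :
  qrec (fun z => F z~l z~r) -> rec k ->
  qrec (fun n => \sum_(i < k n) F n i).
Proof.
move=> [f hf fE] hk.
exists (fun n => iteri (k n) (fun i r => qadd (f (pr n i)) r) (pr 0 (pr 0 0))).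
  apply: (@rec_iteri (fun=> pr 0 (pr 0 0)) (fun n i r => qadd (f (pr n i)) r)) => //.
    by rauto.
  by apply: rec_qadd; rauto.
move=> n; elim: (k n) => [|m IH]; first by rewrite big_ord0 /= qnumE subrr mul0r.
by rewrite big_ord_recr /= qnum_qadd -IH addrC -fE !unprK.
Qed.

Lemma dec_qle F G : qrec F -> qrec G -> dec (fun n => F n <= G n).
Proof.
move=> [f hf fE] [g hg gE].
pose a n := (f n)~l; pose b n := (f n)~r~l.
pose c n := (f n)~r~r.+1.
pose a' n := (g n)~l; pose b' n := (g n)~r~l.
pose c' n := (g n)~r~r.+1.
apply: dec_ext (_ : dec (fun n => (a n * c' n + b' n * c n <= a' n * c n + b n * c' n)%N)).
  move=> n; rewrite fE gE /qnum.
  rewrite -/(a n) -/(b n) -/(c n) -/(a' n) -/(b' n) -/(c' n).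
  rewrite ler_pdivrMr ?ltr0n // mulrAC ler_pdivlMr ?ltr0n //.
  by rewrite !mulrBl lerBlDr addrAC lerBrDr -!natrM -!natrD ler_nat.
by rewrite /a /b /c /a' /b' /c'; rauto.
Qed.

Lemma dec_qlt F G : qrec F -> qrec G -> dec (fun n => F n < G n).
Proof.
move=> hF hG; apply: dec_ext (dec_not (dec_qle hG hF)) => n.
by rewrite -ltNge.
Qed.

Lemma dec_qeq F G : qrec F -> qrec G -> dec (fun n => F n == G n).
Proof.
move=> hF hG; apply: dec_ext (dec_and (dec_qle hF hG) (dec_qle hG hF)) => n.
by rewrite -eq_le.
Qed.

Lemma qnum_surj q : exists k, qnum k = q.
Proof.
have [n hn] : exists n, denq q = n.+1%:Z.
  by have := denq_gt0 q; case: (denq q) => [[|n]|n] // _; exists n.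
have h : (denq q)%:~R = n.+1%:R :> rat by rewrite hn.
case: (numq q) (divq_num_den q) => m E.
  by exists (pr m (pr 0 n)); rewrite qnumE subr0 -E h.
by exists (pr 0 (pr m.+1 n)); rewrite qnumE sub0r -E NegzE h mulrNz.
Qed.

Lemma qrec_const q : qrec (fun=> q).
Proof. by have [k <-] := qnum_surj q; apply: qrec_qnum; rauto. Qed.

Lemma qpos_gt0 k : 0 < qpos k.
Proof. by rewrite divr_gt0 ?ltr0n. Qed.

Lemma qpos_surj q : 0 < q -> exists k, qpos k = q.
Proof.
move=> q0; have [n hn] : exists n, denq q = n.+1%:Z.
  by have := denq_gt0 q; case: (denq q) => [[|n]|n] // _; exists n.
have h : (denq q)%:~R = n.+1%:R :> rat by rewrite hn.
have := q0; rewrite -numq_gt0.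
case: (numq q) (divq_num_den q) => [[|m]|m] E // _.
by exists (pr m n); rewrite /qpos !unprK -E h.
Qed.

Lemma qrec_qpos f : rec f -> qrec (fun n => qpos (f n)).
Proof.
move=> hf; apply: (@qrec_mul (fun n => (f n)~l.+1%:R)
  (fun n => (f n)~r.+1%:R^-1)).
  by apply: (@qrec_nat (fun n => (f n)~l.+1)); rauto.
by apply: (@qrec_invS (fun n => (f n)~r)); rauto.
Qed.

Ltac rstep_more ::=
  lazymatch goal with
  | |- rec (fun n => qadd (@?f n) (@?g n)) => refine (@rec_qadd f g _ _)
  | |- qrec (fun _ => ?q) => exact (qrec_const q)
  | |- qrec (fun n => qnum (@?f n)) => refine (@qrec_qnum f _)
  | |- qrec (fun n => qpos (@?f n)) => refine (@qrec_qpos f _)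
  | |- qrec (fun n => GRing.natmul 1 (@?f n)) => refine (@qrec_nat f _)
  | |- qrec (fun n => GRing.inv (GRing.natmul 1 (S (@?f n)))) => refine (@qrec_invS f _)
  | |- qrec (fun n => GRing.inv (GRing.exp 2 (@?f n))) => refine (@qrec_exp2 f _)
  | |- qrec (fun n => GRing.opp (@?f n)) => refine (@qrec_opp f _)
  | |- qrec (fun n => GRing.add (@?f n) (@?g n)) => refine (@qrec_add f g _ _)
  | |- qrec (fun n => GRing.mul (@?f n) (@?g n)) => refine (@qrec_mul f g _ _)
  | |- qrec (fun n => if _ then _ else _) => apply qrec_if
  | |- dec (fun n => Order.le (@?f n) (@?g n)) => refine (@dec_qle f g _ _)
  | |- dec (fun n => Order.lt (@?f n) (@?g n)) => refine (@dec_qlt f g _ _)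
  | |- dec (fun n => @eq_op _ (@?f n) (@?g n)) => refine (@dec_qeq f g _ _)
  | H : qrec ?F |- qrec (fun n => ?F (@?g n)) => refine (@qrec_comp F g H _)
  | H : qrec (fun z => ?h z~l z~r) |- qrec (fun n => ?h (@?f n) (@?g n)) =>
      refine (@qrec_comp2 h f g H _ _)
  end.

(** * Left-c.e. reals, open sets and lower semicomputable functions *)

#[local] Opaque qnum.

Section cuts.
Context {R : realType}.
Implicit Types (y : nat -> R).

(* The [y n] are uniformly left-c.e.; they are uniformly computable when the
   [- y n] are left-c.e. too. *)
Definition lcut y := ce (fun w => ratr (qnum w~r) < y w~l).

Lemma lcut_ext y (z : nat -> R) : y =1 z -> lcut y -> lcut z.
Proof. by move=> yz; apply: ce_ext => n; rewrite yz. Qed.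

Lemma lcut_ce (P : nat -> nat -> Prop) y :
  ce (fun w => P w~l w~r) ->
  (forall n k, P n k <-> ratr (qnum k) < y n) -> lcut y.
Proof. by move=> hP Py; apply: ce_ext hP => w; rewrite Py. Qed.

Lemma ce_lcut y F g : lcut y -> qrec F -> rec g ->
  ce (fun n => ratr (F n) < y (g n)).
Proof.
move=> hy [f hf fE] hg.
apply: ce_ext (ce_comp hy (rec_pr hg hf)) => n.
by rewrite !unprK fE.
Qed.

Lemma ce_lcut2 (y : nat -> nat -> R) F f g : lcut (fun z => y z~l z~r) ->
  qrec F -> rec f -> rec g -> ce (fun n => ratr (F n) < y (f n) (g n)).
Proof.
move=> hy hF hf hg; apply: ce_ext (ce_lcut hy hF (rec_pr hf hg)) => n.
by rewrite !unprK.
Qed.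

Ltac rstep_pre ::= match goal with
  | H : lcut ?y |- ce (fun n => is_true (Order.lt (ratr (@?F n)) (?y (@?g n)))) =>
    refine (@ce_lcut y F g H _ _)
  | H : lcut (fun z => ?y z~l z~r) |-
      ce (fun n => is_true (Order.lt (ratr (@?F n)) (?y (@?f n) (@?g n)))) =>
    refine (@ce_lcut2 y F f g H _ _ _)
  | H : lcut (fun z => - ?y z) |- ce (fun n => is_true (Order.lt (ratr (@?F n)) (- ?y (@?g n)))) =>
    refine (@ce_lcut (fun z => - y z) F g H _ _)
  | H : lcut (fun z => - ?y z~l z~r) |-
      ce (fun n => is_true (Order.lt (ratr (@?F n)) (- ?y (@?f n) (@?g n)))) =>
    refine (@ce_lcut2 (fun a b => - y a b) F f g H _ _ _)
  end.

Lemma lcut_comp y g : lcut y -> rec g -> lcut (fun n => y (g n)).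
Proof.
move=> hy hg; apply: (@lcut_ce (fun n k => ratr (qnum k) < y (g n))) => //.
by rauto.
Qed.

Lemma lcut_qrec F : qrec F -> lcut (fun n => ratr (F n)).
Proof.
move=> hF; apply: (@lcut_ce (fun n k => qnum k < F n)); first by rauto.
by move=> n k; rewrite ltr_rat.
Qed.

Lemma qnum_dense (a b : R) : a < b -> exists k, a < ratr (qnum k) /\ ratr (qnum k) < b.
Proof.
move=> /rat_in_itvoo[q]; have [k <-] := qnum_surj q.
by rewrite in_itv /= => /andP[]; exists k.
Qed.

Lemma lcut_add y (z : nat -> R) : lcut y -> lcut z -> lcut (fun n => y n + z n).
Proof.
move=> hy hz; apply: (@lcut_ce (fun n k => exists l,
    ratr (qnum l) < y n /\ ratr (qnum k - qnum l) < z n)).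
  by rauto.
move=> n k; split=> [[l [ly lz]]|h].
  by rewrite -(subrK (qnum l) (qnum k)) addrC rmorphD ltrD.
have [l [h1 h2]] := @qnum_dense (ratr (qnum k) - z n) (y n) ltac:(lra).
by exists l; split=> //; rewrite rmorphB /=; lra.
Qed.

Lemma lcut_scale F y : qrec F -> (forall n, 0 <= F n) -> lcut y ->
  lcut (fun n => ratr (F n) * y n).
Proof.
move=> hF F0 hy; apply: (@lcut_ce (fun n k => exists l,
    ratr (qnum l) < y n /\ qnum k < F n * qnum l)).
  by rauto.
move=> n k; have F0' : 0 <= ratr (F n) :> R by rewrite ler0q.
split=> [[l [ly lz]]|h].
  apply: (@lt_le_trans _ _ (ratr (F n * qnum l))); first by rewrite ltr_rat.
  by rewrite rmorphM ler_wpM2l // ltW.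
(* For a zero factor the product is 0 and any rational below [y n] is a witness; a positive factor
   allows division. *)
move: F0'; rewrite le_eqVlt => /orP[/eqP F00|Fp].
  have [l [_ hl]] := @qnum_dense (y n - 1) (y n) ltac:(lra).
  exists l; split=> //; rewrite -(ltr_rat R) (rmorphM _ (F n)) /= -F00 mul0r.
  by move: h; rewrite -F00 mul0r.
have [|l [h1 h2]] := @qnum_dense (ratr (qnum k) / ratr (F n)) (y n).
  by rewrite ltr_pdivrMr // mulrC.
exists l; split=> //; rewrite -(ltr_rat R) (rmorphM _ (F n)) /=.
by move: h1; rewrite ltr_pdivrMr // mulrC.
Qed.

(** Applied to [- y] with computable lower bounds that come arbitrarily close, it gives the upper
    cut of [y]. This is how the integrals below are bounded from above: an approximation plus an
    explicit error. *)
Lemma lcut_approx (z : nat -> nat -> R) y :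
  lcut (fun n => z n~l n~r) ->
  (forall n m, z n m <= y n) -> (forall n e, 0 < e -> exists m, y n - e < z n m) ->
  lcut y.
Proof.
move=> hz zy yz; apply: (@lcut_ce (fun n k => exists m, ratr (qnum k) < z n m)).
  by rauto.
move=> n k; split=> [[m /lt_le_trans]|h]; first exact.
have [m hm] := yz n (y n - ratr (qnum k)) ltac:(lra).
by exists m; lra.
Qed.

Lemma lcut_sum (y : nat -> nat -> R) k :
  lcut (fun z => y z~l z~r) -> rec k ->
  lcut (fun n => \sum_(i < k n) y n i).
Proof.
move=> hy hk; apply: (@lcut_ce (fun n l => exists v,
    (forall i, (i < k n)%N -> ratr (qnum (lk v i)) < y n i) /\
    qnum l < \sum_(i < k n) qnum (lk v i))).
  rauto.
  by apply: (@qrec_sum (fun z i => qnum (lk z~r i))); rauto.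
move=> n l; split=> [[v [hv]]|h].
  rewrite -(ltr_rat R) rmorph_sum => /lt_le_trans; apply.
  by apply: ler_sum => i _; rewrite ltW // hv.
(* The gap is divided by one more than the number of summands, so that losing [d] in each of them
   keeps the sum strictly above the target, also when there are no summands. *)
pose d := (\sum_(i < k n) y n i - ratr (qnum l)) / (k n).+1%:R.
have d0 : 0 < d by rewrite divr_gt0 ?subr_gt0.
have /choice[g hg] : forall i, exists j, y n i - d < ratr (qnum j) /\ ratr (qnum j) < y n i.
  by move=> i; apply: qnum_dense; lra.
have [v hv] := lk_mkseq g (k n).
exists v; split=> [i ik|]; first by rewrite hv // (hg i).2.
rewrite -(ltr_rat R) rmorph_sum /=.
apply: (@lt_le_trans _ _ (\sum_(i < k n) (y n i - d))); last first.
  by apply: ler_sum => i _; rewrite hv // ltW // (hg i).1.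
rewrite sumrB sumr_const card_ord ltrBrDr -ltrBrDl -mulr_natl /d.
rewrite mulrA ltr_pdivrMr ?ltr0n // [ltRHS]mulrC ltr_pM2r ?subr_gt0 //.
by rewrite ltr_nat.
Qed.

Lemma exp2N_gt0 m : 0 < 2 ^- m :> R.
Proof. by rewrite invr_gt0 exprn_gt0. Qed.

Lemma lt_exp2N (e : R) : 0 < e -> exists m, 2 ^- m < e.
Proof.
move=> e0; have [m hm] : exists m : nat, e^-1 < m%:R.
  by exists (Num.truncn e^-1).+1; exact: Num.Theory.truncnS_gt.
exists m; rewrite invf_plt ?posrE ?exprn_gt0 //.
by apply: lt_trans hm _; rewrite -natrX ltr_nat ltn_expl.
Qed.

Lemma ratr_exp2N m : ratr (2 ^- m) = 2 ^- m :> R.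
Proof. by rewrite fmorphV rmorphXn /= ratr_nat. Qed.

Lemma ratrM a b : ratr (a * b) = ratr a * ratr b :> R.
Proof. exact: rmorphM. Qed.

Lemma ratrV a : ratr a^-1 = (ratr a)^-1 :> R.
Proof. exact: fmorphV. Qed.

Lemma ratr_sum (I : Type) (s : seq I) (P : pred I) (F : I -> rat) :
  ratr (\sum_(i <- s | P i) F i) = \sum_(i <- s | P i) ratr (F i) :> R.
Proof. exact: rmorph_sum. Qed.

Lemma ratr_inv_nat n : ratr n%:R^-1 = n%:R^-1 :> R.
Proof. by rewrite ratrV ratr_nat. Qed.

Lemma ratr_div_nat m n : ratr (m%:R / n%:R) = m%:R / n%:R :> R.
Proof. by rewrite ratrM ratr_inv_nat ratr_nat. Qed.

Lemma lcut_of_real_index e y : rec e -> (forall n, real_index (e n) (y n)) ->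
  lcut y /\ lcut (fun n => - y n).
Proof.
move=> he H.
have hphi := ce_phi.
split.
  apply: (@lcut_ce (fun n k => exists m, exists j, phi (e n) m j /\
      qnum k < qnum j - 2 ^- m)); first by rauto.
  move=> n k; split=> [[m [j [hj]]]|h].
    rewrite -(ltr_rat R) rmorphB /= ratr_exp2N => hk.
    have [j' hj'] := H n m; rewrite -(phi_det hj hj') ler_norml => /andP[h1 h2].
    lra.
  have [m hm] := @lt_exp2N ((y n - ratr (qnum k)) / 2) ltac:(lra).
  have [j hj] := H n m; rewrite ler_norml => /andP[h1 h2].
  exists m, j; split=> //; rewrite -(ltr_rat R) rmorphB /= ratr_exp2N; lra.
apply: (@lcut_ce (fun n k => exists m, exists j, phi (e n) m j /\
    qnum k < - qnum j - 2 ^- m)); first by rauto.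
move=> n k; split=> [[m [j [hj]]]|h].
  rewrite -(ltr_rat R) rmorphB /= ratr_exp2N rmorphN => hk.
  have [j' hj'] := H n m; rewrite -(phi_det hj hj') ler_norml => /andP[h1 h2].
  lra.
have [m hm] := @lt_exp2N ((- y n - ratr (qnum k)) / 2) ltac:(lra).
have [j hj] := H n m; rewrite ler_norml => /andP[h1 h2].
exists m, j; split=> //; rewrite -(ltr_rat R) rmorphB /= ratr_exp2N rmorphN /=; lra.
Qed.

Lemma real_index_of_lcut y : lcut y -> lcut (fun n => - y n) ->
  exists2 e, rec e & forall n, real_index (e n) (y n).
Proof.
move=> hy hy'.
have [||f hf fP] := @ce_select (fun z k =>
    ratr (qnum k - 2 ^- z~r) < y z~l /\
    ratr (- qnum k - 2 ^- z~r) < - y z~l).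
- by rauto.
- move=> z; have p0 := exp2N_gt0 z~r.
  have [k [h1 h2]] := @qnum_dense (y z~l - 2 ^- z~r) (y z~l) ltac:(lra).
  by exists k; rewrite !rmorphB /= rmorphN /= !ratr_exp2N; split; lra.
have [J hJ JP] := smn_rec hf.
exists J => // n m; exists (f (pr n m)) => //.
have := fP (pr n m); rewrite !unprK /= !rmorphB /= rmorphN /= !ratr_exp2N => -[h1 h2].
rewrite ler_norml; lra.
Qed.

Lemma lcut_of_lce_index e y : rec e -> (forall n, lce_index (e n) (y n)%:E) -> lcut y.
Proof.
move=> he H; apply: (@lcut_ce (fun n k => yields (e n) k (fun=> True))).
  apply: (@ce_comp2 (fun e k => yields e k (fun=> True)) _ _ ce_yieldsT); rauto.
by move=> n k; rewrite H lte_fin.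
Qed.

End cuts.

(** * Uniformly c.e. open sets *)

Section opens.
Context {R : realType} {X : computablePolishType R}.
Implicit Types (U V : nat -> set X).

Definition cball (b : nat) : set X :=
  [set x | mdist (ideal b~l) x < ratr (qpos b~r) :> R].

(** The balls are given by a c.e. relation instead of an enumeration, so that set operations become
    operations on c.e. predicates and empty unions need no special treatment. *)
Definition uopen U := exists2 W : nat -> nat -> Prop,
  ce (fun z => W z~l z~r) &
  forall n x, U n x <-> exists b, W n b /\ cball b x.

Lemma uopen_ext U V : U =1 V -> uopen U -> uopen V.
Proof. by move=> /funext ->. Qed.

Lemma uopen_iff U V : (forall n x, U n x <-> V n x) -> uopen U -> uopen V.
Proof. by move=> UV; apply: uopen_ext => n; apply/seteqP; split=> x /UV. Qed.

Lemma uopen_comp U g : uopen U -> rec g -> uopen (fun n => U (g n)).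
Proof.
by move=> [W hW WU] hg; exists (fun n => W (g n)) => //; rauto.
Qed.

Lemma uopen_comp2 (U : nat -> nat -> set X) f g :
  uopen (fun z => U z~l z~r) -> rec f -> rec g ->
  uopen (fun n => U (f n) (g n)).
Proof.
move=> hU hf hg; have := uopen_comp hU (rec_pr hf hg).
by apply: uopen_ext => n; rewrite unprK.
Qed.

Lemma uopen_of_index e U : rec e -> (forall n, open_index (e n) (U n)) -> uopen U.
Proof.
move=> he H; exists (fun n b => exists i, phi (e n) i b).
  by have := ce_phi => ?; rauto.
move=> n x; rewrite (H n); split=> [[i [b ib bx]]|[b [[i ib] bx]]].
  by exists b; split=> //; exists i.
by exists i, b.
Qed.

Lemma index_of_uopen U : uopen U -> exists2 e, rec e & forall n, open_index (e n) (U n).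
Proof.
move=> [W [b hb bW] WU].
(* The program accepts pairs of a ball and a witness that this ball is listed, and returns the
   ball. *)
have [J hJ JP] := @smn (fun z => b (pr (pr z~l z~r~l) z~r~r))
  (fun z => z~r~l) ltac:(rauto) ltac:(rauto).
exists J => // n; apply/seteqP; split=> x /=.
  move/WU => [d [+ dx]]; have := bW (pr n d); rewrite !unprK => /= -> [w hw].
  by exists (pr d w), d => //; apply/JP; rewrite !unprK.
move=> [i [d /JP[+ ->]]]; rewrite !unprK => hw dx.
apply/WU; exists i~l; split=> //.
by have := bW (pr n i~l); rewrite !unprK /= => ->; exists i~r.
Qed.

Lemma uopen_ex (U : nat -> nat -> set X) (P : nat -> nat -> Prop) :
  uopen (fun z => U z~l z~r) ->
  ce (fun z => P z~l z~r) ->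
  uopen (fun n => [set x | exists m, P n m /\ U n m x]).
Proof.
move=> [W hW WU] hP; exists (fun n b => exists m, P n m /\ W (pr n m) b).
  by rauto.
have {}WU n m x : U n m x <-> exists b, W (pr n m) b /\ cball b x.
  by have := WU (pr n m) x; rewrite unprK.
move=> n x; split=> /= [[m [Pm /WU[b [Wb bx]]]]|[b [[m [Pm Wb]] bx]]].
  by exists b; split=> //; exists m.
by exists m; split=> //; apply/WU; exists b.
Qed.

Lemma small_qpos (e : R) : 0 < e -> exists k, ratr (qpos k) < e.
Proof.
move=> /lt_exp2N[m hm]; have [k hk] := @qpos_surj (2 ^- m) ltac:(by rewrite invr_gt0 exprn_gt0).
by exists k; rewrite hk ratr_exp2N.
Qed.

Lemma ideal_approx (x : X) (e : R) : 0 < e -> exists n, mdist (ideal n) x < e.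
Proof.
move=> e0; have hx : (ball x e)^° x by exact: nbhsx_ballx.
have [y [/interior_subset yx [n _ ny]]] :=
  @dense_ideal R X (ball x e)^° (ex_intro _ x hx) (@open_interior _ _).
by exists n; move: yx; rewrite -ny ballEmdist /= metric_sym.
Qed.

Lemma uopenT : uopen (fun=> [set: X]).
Proof.
exists (fun _ _ => True); first exact: ce_const.
move=> n x; split=> // _; have [k hk] := small_qpos ltr01.
have [m hm] := @ideal_approx x (ratr (qpos k)) ltac:(by rewrite ltr0q qpos_gt0).
by exists (pr m k); split=> //; rewrite /cball /= unprK.
Qed.

Lemma uopen_cball : uopen cball.
Proof.
exists (fun n b => n = b); first by rauto.
by move=> n x; split=> [nx|[b [<-]]//]; exists n.
Qed.

Lemma uopen_guard U (P : nat -> Prop) : ce P -> uopen U ->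
  uopen (fun n => [set x | P n /\ U n x]).
Proof.
move=> hP [W hW WU]; exists (fun n b => P n /\ W n b); first by rauto.
move=> n x; split=> [[Pn /WU[b [h bx]]]|[b [[Pn h] bx]]]; first by exists b.
by split=> //; apply/WU; exists b.
Qed.

Lemma uopenU U V : uopen U -> uopen V -> uopen (fun n => U n `|` V n).
Proof.
move=> [W hW WU] [W' hW' WV]; exists (fun n b => W n b \/ W' n b); first by rauto.
move=> n x; split=> [[/WU|/WV][b [h bx]]|[b [[h|h] bx]]].
- by exists b; split=> //; left.
- by exists b; split=> //; right.
- by left; apply/WU; exists b.
- by right; apply/WV; exists b.
Qed.

(* Formal inclusion of balls: unlike the inclusion of the sets, which it
   implies, it is c.e. *)
Definition finc (b d : nat) : Prop :=
  ratr (qpos b~r - qpos d~r) <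
  - mdist (ideal d~l : X) (ideal b~l) :> R.

Lemma ce_finc : ce (fun z => finc z~l z~r).
Proof.
have [e he] := @computable_mdist R X.
have [|||f hf fP] := @yields_select (fun=> e) id
  (fun z j => real_index j (mdist (ideal z~l : X) (ideal z~r) : R)).
- by rauto.
- exact: rec_id.
- by move=> n; have := he n~l n~r; rewrite prK.
have [_ h] := lcut_of_real_index hf fP.
have {}h : lcut (fun z => - (fun i j => mdist (ideal i : X) (ideal j) : R) z~l z~r) := h.
rewrite /finc.
by apply: (@ce_lcut2 _ (fun i j => - mdist (ideal i : X) (ideal j)) _ _ _ h); rauto.
Qed.

Lemma finc_sub b d : finc b d -> cball b `<=` cball d.
Proof.
rewrite /finc /cball rmorphB /= => h x /= bx.
have := @metric_triangle R X (ideal d~l) (ideal b~l) x.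
lra.
Qed.

(** The point lies in each of the finitely many balls with a common margin [2 e]; a ball of radius
    below [e] that contains the point is then formally included in all of them. *)
Lemma finc_ex (d : nat -> nat) k x : (forall i, (i < k)%N -> cball (d i) x) ->
  exists2 b, cball b x & forall i, (i < k)%N -> finc b (d i).
Proof.
move=> H.
have [e e0 he] : exists2 e : R, 0 < e & forall i, (i < k)%N ->
    mdist (ideal (d i)~l) x + 2 * e < ratr (qpos (d i)~r).
  elim: k H => [|k IH] H; first by exists 1.
  have [|e e0 he] := IH; first by move=> i ik; exact/H/ltnW.
  have := H k (ltnSn _); rewrite /cball /= => hk.
  exists (Num.min e ((ratr (qpos (d k)~r) - mdist (ideal (d k)~l) x) / 4)).
    by rewrite lt_min e0 /=; lra.
  move=> i; rewrite ltnS leq_eqVlt => /orP[/eqP ->|/he h]; case: (leP e); lra.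
have [j hj] := small_qpos e0.
have [n hn] := @ideal_approx x (ratr (qpos j)) ltac:(by rewrite ltr0q qpos_gt0).
exists (pr n j); first by rewrite /cball /= unprK.
move=> i /he; rewrite /finc unprK rmorphB /=.
have := @metric_triangle R X (ideal (d i)~l) x (ideal n).
rewrite (metric_sym x); lra.
Qed.

(** The balls of the intersection are those formally included, for every [i], in some listed ball of
    the [i]-th set. Formal inclusion keeps this c.e., and [finc_ex] shows that no point is lost. *)
Lemma uopen_all (U : nat -> nat -> set X) k :
  uopen (fun z => U z~l z~r) -> rec k ->
  uopen (fun n => [set x | forall i, (i < k n)%N -> U n i x]).
Proof.
move=> [W hW WU] hk; exists (fun n b => forall i, (i < k n)%N ->
   exists d, W (pr n i) d /\ finc b d).
  by have := ce_finc => ?; rauto.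
have {}WU n m x : U n m x <-> exists b, W (pr n m) b /\ cball b x.
  by have := WU (pr n m) x; rewrite unprK.
move=> n x; split=> [h|[b [h bx]] i ik].
  have /choice_lk[v hv] : forall i, (i < k n)%N -> exists d, W (pr n i) d /\ cball d x.
    by move=> i ik; apply/WU/h.
  have [b bx bd] := @finc_ex (lk v) (k n) x (fun i ik => (hv i ik).2).
  exists b; split=> // i ik; exists (lk v i); split; last exact: bd.
  by have [] := hv i ik.
have [d [Wd bd]] := h i ik; apply/WU; exists d; split=> //.
exact: finc_sub bd _ bx.
Qed.

Lemma uopenI U V : uopen U -> uopen V -> uopen (fun n => U n `&` V n).
Proof.
move=> [W hW WU] [W' hW' WV].
apply: (uopen_iff _ (@uopen_all (fun n i => if i == 0 then U n else V n)
  (fun=> 2%N) _ _)); last by rauto.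
  move=> n x; split=> [h|[Ux Vx] [|i]] //.
  by split; [exact: (h 0)|exact: (h 1%N)].
exists (fun z b => (z~r = 0%N /\ W z~l b) \/
  ((0 < z~r)%N /\ W' z~l b)); first by rauto.
move=> n x; case: eqVneq => [n0|n0]; rewrite ?WU ?WV.
  split=> [[b [h bx]]|[b [[[_ h]|[]]]]].
  - by exists b; split=> //; left.
  - by exists b.
  - by rewrite n0.
split=> [[b [h bx]]|[b [[[n00 h]|[_ h]]]]].
- by exists b; split=> //; right; split=> //; rewrite lt0n.
- by rewrite n00 in n0.
- by exists b.
Qed.

Lemma open_cball b : open (cball b).
Proof.
rewrite openE => x bx; apply/nbhs_ballP.
move: (bx); rewrite /cball /= => bx'.
exists (ratr (qpos b~r) - mdist (ideal b~l) x) => /=; first by rewrite subr_gt0.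
move=> y; rewrite ballEmdist /= => xy.
have := @metric_triangle R X (ideal b~l) x y; lra.
Qed.

Lemma open_uopen U n : uopen U -> open (U n).
Proof.
move=> [W _ WU].
have -> : U n = \bigcup_(b in W n) cball b.
  apply/seteqP; split=> x; first by move/WU => [b [Wb bx]]; exists b.
  by move=> [b Wb bx]; apply/WU; exists b.
by apply: bigcup_open => b _; exact: open_cball.
Qed.

Lemma open_cballs (O : set X) : open O -> exists D : set nat, O = \bigcup_(b in D) cball b.
Proof.
move=> oO; exists [set b | cball b `<=` O]; apply/seteqP; split=> [x Ox|x [b bO bx]]; last exact: bO.
move: oO; rewrite openE => /(_ x Ox)/nbhs_ballP[e /= e0 he].
have [j hj] := @small_qpos (e / 2) ltac:(by rewrite divr_gt0).
have [n hn] := @ideal_approx x (ratr (qpos j)) ltac:(by rewrite ltr0q qpos_gt0).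
exists (pr n j); last by rewrite /cball /= unprK.
move=> y; rewrite /cball /= unprK => hy; apply: he; rewrite ballEmdist /=.
have := @metric_triangle R X x (ideal n) y; rewrite (metric_sym x (ideal n)); lra.
Qed.

End opens.

(** * Uniformly lower semicomputable functions *)

Section lower_semicomputable.
Context {R : realType} {X : computablePolishType R}.
Implicit Types (U : nat -> set X) (f : nat -> X -> \bar R).

(** The value [-oo] is not excluded here; it is ruled out separately where an index is produced. *)
Definition ulsc f :=
  uopen (fun z => [set x | (ratr (qnum z~r))%:E < f z~l x]%E).

Lemma ulsc_ext f (g : nat -> X -> \bar R) :
  (forall n x, f n x = g n x) -> ulsc f -> ulsc g.
Proof. by move=> fg; apply: uopen_iff => z x /=; rewrite fg. Qed.

Lemma ulsc_lt f F g : ulsc f -> qrec F -> rec g ->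
  uopen (fun n => [set x | (ratr (F n))%:E < f (g n) x]%E).
Proof.
move=> hf [h hh hE] hg; have := uopen_comp hf (rec_pr hg hh).
by apply: uopen_iff => n x /=; rewrite !unprK /= hE.
Qed.

Lemma ulsc_comp f g : ulsc f -> rec g -> ulsc (fun n => f (g n)).
Proof.
move=> hf hg.
by apply: (@ulsc_lt _ (fun z => qnum z~r) (fun z => g z~l) hf); rauto.
Qed.

Lemma ulsc_comp2 (f : nat -> nat -> X -> \bar R) g h :
  ulsc (fun z => f z~l z~r) -> rec g -> rec h ->
  ulsc (fun n => f (g n) (h n)).
Proof.
move=> hf hg hh; apply: ulsc_ext (ulsc_comp hf (rec_pr hg hh)) => n x.
by rewrite unprK.
Qed.

Lemma ulsc_lt2 (f : nat -> nat -> X -> \bar R) F g h :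
  ulsc (fun z => f z~l z~r) -> qrec F -> rec g -> rec h ->
  uopen (fun n => [set x | (ratr (F n))%:E < f (g n) (h n) x]%E).
Proof.
move=> hf hF hg hh; apply: uopen_iff (ulsc_lt hf hF (rec_pr hg hh)) => n x /=.
by rewrite unprK.
Qed.

Lemma ulsc_of_index e f : rec e -> (forall n, lsc_index (e n) (f n)) -> ulsc f.
Proof.
move=> he H.
have [|||j hj jP] := @yields_select (fun z => e z~l) (fun z => z~r)
  (fun z j => open_index j [set x | (ratr (qnum z~r))%:E < f z~l x]%E).
- by rauto.
- by rauto.
- by move=> z; have [_] := H z~l; apply.
- exact: uopen_of_index hj jP.
Qed.

Lemma index_of_ulsc f : (forall n x, f n x != -oo%E) -> ulsc f ->
  exists2 e, rec e & forall n, lsc_index (e n) (f n).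
Proof.
move=> fNy /index_of_uopen[e he eP].
have [J hJ JP] := smn_rec he.
exists J => // n; split=> // k; exists (e (pr n k)) => //.
by have := eP (pr n k); rewrite !unprK.
Qed.

Lemma ulsc_sup (f : nat -> nat -> X -> \bar R) :
  ulsc (fun z => f z~l z~r) ->
  ulsc (fun n x => ereal_sup (range (fun m => f n m x))).
Proof.
move=> hf.
have := @uopen_ex _ _ (fun z m => [set x | (ratr (qnum z~r))%:E < f z~l m x]%E)
  (fun _ _ => True) _ (ce_const True).
move=> H; apply: uopen_iff (H _) => [z x|] /=.
  split=> [[m [_ h]]|/ereal_sup_gt[_ [m _ <-] h]]; last by exists m.
  by apply: lt_le_trans h _; apply: ereal_sup_ubound; exists m.
by apply: (@ulsc_lt2 f (fun z => qnum z~l~r) (fun z => z~l~l)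
  (fun z => z~r) hf); rauto.
Qed.

Lemma ereal_rat_below (a : \bar R) (q : R) : (q%:E < a)%E ->
  exists k, q < ratr (qnum k) /\ ((ratr (qnum k))%:E < a)%E.
Proof.
case: a => [r| |] //; last first.
  move=> _; have [k [h _]] := @qnum_dense R q (q + 1) ltac:(lra).
  by exists k; split=> //; rewrite ltry.
by rewrite lte_fin => /qnum_dense[k [h1 h2]]; exists k; rewrite lte_fin.
Qed.

Lemma ereal_rat_split (a b : \bar R) (q : R) : a != -oo%E -> b != -oo%E ->
  (q%:E < a + b)%E <->
  exists k, ((ratr (qnum k))%:E < a)%E /\ ((q - ratr (qnum k))%:E < b)%E.
Proof.
move=> a0 b0; split=> [|[k [h1 h2]]]; last first.
  by have := lteD h1 h2; rewrite -EFinD addrC subrK.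
case: a a0 => [a||//] _; case: b b0 => [b||//] _ h.
- have [k [h1 h2]] := @qnum_dense R (q - b) a ltac:(rewrite -EFinD lte_fin in h; lra).
  by exists k; rewrite !lte_fin; split; lra.
- have [k [h1 h2]] := @qnum_dense R (a - 1) a ltac:(lra).
  by exists k; rewrite lte_fin ltry.
- have [k [h1 h2]] := @qnum_dense R (q - b) (q - b + 1) ltac:(lra).
  by exists k; rewrite ltry lte_fin; split=> //; lra.
- by exists 0; rewrite !ltry.
Qed.

(** Meant for nonnegative functions: their superlevel sets at negative rationals are the whole
    space, and the sign of a rational is decidable. *)
Lemma uopen_guard2 (U : nat -> set X) (b : nat -> bool) : dec b -> uopen U ->
  uopen (fun n => if b n then [set: X] else U n).
Proof.
move=> hb hU.
have := uopenU (uopen_guard (ce_dec hb) (@uopenT R X)) (uopen_guard (ce_dec (dec_not hb)) hU).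
apply: uopen_iff => n x /=; case: (b n) => /=.
  by split=> // _; left.
by split=> [[[]|[]]//|Ux]; right.
Qed.

(** This makes remainders of tests lsc: [f] is lsc and the subtracted function is usc. The positive
    part gives nonnegativity at every point, also where the usc companion says nothing about the
    test. *)
Lemma ulsc_posdiff f (g : nat -> X -> \bar R) :
  (forall n x, f n x != -oo%E) -> (forall n x, g n x != +oo%E) ->
  ulsc f -> ulsc (fun n x => - g n x)%E ->
  ulsc (fun n x => maxe (f n x - g n x) 0)%E.
Proof.
move=> f0 g0 hf hg.
have : uopen (fun z => if (qnum z~r < 0) then [set: X] else
  [set x | exists k, True /\ ([set x | (ratr (qnum k))%:E < f z~l x]%E `&`
     [set x | (ratr (qnum z~r - qnum k))%:E < - g z~l x]%E) x]).
  apply: uopen_guard2; first by rauto.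
  apply: (@uopen_ex _ _ (fun z k => [set x | (ratr (qnum k))%:E < f z~l x]%E `&`
     [set x | (ratr (qnum z~r - qnum k))%:E < - g z~l x]%E)); last by rauto.
  apply: uopenI.
    by apply: (@ulsc_lt _ (fun z => qnum z~r) (fun z => z~l~l) hf); rauto.
  by apply: (@ulsc_lt _ (fun z => qnum z~l~r - qnum z~r)
    (fun z => z~l~l) hg); rauto.
apply: uopen_iff => z x /=; rewrite lt_max lte_fin ltrq0.
case: ifP => /= h; first by rewrite orbT.
rewrite orbF ereal_rat_split //; last by rewrite eqe_oppLR.
by split=> [[k [_ [h1 +]]]|[k [h1 h2]]]; rewrite ?rmorphB /=; exists k; rewrite ?rmorphB.
Qed.

Lemma ulsc_scale f F : qrec F -> (forall n, 0 < F n) -> ulsc f ->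
  ulsc (fun n x => (ratr (F n))%:E * f n x)%E.
Proof.
move=> hF F0 hf.
have : uopen (fun z => [set x | exists k, (qnum z~r < F z~l * qnum k) /\
    ((ratr (qnum k))%:E < f z~l x)%E]).
  apply: (@uopen_ex _ _ (fun z k => [set x | (ratr (qnum k))%:E < f z~l x]%E)
    (fun z k => qnum z~r < F z~l * qnum k)); last by rauto.
  by apply: (@ulsc_lt _ (fun z => qnum z~r) (fun z => z~l~l) hf); rauto.
apply: uopen_iff => z x /=.
have p0 : 0 < ratr (F z~l) :> R by rewrite ltr0q.
have key (k : nat) : (qnum z~r < F z~l * qnum k) =
   (ratr (qnum z~r) / ratr (F z~l) < ratr (qnum k) :> R).
  rewrite -(ltr_rat R).
  have -> : ratr (F z~l * qnum k) = ratr (F z~l) * ratr (qnum k) :> R.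
    exact: rmorphM.
  by rewrite [RHS]ltr_pdivrMr // mulrC.
have key2 : ((ratr (qnum z~r))%:E < (ratr (F z~l))%:E * f z~l x)%E =
   ((ratr (qnum z~r) / ratr (F z~l))%:E < f z~l x)%E.
  case: (f _ _) => [r| |]; rewrite ?gt0_mulye ?gt0_mulNye ?ltry ?lte_fin //.
  - by rewrite [RHS]ltr_pdivrMr // mulrC.
  - by rewrite gt0_muley ?lte_fin // !ltry.
  - by rewrite gt0_muleNy ?lte_fin.
rewrite key2; split=> [[k []]|/ereal_rat_below[k [h1 h2]]].
  by rewrite key => h1; apply: lt_trans; rewrite lte_fin.
by exists k; rewrite key.
Qed.

Lemma ulsc_min f F : qrec F -> ulsc f ->
  ulsc (fun n x => mine (f n x) (ratr (F n))%:E).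
Proof.
move=> hF hf.
have : uopen (fun z => [set x | (qnum z~r < F z~l) /\
    ((ratr (qnum z~r))%:E < f z~l x)%E]).
  apply: uopen_guard; first by rauto.
  exact: hf.
apply: uopen_iff => z x /=; rewrite lt_min lte_fin ltr_rat.
by split=> [[-> ->]//|/andP[-> ->]].
Qed.

Lemma ereal_rat_sum (a : nat -> \bar R) k (q : R) : (forall i, a i != -oo%E) ->
  (q%:E < \sum_(i < k) a i)%E <->
  exists v, (forall i, (i < k)%N -> ((ratr (qnum (lk v i)))%:E < a i)%E) /\
    q < \sum_(i < k) ratr (qnum (lk v i)).
Proof.
move=> a0; split=> [h|[v [h h']]]; last first.
  apply: (@lt_le_trans _ _ (\sum_(i < k) ratr (qnum (lk v i)))%:E); first by rewrite lte_fin.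
  by rewrite -sumEFin; apply: lee_sum => i _; rewrite ltW // h.
have [g [hg1 hg2]] : exists g, (forall i, (i < k)%N -> ((ratr (qnum (g i)))%:E < a i)%E) /\
    q < \sum_(i < k) ratr (qnum (g i)).
  elim: k q h => [|k IH] q; first by rewrite !big_ord0 lte_fin; exists id; rewrite big_ord0.
  rewrite big_ord_recr /= ereal_rat_split //; last first.
    apply: (big_ind (fun x : \bar R => x != -oo%E)) => // u w hu hw.
    by rewrite adde_eq_ninfty negb_or hu.
  move=> [l [/IH[g [g1 g2]] /ereal_rat_below[m [m1 m2]]]].
  exists (fun i => if i == k then m else g i); split=> [i|].
    rewrite ltnS leq_eqVlt; case: eqVneq => [-> _|_ /= /g1] //.
  rewrite big_ord_recr /= eqxx.
  under eq_bigr => i _ do rewrite ltn_eqF //.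
  lra.
have [v hv] := lk_mkseq g k.
exists v; split=> [i ik|]; first by rewrite hv //; exact: hg1.
by under eq_bigr => i _ do rewrite hv //.
Qed.

Lemma ulsc_sum (f : nat -> nat -> X -> \bar R) k :
  (forall n i x, f n i x != -oo%E) ->
  ulsc (fun z => f z~l z~r) -> rec k ->
  ulsc (fun n x => \sum_(i < k n) f n i x)%E.
Proof.
move=> f0 hf hk.
have : uopen (fun z => [set x | exists v, (qnum z~r < \sum_(i < k z~l) qnum (lk v i)) /\
    (forall i, (i < k z~l)%N -> ((ratr (qnum (lk v i)))%:E < f z~l i x)%E)]).
  apply: (@uopen_ex _ _ (fun z v => [set x | forall i, (i < k z~l)%N ->
      ((ratr (qnum (lk v i)))%:E < f z~l i x)%E])
    (fun z v => (qnum z~r < \sum_(i < k z~l) qnum (lk v i)))).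
    apply: (@uopen_all _ _ (fun z i => [set x | (ratr (qnum (lk z~r i)))%:E < f z~l~l i x]%E)); last by rauto.
    by apply: (@ulsc_lt2 f (fun z => qnum (lk z~l~r z~r))
      (fun z => z~l~l~l) (fun z => z~r) hf); rauto.
  rauto.
  by apply: (@qrec_sum (fun z i => qnum (lk z~r i)) (fun z => k z~l~l)); rauto.
apply: uopen_iff => z x /=; rewrite (@ereal_rat_sum (fun i => f z~l i x)) //.
split=> -[v [h1 h2]]; exists v; split=> //.
  by rewrite -(ltr_rat R) rmorph_sum in h1.
by rewrite -(ltr_rat R) rmorph_sum.
Qed.

Lemma ulsc_qrec F : qrec F -> ulsc (fun n _ => (ratr (F n))%:E).
Proof.
move=> hF.
have := @uopen_guard _ _ _ (fun z => qnum z~r < F z~l) _ (@uopenT R X).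
move=> H; apply: uopen_iff (H _) => [z x|]; last by rauto.
by rewrite /= lte_fin ltr_rat; split=> [[]//|].
Qed.

Lemma ulsc_indic U : uopen U -> ulsc (fun n x => (\1_(U n) x)%:E).
Proof.
move=> hU.
have : uopen (fun z => if (qnum z~r < 0) then [set: X] else
   [set x | (qnum z~r < 1) /\ U z~l x]).
  apply: uopen_guard2; first by rauto.
  by apply: uopen_guard; [rauto|apply: (uopen_comp hU); rauto].
apply: uopen_iff => z x /=; rewrite lte_fin indicE.
case: ifP => /= h.
  split=> // _; apply: (@lt_le_trans _ _ 0); first by rewrite ltrq0.
  by case: (_ \in _).
case: (boolP (x \in U _)) => [|/negP] xU; rewrite inE in xU => /=.
  by rewrite -(ltr_rat R) rmorph1; split=> [[]//|].
by rewrite ltrq0 h; split=> [[]|].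
Qed.

Lemma measurable_ulsc f n : ulsc f -> measurable_fun [set: Borel X] (f n : Borel X -> \bar R).
Proof.
move=> hf; apply: (measurability _ (ErealGenOInfty.measurableE R)).
move=> _ [_ [r ->] <-]; rewrite setTI.
have -> : f n @^-1` [set` `]r%:E, +oo[%E] =
    \bigcup_(k in [set k | r < ratr (qnum k)]) [set x | (ratr (qnum k))%:E < f n x]%E.
  apply/seteqP; split=> x /=; rewrite in_itv /= andbT.
    by move=> /ereal_rat_below[k [h1 h2]]; exists k.
  by move=> [k /= h1]; apply: lt_trans; rewrite lte_fin.
apply: bigcup_measurable => k _; apply: sub_sigma_algebra.
have := @open_uopen _ _ _ (pr n k) hf.
by rewrite !unprK.
Qed.

Lemma measurable_uopen U n : uopen U -> measurable (U n : set (Borel X)).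
Proof. by move=> hU; apply: sub_sigma_algebra; exact: open_uopen. Qed.

End lower_semicomputable.

(** * Integrals *)

Section liminf.
Context {R : realType}.
Implicit Types (u : nat -> \bar R).

Lemma le_limn_einf u (q : \bar R) M : (forall m, (M <= m)%N -> (q <= u m)%E) ->
  (q <= limn_einf u)%E.
Proof.
move=> h; rewrite limn_einf_lim; apply: lime_ge; first exact: is_cvg_einfs.
exists M => // n /= Mn; apply: le_ereal_inf_tmp => _ [k /= nk <-].
by apply: h; exact: leq_trans nk.
Qed.

Lemma limn_einf_le u (c : \bar R) : (forall m, (u m <= c)%E) -> (limn_einf u <= c)%E.
Proof.
move=> h; rewrite limn_einf_lim; apply: lime_le; first exact: is_cvg_einfs.
apply: nearW => n; apply: le_trans (h n); apply: ereal_inf_lbound.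
by exists n => /=.
Qed.

Lemma le_of_real_lt (a b : \bar R) : (0 <= b)%E ->
  (forall q : R, 0 <= q -> (q%:E < a)%E -> (q%:E <= b)%E) -> (a <= b)%E.
Proof.
move=> b0 h; rewrite leNgt; apply/negP; case: b b0 h => [b| |]//; last by case: a.
move=> b0 h /ereal_rat_below[k [h1 h2]].
have := h _ _ h2; rewrite lee_fin => /(_ _).
by move=> /(_ ltac:(rewrite lee_fin in b0; lra)); lra.
Qed.

End liminf.

Section level_sums.
Context {R : realType}.

(** A discretized layer-cake sum: when [P j] says that a value exceeds [(j+1)/(m+1)], it
    approximates the value from below with mesh [1/(m+1)], capped at [m+1]; hence the [(m+1)^2]
    levels. *)
Definition lsum (m : nat) (P : nat -> bool) : R :=
  \sum_(j < m.+1 ^ 2) m.+1%:R^-1 * (P j)%:R.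

Lemma lsum_ge0 m P : 0 <= lsum m P.
Proof. by apply: sumr_ge0 => j _; rewrite mulr_ge0 ?invr_ge0. Qed.

(** The highest level at which [P] holds already bounds the total weight of all levels up to it. *)
Lemma lsum_le m (P : nat -> bool) (a : \bar R) : (0 <= a)%E ->
  (forall j, P j -> ((j.+1%:R / m.+1%:R)%:E < a)%E) -> ((lsum m P)%:E <= a)%E.
Proof.
rewrite /lsum; elim: (m.+1 ^ 2)%N => [|K IH] a0 h; first by rewrite big_ord0.
case hP: (P K); last first.
  by rewrite big_ord_recr /= hP mulr0 addr0; exact: IH.
apply: ltW; apply: le_lt_trans (h K hP); rewrite lee_fin.
apply: (@le_trans _ _ (\sum_(j < K.+1) m.+1%:R^-1)).
  by apply: ler_sum => j _; rewrite ler_piMr ?invr_ge0 // lern1 leq_b1.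
by rewrite sumr_const card_ord -[leLHS]mulr_natl.
Qed.

Lemma lsum_ge m (P : nat -> bool) (q : R) : 0 <= q -> q <= m.+1%:R ->
  (forall j : nat, j.+1%:R / m.+1%:R <= q -> P j) -> q - m.+1%:R^-1 <= lsum m P.
Proof.
move=> q0 qm h; pose K := Num.truncn (q * m.+1%:R).
have /andP[K1 K2] : K%:R <= q * m.+1%:R < K.+1%:R.
  by apply: Num.Theory.truncn_itv; rewrite mulr_ge0.
have Km : (K <= m.+1 ^ 2)%N.
  rewrite -(ler_nat R); apply: le_trans K1 _.
  by rewrite natrX expr2 ler_wpM2r.
rewrite /lsum -(big_mkord xpredT (fun j => m.+1%:R^-1 * (P j)%:R)).
rewrite (big_cat_nat (n := K)) //=.
apply: (@le_trans _ _ (\sum_(0 <= j < K) m.+1%:R^-1)).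
  rewrite sumr_const_nat subn0 -[leRHS]mulr_natl lerBlDr -[X in _ + X]mul1r.
  by rewrite -mulrDl ler_pdivlMr // natr1 ltW.
rewrite -[leLHS]addr0 lerD //; last first.
  by apply: sumr_ge0 => j _; rewrite mulr_ge0 ?invr_ge0.
rewrite [leLHS]big_nat [leRHS]big_nat.
apply: ler_sum => j /= jK; rewrite h ?mulr1 //.
by rewrite ler_pdivrMr //; apply: le_trans K1; rewrite ler_nat.
Qed.

Lemma lsum_near (q r : R) : 0 <= q -> q < r ->
  exists M, forall m, (M <= m)%N -> forall P : nat -> bool,
  (forall j : nat, j.+1%:R / m.+1%:R <= r -> P j) -> q <= lsum m P.
Proof.
move=> q0 qr; have [M hM] := @lt_exp2N R (r - q) ltac:(lra).
have [N hN] : exists N : nat, r <= N%:R.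
  by exists (Num.truncn r).+1; exact: ltW (Num.Theory.truncnS_gt _).
(* [2 ^ M] makes the mesh finer than [r - q], and [N] lifts the cap above [r]. *)
exists (maxn (2 ^ M) N) => m; rewrite geq_max => /andP[Mm Nm] P hP.
apply: (@le_trans _ _ (r - m.+1%:R^-1)).
  have : m.+1%:R^-1 <= 2 ^- M :> R.
    rewrite lef_pV2 ?posrE // -?natrX ?ltr0n ?expn_gt0 //.
    by rewrite ler_nat ltnW.
  by move=> h; rewrite lerBrDr -lerBrDl; exact: le_trans h (ltW hM).
apply: lsum_ge => //; first exact: le_trans q0 (ltW qr).
by apply: le_trans hN _; rewrite ler_nat ltnW.
Qed.

End level_sums.

Section integral_below.
Context d (T : measurableType d) (R : realType) (mu : {measure set T -> \bar R}).

Lemma measurable_fun_oppe (f : T -> \bar R) :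
  measurable_fun setT f -> measurable_fun setT (fun x => - f x)%E.
Proof. by move=> mf; apply: measurableT_comp mf; exact: oppe_measurable. Qed.

Lemma measurable_limn_einf (f : (T -> \bar R)^nat) :
  (forall m, measurable_fun setT (f m)) ->
  measurable_fun setT (fun x => limn_einf (f ^~ x)).
Proof.
move=> mf; rewrite /limn_einf; apply: measurable_fun_oppe.
by apply: measurable_fun_limn_esup => m; exact: measurable_fun_oppe.
Qed.

(** The [phi m] need not increase with [m], so Fatou's lemma takes the place of monotone
    convergence: the hypothesis says [f <= liminf phi]. The bound [M] allows the index to be chosen
    beyond any prescribed stage. *)
Lemma integral_below (f : T -> \bar R) (phi : nat -> T -> \bar R) :
  (forall x, 0 <= f x)%E -> measurable_fun setT f ->
  (forall m x, 0 <= phi m x)%E -> (forall m, measurable_fun setT (phi m)) ->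
  (forall x (q : R), 0 <= q -> (q%:E < f x)%E ->
     exists M, forall m, (M <= m)%N -> (q%:E <= phi m x)%E) ->
  forall (M : nat) (c : \bar R), (c < \int[mu]_x f x)%E ->
  exists2 m, (M <= m)%N & (c < \int[mu]_x phi m x)%E.
Proof.
move=> f0 mf phi0 mphi H M c; apply: contraPP => /forall2NP h.
apply/negP; rewrite -leNgt.
apply: (@le_trans _ _ (\int[mu]_x limn_einf (fun m => phi (m + M)%N x))%E).
  apply: ge0_le_integral => //.
  - by apply: measurable_limn_einf => m; exact: mphi.
  - move=> x _; apply: le_of_real_lt.
      by apply: (@le_limn_einf _ _ _ 0) => // m _.
    move=> q q0 /(H x q q0)[N hN]; apply: (@le_limn_einf _ _ _ N) => m Nm.
    by apply: hN; exact: leq_trans (leq_addr _ _).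
apply: le_trans (fatou _ _ _ _) _ => //.
apply: limn_einf_le => m.
by have [/negP|/negP] := h (m + M)%N; rewrite ?leq_addl // -leNgt.
Qed.

End integral_below.

Section integrals.
Context {R : realType} {X : computablePolishType R} (nu : probability (Borel X) R).
Hypothesis hnu : computable_measure nu.
Implicit Types (U : nat -> set X) (f : nat -> X -> \bar R).

Lemma lcut_nu U : uopen U -> lcut (fun n => fine (nu (U n))).
Proof.
move=> hU; have [e he eU] := index_of_uopen hU; have [h hh] := hnu.
have [||j hj jP] := @yields_select (fun=> h) e (fun n j => lce_index j (nu (U n))) (rec_const h).
- by [].
- by move=> n; apply: hh.
- apply: (lcut_of_lce_index hj) => n.
  by rewrite fineK ?fin_num_measure //; exact: measurable_uopen.
Qed.

Lemma integral_lsum (P : nat -> set X) m :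
  (forall j, measurable (P j : set (Borel X))) ->
  (\int[nu]_x (lsum m (fun j => x \in P j))%:E =
   (\sum_(j < m.+1 ^ 2) m.+1%:R^-1 * fine (nu (P j)))%:E)%E.
Proof.
move=> mP; rewrite /lsum.
under eq_integral do rewrite -sumEFin.
have m1 (j : nat) : measurable_fun [set: Borel X] (fun x : Borel X => (\1_(P j) x)%:E : \bar R).
  by apply/measurable_EFinP; exact: measurable_indic.
have m2 (j : 'I_(m.+1 ^ 2)) : measurable_fun [set: Borel X]
    (fun x : Borel X => (m.+1%:R^-1 * (x \in P j)%:R)%:E : \bar R).
  by apply/measurable_EFinP; apply: measurable_funM => //; exact: measurable_indic.
have p2 (j : 'I_(m.+1 ^ 2)) (x : Borel X) : [set: Borel X] x ->
    (0 <= (m.+1%:R^-1 * (x \in P j)%:R)%:E :> \bar R)%E.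
  by rewrite lee_fin mulr_ge0 // invr_ge0.
rewrite (ge0_integral_sum _ measurableT m2 p2).
rewrite -sumEFin; apply: eq_bigr => j _.
under eq_integral do rewrite EFinM.
rewrite (ge0_integralZl_EFin _ measurableT _ (m1 j)) ?invr_ge0 //.
by rewrite EFinM fineK ?fin_num_measure // integral_indic // setIT.
Qed.

Lemma measurable_lsum (P : nat -> set X) m :
  (forall j, measurable (P j : set (Borel X))) ->
  measurable_fun [set: Borel X] (fun x : Borel X => (lsum m (fun j => x \in P j))%:E : \bar R).
Proof.
move=> mP; apply/measurable_EFinP; apply: measurable_sum => j.
by apply: measurable_funM => //; exact: measurable_indic.
Qed.

(** The level sums turn the integral into a supremum of finite rational combinations of measures of
    superlevel sets, and these measures are left-c.e. *)
Lemma lcut_integral f : ulsc f -> (forall n x, 0 <= f n x)%E ->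
  (forall n, \int[nu]_x f n x < +oo)%E ->
  lcut (fun n => fine (\int[nu]_x f n x)%E).
Proof.
move=> hf f0 fi.
pose U n m j := [set x | ((j.+1%:R / m.+1%:R)%:E < f n x)%E].
have hU : uopen (fun z => U z~l z~r~l z~r~r).
  have := @ulsc_lt _ _ f (fun z => z~r~r.+1%:R / z~r~l.+1%:R)
    (fun z => z~l) hf.
  move=> H; apply: uopen_iff (H _ _) => [z x||]; [|by rauto|by rauto].
  by rewrite /U /= ratr_div_nat.
have mU n m j : measurable (U n m j : set (Borel X)).
  by have := measurable_uopen (pr n (pr m j)) hU; rewrite !unprK.
have le_phi n m x : ((lsum m (fun j => x \in U n m j))%:E <= f n x)%E.
  by apply: lsum_le => // j; rewrite inE.
have int_phi n m : (\int[nu]_x (lsum m (fun j => x \in U n m j))%:E <= \int[nu]_x f n x)%E.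
  apply: ge0_le_integral => //.
  - by move=> x _; rewrite lee_fin lsum_ge0.
  - exact: measurable_lsum.
  - exact: measurable_ulsc.
have ffin n : (\int[nu]_x f n x)%E \is a fin_num.
  by rewrite ge0_fin_numE ?fi // integral_ge0.
apply: (@lcut_approx _ (fun n m => \sum_(j < m.+1 ^ 2) m.+1%:R^-1 * fine (nu (U n m j)))).
- have := @lcut_sum R (fun z j => ratr z~r.+1%:R^-1 *
    fine (nu (U z~l z~r j))) (fun z => (z~r.+1 ^ 2)%N).
  move=> H; apply: lcut_ext (H _ _); last by rauto.
    by move=> z; apply: eq_bigr => j _; rewrite ratr_inv_nat.
  have h := lcut_nu hU.
  apply: (@lcut_scale R (fun z => z~l~r.+1%:R^-1)); first by rauto.
    by move=> n; rewrite invr_ge0.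
  have := lcut_comp h (_ : rec (fun z => pr z~l~l (pr z~l~r z~r))).
  by move=> H'; apply: lcut_ext (H' _) => [z|]; rewrite ?unprK; rauto.
- move=> n m; rewrite -lee_fin fineK // -integral_lsum //; exact: int_phi.
move=> n e e0.
have Hphi x (q : R) : 0 <= q -> (q%:E < f n x)%E -> exists M, forall m, (M <= m)%N ->
    (q%:E <= (lsum m (fun j => x \in U n m j))%:E)%E.
  move=> q0 /ereal_rat_below[k [qk kf]].
  have [M hM] := lsum_near q0 qk.
  exists M => m /hM h; rewrite lee_fin; apply: h => j hj.
  by rewrite inE /U /=; apply: le_lt_trans kf; rewrite lee_fin.
have phi0 m (x : Borel X) : (0 <= (lsum m (fun j => x \in U n m j))%:E :> \bar R)%E.
  by rewrite lee_fin lsum_ge0.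
have [|m _ hm] := @integral_below _ (Borel X) R nu (f n) _ (f0 n) (measurable_ulsc n hf)
  phi0 (fun m => measurable_lsum m (mU n m)) Hphi 0 (fine (\int[nu]_x f n x) - e)%:E.
  by rewrite -[ltRHS](fineK (ffin n)) lte_fin ltrBlDr ltrDl.
by exists m; rewrite -lte_fin -integral_lsum.
Qed.

End integrals.

(** * Evaluating codes of algebra terms and simple functions *)

Section aterm_codes.

Lemma aterm_num_inj t u : aterm_num t = aterm_num u -> t = u.
Proof.
elim: t u => [n|t IH|t IHt t' IHt'] [m|u|u u'] //= h; try lia.
- by congr ABase; lia.
- by congr ACompl; apply: IH; lia.
- have /pr_inj[/IHt -> /IHt' ->] : pr (aterm_num t) (aterm_num t') = pr (aterm_num u) (aterm_num u') by lia.
  by [].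
Qed.

Lemma aterm_num_surj i : exists t, aterm_num t = i.
Proof.
elim/ltn_ind: i => i IH.
have [r3 E] : (i %% 3 < 3)%N /\ i = (i %/ 3 * 3 + i %% 3)%N by lia.
case: (i %% 3)%N r3 E => [|[|[|//]]] _ E.
- by exists (ABase (i %/ 3)) => /=; lia.
- have [|t ht] := IH (i %/ 3)%N; first by lia.
  by exists (ACompl t) => /=; lia.
- have [a1 a2] := leq_pr (i %/ 3)~l (i %/ 3)~r; rewrite prK in a1 a2.
  have [|t ht] := IH (i %/ 3)~l; first by lia.
  have [|u hu] := IH (i %/ 3)~r; first by lia.
  by exists (AUnion t u); rewrite /= ht hu prK; lia.
Qed.

(* Truth value of [x \in aset B t] when [lk v n != 0] means [B n x]. *)
Fixpoint aeval (v : nat) (t : aterm) : bool :=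
  match t with
  | ABase n => lk v n != 0%N
  | ACompl t => ~~ aeval v t
  | AUnion t u => aeval v t || aeval v u
  end.

(** Course-of-values recursion by search: [w] is a table of truth values for all codes up to the
    given one, locally correct in the sense of [rule]. Residues modulo 3 determine the shape of a
    term and every number codes a term, so a table exists and its entries are forced. *)
Lemma aeval_rec : exists2 f, rec (fun z => f z~l z~r) &
  forall v t, f v (aterm_num t) = aeval v t.
Proof.
pose rule v w i : Prop :=
  (exists n, i = (3 * n)%N /\ lk w i = (lk v n != 0%N)) \/
  (exists j, i = (1 + 3 * j)%N /\ lk w i = ~~ (lk w j != 0%N)) \/
  (exists a, exists b, i = (2 + 3 * pr a b)%N /\ lk w i = ((lk w a != 0%N) || (lk w b != 0%N))).
pose P z y : Prop := exists w, (forall i, (i < z~r.+1)%N -> rule z~l w i) /\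
   y = lk w z~r.
have rule_aeval v w a : (forall i, (i < a.+1)%N -> rule v w i) ->
    forall t, (aterm_num t <= a)%N -> lk w (aterm_num t) = aeval v t.
  move=> h; elim=> [n|t IH|t IHt u IHu] /= ta.
  - by have [[m [E ->]]|[[j [E _]]|[b [c [E _]]]]] := h (aterm_num (ABase n)) ta; rewrite /= in E; try lia; congr (nat_of_bool (lk v _ != _)); lia.
  - have [[m [E _]]|[[j [E ->]]|[b [c [E _]]]]] := h (aterm_num (ACompl t)) ta; rewrite /= in E; try lia.
    have -> : j = aterm_num t by lia.
    by rewrite IH ?(leq_trans _ ta) //; [case: (aeval v t)|lia].
  - have [[m [E _]]|[[j [E _]]|[b [c [E ->]]]]] := h (aterm_num (AUnion t u)) ta; rewrite /= in E; try lia.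
    have /pr_inj[<- <-] : pr (aterm_num t) (aterm_num u) = pr b c by lia.
    have [a1 a2] := leq_pr (aterm_num t) (aterm_num u).
    by rewrite IHt ?IHu; [case: (aeval v t); case: (aeval v u)|lia|lia].
have [||f hf fP] := @ce_select P.
- by rewrite /P /rule; rauto.
- move=> z; have /choice[dec_ hdec] := aterm_num_surj.
  have [w hw] := lk_mkseq (fun i => nat_of_bool (aeval z~l (dec_ i))) z~r.+1.
  exists (lk w z~r), w; split=> // i iz; rewrite /rule hw //.
  have := hdec i; case: (dec_ i) => [n|t|t u] /= E.
  + by left; exists n.
  + right; left; exists (aterm_num t); split=> //; rewrite hw; last by lia.
    have -> : dec_ (aterm_num t) = t by apply: aterm_num_inj; rewrite hdec.
    by case: (aeval _ t).
  + right; right; exists (aterm_num t), (aterm_num u); split=> //.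
    have [a1 a2] := leq_pr (aterm_num t) (aterm_num u).
    rewrite !hw; [|by lia|by lia].
    have -> : dec_ (aterm_num t) = t by apply: aterm_num_inj; rewrite hdec.
    have -> : dec_ (aterm_num u) = u by apply: aterm_num_inj; rewrite hdec.
    by case: (aeval _ t); case: (aeval _ u).
exists (fun v a => f (pr v a)); first by rauto.
move=> v t; have [w] := fP (pr v (aterm_num t)); rewrite !unprK /= => -[h ->].
exact: rule_aeval h _ _.
Qed.

Lemma size_seq_num s : (size s <= seq_num s)%N.
Proof. by elim: s => //= x s IH; have := (leq_pr x (seq_num s)).2; lia. Qed.

Definition simple_eval (v : nat) (s : seq (nat * aterm)) : rat :=
  \sum_(kt <- s) qnum kt.1 * (aeval v kt.2)%:R.

Lemma qnum0 : qnum 0 = 0.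
Proof. by have := qnumE 0 0 0; rewrite (_ : pr 0 (pr 0 0) = 0%N) // subrr mul0r. Qed.

Lemma simple_eval_qrec : exists2 f : nat -> nat -> rat,
  qrec (fun z => f z~l z~r) &
  forall v s, f v (simple_num s) = simple_eval v s.
Proof.
have [e he eE] := aeval_rec.
(* The list code itself bounds the length of the list; the entries past the end are 0 and contribute
   nothing, as [qnum 0 = 0]. *)
exists (fun v c => \sum_(i < c) qnum (lk c i)~l * (e v (lk c i)~r)%:R).
  apply: (@qrec_sum (fun z i => qnum (lk z~r i)~l *
    (e z~l (lk z~r i)~r)%:R)); by rauto.
move=> v s; rewrite /simple_eval (big_nth (0%N, ABase 0)).
rewrite -(big_mkord xpredT (fun i => qnum (lk (simple_num s) i)~l *
  (e v (lk (simple_num s) i)~r)%:R)).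
have le_s : (size s <= simple_num s)%N.
  by apply: leq_trans (size_seq_num _); rewrite size_map.
rewrite (big_cat_nat (n := size s)) //= [X in _ + X]big1_seq ?addr0; last first.
  move=> i; rewrite mem_index_iota => /andP[_ /andP[si _]].
  by rewrite /simple_num lk_seq_num nth_default ?size_map // qnum0 mul0r.
rewrite big_nat [RHS]big_nat; apply: eq_bigr => i /= si.
rewrite /simple_num lk_seq_num (nth_map (0%N, ABase 0)) // unprK /=.
by rewrite eE.
Qed.

End aterm_codes.

(** * Cells on which simple functions are constant *)

Section cells.
Context {R : realType} {X : computablePolishType R}.
Implicit Types (B O : nat -> set X).

(** The first [N] bits of [v] choose between [B i] and an open set [O i], which stands in for the
    complement of [B i] up to a null set. Unlike the atoms of the generated algebra, these cells are
    c.e. open. *)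
Definition cell B O (N v : nat) : set X :=
  [set x | forall i, (i < N)%N -> (lk v i != 0%N /\ B i x) \/ (lk v i = 0%N /\ O i x)].

Lemma aset_cell B O N v x t : (forall n, B n `&` O n = set0) -> cell B O N v x ->
  (aterm_num t < N)%N -> aset B t x <-> aeval v t.
Proof.
move=> BO cx; elim: t => [n|t IH|t IHt u IHu] /= tN.
- have [|[-> //]|[-> /= Ox]] := cx n; first by lia.
  by split=> // Bx; have : (B n `&` O n) x by []; rewrite BO.
- have [|h1 h2] := IH _; first by lia.
  by split=> [nx|/negP h /h1 //]; apply/negP => /h2.
- have [a1 a2] := leq_pr (aterm_num t) (aterm_num u).
  have h1 := IHt ltac:(lia); have h2 := IHu ltac:(lia).
  split=> [[/h1 ->|/h2 ->]|/orP[/h1|/h2]]; rewrite ?orbT //; by [left|right].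
Qed.

Lemma simple_fun_cell B O v x s : (forall n, B n `&` O n = set0) ->
  cell B O (simple_num s).+1 v x ->
  simple_fun B s x = (ratr (simple_eval v s))%:E :> \bar R.
Proof.
move=> BO cx; rewrite /simple_fun /simple_eval ratr_sum; congr EFin.
have : all (fun kt => aterm_num kt.2 < (simple_num s).+1)%N s.
  elim: {cx}s => //= -[k t] s IH; rewrite {1}/simple_num /= -/(simple_num s).
  have [h1 h2] := leq_pr k (aterm_num t).
  have [h3 h4] := leq_pr (pr k (aterm_num t)) (simple_num s).
  apply/andP; split; first by lia.
  by apply: sub_all IH => kt; rewrite /simple_num /= -/(simple_num s); lia.
elim: s (simple_num s).+1 cx => [|[k t] s IH] N cx; first by rewrite !big_nil.
rewrite !big_cons /= => /andP[tN sN]; rewrite (IH N) //; congr (_ + _).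
rewrite ratrM ratr_nat indicE; congr (_ * _%:R); congr nat_of_bool.
by apply/idP/idP; rewrite inE => /(aset_cell BO cx tN).
Qed.

Lemma uopen_cell B O : uopen B -> uopen O ->
  uopen (fun z => cell B O z~l z~r).
Proof.
move=> hB hO.
apply: (@uopen_all _ _ (fun z i => [set x | (lk z~r i != 0%N /\ B i x) \/
  (lk z~r i = 0%N /\ O i x)])); last by rauto.
apply: (@uopenU _ _ (fun z => [set x | _ /\ _]) (fun z => [set x | _ /\ _])).
  apply: uopen_guard; first by rauto.
  by apply: (uopen_comp hB); rauto.
apply: uopen_guard; first by rauto.
by apply: (uopen_comp hO); rauto.
Qed.

Lemma cell_ex B O N x : (forall n, B n x \/ O n x) -> exists v, cell B O N v x.
Proof.
move=> h; have [v hv] := lk_mkseq (fun n => nat_of_bool `[< B n x >]) N.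
exists v => i iN; rewrite hv //; case: asboolP => Bx; first by left.
by right; split=> //; have [] := h i.
Qed.

(** Replacing [w] by 0 off the cells makes it lsc: a superlevel set at a nonnegative rational is
    then a union of cells, selected by comparing rationals. *)
Lemma cell_lsc B O (phi : nat -> nat -> rat) N (w : nat -> X -> R) :
  uopen B -> uopen O -> qrec (fun z => phi z~l z~r) -> rec N ->
  (forall n x, 0 <= w n x) ->
  (forall n v x, cell B O (N n) v x -> w n x = ratr (phi n v)) ->
  exists2 W : nat -> X -> \bar R, ulsc W &
    forall n x, (0 <= W n x <= (w n x)%:E)%E /\
      ((forall i, B i x \/ O i x) -> W n x = (w n x)%:E).
Proof.
move=> hB hO hphi hN w0 hw.
pose W n x := if `[< exists v, cell B O (N n) v x >] then (w n x)%:E else 0%E.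
exists W; last first.
  move=> n x; rewrite /W; case: asboolP => h; first by rewrite lee_fin w0 lexx.
  by rewrite lexx lee_fin w0; split=> // /(cell_ex (N n)).
have : uopen (fun z => if (qnum z~r < 0) then [set: X] else
  [set x | exists v, qnum z~r < phi z~l v /\ cell B O (N z~l) v x]).
  apply: uopen_guard2; first by rauto.
  apply: (@uopen_ex _ _ (fun z v => cell B O (N z~l) v)
    (fun z v => qnum z~r < phi z~l v)); last by rauto.
  by apply: (@uopen_comp2 _ _ (cell B O) _ _ (uopen_cell hB hO)); rauto.
apply: uopen_iff => z x /=; rewrite /W; case: asboolP => [[v cx]|ncx]; rewrite lte_fin.
  case: ifP => h; first by split=> // _; apply: lt_le_trans (w0 _ _); rewrite ltrq0.
  split=> [[v' [h1 h2]]|h1]; first by rewrite (hw _ _ _ h2) ltr_rat.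
  by exists v; split=> //; rewrite -(ltr_rat R) -(hw _ _ _ cx).
rewrite ltrq0; case: ifP => h; first by [].
by split=> // -[v [_ cx]]; case: ncx; exists v.
Qed.

End cells.

Section probability_integrals.
Context d (T : measurableType d) (R : realType) (P : probability T R).

Lemma integral_prob_cst (M : R) : (\int[P]_x M%:E = M%:E)%E.
Proof. by rewrite integral_cst //= probability_setT mule1. Qed.

Lemma integral_prob_le (f : T -> \bar R) (M : R) : measurable_fun setT f ->
  (forall x, 0 <= f x)%E -> (forall x, f x <= M%:E)%E ->
  (\int[P]_x f x <= M%:E)%E.
Proof.
by move=> mf f0 fM; rewrite -(integral_prob_cst M); apply: ge0_le_integral.
Qed.

Lemma integral_prob_fin (f : T -> \bar R) (M : R) : measurable_fun setT f ->
  (forall x, 0 <= f x)%E -> (forall x, f x <= M%:E)%E ->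
  (\int[P]_x f x)%E \is a fin_num.
Proof.
move=> mf f0 fM; rewrite ge0_fin_numE ?integral_ge0 //.
by apply: le_lt_trans (integral_prob_le mf f0 fM) _; rewrite ltry.
Qed.

Lemma integral_compl (w : T -> R) (M : R) : measurable_fun setT w ->
  (forall x, 0 <= w x) -> (forall x, w x <= M) ->
  fine (\int[P]_x (M - w x)%:E)%E = M - fine (\int[P]_x (w x)%:E)%E.
Proof.
move=> mw w0 wM.
have mw' : measurable_fun setT (fun x => (w x)%:E) by exact/measurable_EFinP.
have mw2 : measurable_fun setT (fun x => (M - w x)%:E).
  by apply/measurable_EFinP; apply: measurable_funB.
have E : (\int[P]_x (M - w x)%:E + \int[P]_x (w x)%:E = M%:E)%E.
  rewrite -ge0_integralD //; last 2 first.
  - by move=> x _; rewrite lee_fin subr_ge0.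
  - by move=> x _; rewrite lee_fin.
  rewrite -(integral_prob_cst M); apply: eq_integral => x _.
  by rewrite -EFinD subrK.
have wfin : (\int[P]_x (w x)%:E)%E \is a fin_num.
  by apply: (@integral_prob_fin _ M) => // x; rewrite lee_fin.
have wfin2 : (\int[P]_x (M - w x)%:E)%E \is a fin_num.
  by apply: (@integral_prob_fin _ M) => // x; rewrite lee_fin ?subr_ge0 ?gerBl.
apply: (canRL (addrK _)).
by have := congr1 fine E; rewrite fineD.
Qed.

End probability_integrals.

Section simple_functions.
Context {R : realType} {X : computablePolishType R} (nu : probability (Borel X) R).
Variable B : nat -> set X.
Hypothesis hnu : computable_measure nu.
Hypothesis hB : computable_basis nu B.

Lemma uopen_basis : uopen B.
Proof.
case: hB => -[h hh] _ _ _.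
have [|j hj jP] := @yields_select (fun=> h) id (fun n e => open_index e (B n)) (rec_const h) rec_id.
  exact: hh.
exact: uopen_of_index hj jP.
Qed.

(** [O n] is the complement of the effectively closed superset paired with [B n]; what lies between
    the two sets is null, and there are countably many [n]. *)
Lemma basis_outer : exists O : nat -> set X, [/\ uopen O,
  forall n, B n `&` O n = set0 & nu.-negligible [set x : Borel X | exists n, ~ B n x /\ ~ O n x]].
Proof.
case: hB => _ _ _ [h hh].
have [|j hj jP] := @yields_select (fun=> h) id (fun n e => exists V : set X,
  [/\ eff_closed_index e V, B n `<=` V & nu V = nu (B n)]) (rec_const h) rec_id.
  exact: hh.
have [V hV] := choice jP.
have hO : uopen (fun n => ~` V n) by apply: (uopen_of_index hj) => n; case: (hV n).
have mB n : measurable (B n : set (Borel X)) by exact: measurable_uopen uopen_basis.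
have mV n : measurable (V n : set (Borel X)).
  rewrite -(setCK (V n)); apply: measurableC; exact: (measurable_uopen n hO).
exists (fun n => ~` V n); split=> [//|n|].
  case: (hV n) => _ BV _; rewrite -subset0 => x [Bx Vx]; exact/Vx/BV.
have sub : [set x : Borel X | exists n, ~ B n x /\ ~ (~` V n) x] `<=` \bigcup_n (V n `\` B n).
  by move=> x /= [n [nB /contrapT Vx]]; exists n.
apply: (negligibleS sub).
apply: negligible_bigcup => n; exists (V n `\` B n); split=> //.
  exact: measurableD.
case: (hV n) => _ BV VB; rewrite measureD //; last first.
  by rewrite -ge0_fin_numE // fin_num_measure.
rewrite setIidr //.
have E : (nu (V n) - nu (B n) = 0)%E by rewrite VB subee // fin_num_measure.
exact: E.
Qed.

Lemma lcut_cells (phi : nat -> nat -> rat) N (w : nat -> X -> R) (M : nat -> R) O :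
  uopen O -> nu.-negligible [set x : Borel X | exists n, ~ B n x /\ ~ O n x] ->
  qrec (fun z => phi z~l z~r) -> rec N ->
  (forall n, measurable_fun [set: Borel X] (w n : Borel X -> R)) ->
  (forall n x, 0 <= w n x) -> (forall n x, w n x <= M n) ->
  (forall n v x, cell B O (N n) v x -> w n x = ratr (phi n v)) ->
  lcut (fun n => fine (\int[nu]_x (w n x)%:E)%E).
Proof.
move=> hO hneg hphi hN mw w0 wM hw.
have [W hW WP] := cell_lsc uopen_basis hO hphi hN w0 hw.
have W0 n x : (0 <= W n x)%E by have [/andP[]] := WP n x.
have mw' n : measurable_fun [set: Borel X] (fun x : Borel X => (w n x)%:E : \bar R).
  exact/measurable_EFinP.
have E n : (\int[nu]_x (w n x)%:E = \int[nu]_x W n x)%E.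
  apply: ge0_ae_eq_integral => //.
  - exact: measurable_ulsc.
  - by move=> x _; rewrite lee_fin.
  - apply: negligibleS _ hneg => x /= /not_implyP[_ nE].
    apply: contrapT => h; apply: nE; rewrite (WP n x).2 // => i.
    by apply: contrapT => /not_orP nBO; apply: h; exists i.
have : lcut (fun n => fine (\int[nu]_x W n x)%E).
  apply: lcut_integral => // n; rewrite -E.
  apply: le_lt_trans (@integral_prob_le _ (Borel X) R nu _ (M n) (mw' n) _ _) _ => [x|x|].
  - by rewrite lee_fin.
  - by rewrite lee_fin.
  - exact: ltry.
by apply: lcut_ext => n; rewrite E.
Qed.

(** The complement [M - w] is constant on the same cells, so its integral is left-c.e. too, which is
    the upper cut of the integral of [w]. *)
Lemma cuts_cells (phi : nat -> nat -> rat) N (w : nat -> X -> R) M O :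
  uopen O -> nu.-negligible [set x : Borel X | exists n, ~ B n x /\ ~ O n x] ->
  qrec (fun z => phi z~l z~r) -> rec N -> rec M ->
  (forall n, measurable_fun [set: Borel X] (w n : Borel X -> R)) ->
  (forall n x, 0 <= w n x) -> (forall n x, w n x <= (M n)%:R) ->
  (forall n v x, cell B O (N n) v x -> w n x = ratr (phi n v)) ->
  lcut (fun n => fine (\int[nu]_x (w n x)%:E)%E) /\
  lcut (fun n => - fine (\int[nu]_x (w n x)%:E)%E).
Proof.
move=> hO hneg hphi hN hM mw w0 wM hw; split; first exact: lcut_cells wM hw.
have h : lcut (fun n => fine (\int[nu]_x ((M n)%:R - w n x)%:E)%E).
  apply: (@lcut_cells (fun n v => (M n)%:R - phi n v) N _ (fun n => (M n)%:R) O) => //.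
  - by rauto.
  - by move=> n; apply: measurable_funB.
  - by move=> n x; rewrite subr_ge0.
  - by move=> n x; rewrite gerBl.
  - by move=> n v x /hw ->; rewrite rmorphB /= ratr_nat.
have hM' : lcut (fun n => - (M n)%:R : R).
  apply: lcut_ext (lcut_qrec (_ : qrec (fun n => - (M n)%:R))) => [n|]; last by rauto.
  by rewrite rmorphN /= ratr_nat.
apply: lcut_ext (lcut_add h hM') => n.
by rewrite (@integral_compl _ (Borel X) R nu _ _ (mw n) (w0 n) (wM n)); lra.
Qed.

Lemma measurable_aset t : measurable (aset B t : set (Borel X)).
Proof.
elim: t => [n|t IH|t IHt u IHu] /=.
- exact: measurable_uopen uopen_basis.
- exact: measurableC.
- exact: measurableU.
Qed.

Definition simple_real (s : seq (nat * aterm)) (x : X) : R := fine (simple_fun B s x).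

Lemma simple_realE s x : simple_fun B s x = (simple_real s x)%:E.
Proof. by []. Qed.

Lemma measurable_simple_real s : measurable_fun [set: Borel X] (simple_real s : Borel X -> R).
Proof.
apply: measurable_sum => kt; apply: measurable_funM => //.
by apply: measurable_indic; exact: measurable_aset.
Qed.

Lemma measurable_simple_fun s :
  measurable_fun [set: Borel X] (simple_fun B s : Borel X -> \bar R).
Proof. by apply/measurable_EFinP; exact: measurable_simple_real. Qed.

Lemma simple_real_ge0 s x : simple_nneg s -> 0 <= simple_real s x.
Proof.
rewrite /simple_real /=; elim: s => [|kt s IH] /=; first by rewrite big_nil.
by rewrite big_cons => /andP[k0 /IH sx]; rewrite addr_ge0 // mulr_ge0 ?ler0q.
Qed.

Lemma cuts_simple (s : nat -> seq (nat * aterm)) F M :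
  rec (fun n => simple_num (s n)) -> (forall n, simple_nneg (s n)) ->
  qrec F -> (forall n, 0 <= F n) -> rec M ->
  lcut (fun n => fine (\int[nu]_x (Num.min (ratr (F n) * simple_real (s n) x) (M n)%:R)%:E)%E) /\
  lcut (fun n => - fine (\int[nu]_x (Num.min (ratr (F n) * simple_real (s n) x) (M n)%:R)%:E)%E).
Proof.
move=> hs s0 hF F0 hM; have [V [hO BO hneg]] := basis_outer.
have [f hf fE] := simple_eval_qrec.
pose c n := simple_num (s n); have {}hs : rec c := hs.
pose phi n v := if F n * f v (c n) < (M n)%:R then F n * f v (c n) else (M n)%:R.
apply: (@cuts_cells phi (fun n => (c n).+1) _ M V hO hneg) => //.
- by rewrite /phi; rauto.
- by rauto.
- move=> n; apply: measurable_minr => //; apply: measurable_funM => //.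
  exact: measurable_simple_real.
- by move=> n x; rewrite le_min mulr_ge0 ?ler0q ?simple_real_ge0 /=.
- by move=> n x; rewrite ge_min lexx orbT.
- move=> n v x cx; have := simple_fun_cell BO cx; rewrite simple_realE => -[->].
  rewrite /phi /c fE -(ltr_rat R) ratrM ratr_nat /Num.min.
  by case: ifP => _; rewrite ?ratrM ?ratr_nat.
Qed.

End simple_functions.

(** * Approximating lsc functions from below by simple functions *)

Section stages.
Context {R : realType} {X : computablePolishType R} (nu : probability (Borel X) R).
Variable B : nat -> set X.
Hypothesis hB : computable_basis nu B.

Lemma basis_cover (U : nat -> set X) : uopen U -> exists2 W : nat -> nat -> Prop,
  ce (fun z => W z~l z~r) & forall n x, U n x <-> exists i, W n i /\ B i x.
Proof.
move=> /index_of_uopen[e he eP]; case: hB => _ [h hh] _ _.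
have [|j hj jP] := @yields_select (fun=> h) e
  (fun n j => U n = \bigcup_(i in [set i | yields j i (fun=> True)]) B i) (rec_const h) he.
  by move=> n; exact: hh.
exists (fun n i => yields (j n) i (fun=> True)).
  by apply: (@ce_comp2 (fun e k => yields e k (fun=> True)) _ _ ce_yieldsT); rauto.
by move=> n x; rewrite jP; split=> [[i ji Bi]|[i [ji Bi]]]; exists i.
Qed.

Definition aempty := ACompl (AUnion (ABase 0) (ACompl (ABase 0))).

Lemma aset_empty : aset B aempty = set0.
Proof. by rewrite /= setUv setCT. Qed.

Definition aunion (b : nat -> bool) (m : nat) : aterm :=
  iteri m (fun i t => if b i then AUnion (ABase i) t else t) aempty.

Lemma aset_aunion b m x : aset B (aunion b m) x <-> exists i, ((i < m)%N /\ b i) /\ B i x.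
Proof.
elim: m => [|m IH].
  by have -> : aunion b 0 = aempty by []; rewrite aset_empty; split=> [|[i [[]]]].
rewrite /aunion iteriS -/(aunion b m); case bm: (b m) => /=; split.
- move=> [Bx|/IH[i [[im bi] Bi]]]; first by exists m.
  by exists i; split=> //; split=> //; exact: ltnW.
- move=> [i [[]]]; rewrite ltnS leq_eqVlt => /orP[/eqP -> _ Bm|im bi Bi]; first by left.
  by right; apply/IH; exists i.
- by move=> /IH[i [[im bi] Bi]]; exists i; split=> //; split=> //; exact: ltnW.
- move=> [i [[]]]; rewrite ltnS leq_eqVlt => /orP[/eqP ->|im bi Bi]; first by rewrite bm.
  by apply/IH; exists i.
Qed.

Lemma rec_aunion (b : nat -> nat -> bool) m :
  dec (fun z => b z~l z~r) -> rec m ->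
  rec (fun n => aterm_num (aunion (b n) (m n))).
Proof.
move=> hb hm.
have := @rec_iteri (fun=> aterm_num aempty)
  (fun n i r => if b n i then (2 + 3 * pr (3 * i) r)%N else r) m (rec_const _) _ hm.
move=> H; apply: rec_ext (H _) => [n|]; last by rauto.
rewrite /aunion; elim: (m n) => // k IH.
by rewrite !iteriS IH; case: (b n k).
Qed.

(** [lsum] as a simple function; [pr 1 (pr 0 m)] is the rational code of [1/(m+1)]. *)
Definition alevels (T : nat -> aterm) (m : nat) : seq (nat * aterm) :=
  iteri (m.+1 ^ 2) (fun j s => (pr 1 (pr 0 m), T j) :: s) [::].

Lemma simple_fun_alevels T m x :
  simple_fun B (alevels T m) x = (lsum m (fun j => x \in aset B (T j)))%:E :> \bar R.
Proof.
rewrite /simple_fun /alevels /lsum; congr EFin.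
elim: (m.+1 ^ 2)%N => [|k IH]; first by rewrite big_nil big_ord0.
by rewrite iteriS big_cons big_ord_recr /= IH addrC indicE qnumE subr0 mul1r ratr_inv_nat.
Qed.

Lemma simple_nneg_alevels T m : simple_nneg (alevels T m).
Proof.
rewrite /simple_nneg /alevels; elim: (m.+1 ^ 2)%N => //= k ->.
by rewrite qnumE subr0 mul1r invr_ge0 ler0n.
Qed.

Lemma rec_alevels (T : nat -> nat -> aterm) m :
  rec (fun z => aterm_num (T z~l z~r)) -> rec m ->
  rec (fun n => simple_num (alevels (T n) (m n))).
Proof.
pose t n j := aterm_num (T n j) => hT hm.
have {}hT : rec (fun z => t z~l z~r) := hT.
have := @rec_iteri (fun=> 0%N)
  (fun n j r => (pr (pr (pr 1 (pr 0 (m n))) (t n j)) r).+1) (fun n => (m n).+1 ^ 2)%N (rec_const _).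
move=> H; apply: rec_ext (H _ _) => [n||]; [|by rauto|by rauto].
by rewrite /simple_num /alevels; elim: ((m n).+1 ^ 2)%N => //= k ->.
Qed.

(** Stage [m] replaces each superlevel set in [lsum] by the basic sets discovered by a search
    bounded by [m]. The bound makes the terms computable, and each fixed basic set is discovered at
    all large stages. The stages are lsc because they are positive combinations of indicators of
    finite unions of basic sets. *)
Lemma simple_stages (f : nat -> X -> \bar R) : ulsc f -> (forall n x, 0 <= f n x)%E ->
  exists s : nat -> nat -> seq (nat * aterm),
  [/\ rec (fun z => simple_num (s z~l z~r)),
      forall n m, simple_nneg (s n m),
      ulsc (fun z => simple_fun B (s z~l z~r)),
      forall n m x, (simple_fun B (s n m) x <= f n x)%E &
      forall n x (q : R), 0 <= q -> (q%:E < f n x)%E ->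
        exists M, forall m, (M <= m)%N -> (q%:E <= simple_fun B (s n m) x)%E].
Proof.
move=> hf f0; have [W [b hb bW] WP] := basis_cover hf.
have {}bW n k i : W (pr n k) i <-> exists w, b (pr (pr (pr n k) i) w).
  by have := bW (pr (pr n k) i); rewrite unprK.
have {}WP n k x : ((ratr (qnum k))%:E < f n x)%E <-> exists i, W (pr n k) i /\ B i x.
  by have := WP (pr n k) x; rewrite /= unprK.
(* [k] is a rational level at or above level [j], and [w] a witness that [B i] is listed in the
   superlevel set at [k]. *)
pose S n m j i := bex m (fun k => (j.+1%:R / m.+1%:R <= qnum k) &&
  bex m (fun w => b (pr (pr (pr n k) i) w))).
pose T n m j := aunion (S n m j) m.
have TP n m j x : aset B (T n m j) x <-> exists i, ((i < m)%N /\ S n m j i) /\ B i x.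
  exact: aset_aunion.
have hS : dec (fun z => S z~l~l z~l~r z~r~l z~r~r).
  by rewrite /S; rauto.
exists (fun n m => alevels (T n m) m); split.
- apply: (@rec_alevels (fun z j => T z~l z~r j) (fun z => z~r)); last by rauto.
  rewrite /T; apply: (@rec_aunion (fun z i => S z~l~l z~l~r z~r i)
    (fun z => z~l~r)); last by rauto.
  by rewrite /S; rauto.
- by move=> n m; exact: simple_nneg_alevels.
- have := @ulsc_sum R X (fun z j x => (ratr z~r.+1%:R^-1)%:E *
    (\1_(aset B (T z~l z~r j)) x)%:E)%E (fun z => (z~r.+1 ^ 2)%N).
  move=> H; apply: ulsc_ext (H _ _ _) => [z x|//||]; last by rauto.
    rewrite simple_fun_alevels /lsum -sumEFin; apply: eq_bigr => j _.
    by rewrite ratr_inv_nat indicE EFinM.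
  apply: (@ulsc_scale _ _ (fun z x => (\1_(aset B (T z~l~l z~l~r z~r)) x)%:E)
     (fun z => z~l~r.+1%:R^-1)); first by rauto.
    by move=> z; rewrite invr_gt0 ltr0n.
  apply: (@ulsc_indic _ _ (fun z => aset B (T z~l~l z~l~r z~r))).
  have := @uopen_ex _ _ (fun _ i => B i) (fun z i => (i < z~l~r)%N /\
    S z~l~l z~l~r z~r i).
  move=> H'; apply: uopen_iff (H' _ _) => [z x||].
  + by rewrite TP.
  + by apply: (uopen_comp (uopen_basis hB)); rauto.
  + by rewrite /S; rauto.
- move=> n m x; rewrite simple_fun_alevels; apply: lsum_le => // j.
  rewrite inE => /TP[i [[im /bexP[k km /andP[jk /bexP[w wm bw]]]] Bi]].
  apply: (@le_lt_trans _ _ (ratr (qnum k))%:E).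
    by rewrite lee_fin -ratr_div_nat ler_rat.
  by apply/WP; exists i; split=> //; apply/bW; exists w.
- move=> n x q q0 /ereal_rat_below[k [qk kf]].
  have [M hM] := lsum_near q0 qk.
  have /WP[i [/bW[w bw] Bi]] := kf.
  exists (maxn M (maxn k.+1 (maxn i.+1 w.+1))) => m.
  rewrite !geq_max => /and4P[Mm km im wm].
  rewrite simple_fun_alevels lee_fin; apply: hM => // j hj.
  rewrite inE; apply/TP; exists i; split=> //; split=> //.
  apply/bexP; exists k => //; rewrite -(ler_rat R) ratr_div_nat hj /=.
  by apply/bexP; exists w.
Qed.

End stages.

(** * Truncation and [L_p] norms *)

Section norms.
Context d (T : measurableType d) (R : realType) (P : probability T R).
Implicit Types (f g : T -> \bar R) (p c K : R).

Lemma measurable_mine_cst f c : measurable_fun setT f ->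
  measurable_fun setT (fun x => mine (f x) c%:E).
Proof. by move=> mf; exact: measurable_mine mf (measurable_cst _). Qed.

Lemma poweR_le (a b : \bar R) p : 0 <= p -> (0 <= a)%E -> (a <= b)%E -> (a `^ p <= b `^ p)%E.
Proof.
move=> p0 a0 ab; apply: gt0_ler_poweR => //; rewrite in_itv /= ?leey ?andbT //.
exact: le_trans ab.
Qed.

(** Beyond the cut, [a = a^(1-p) a^p], and the first factor is at most [c^(1-p)] since [p >= 1]. *)
Lemma le_min_poweR (a : \bar R) c p : (0 <= a)%E -> 0 < c -> 1 <= p ->
  (a <= mine a c%:E + (c `^ (1 - p))%:E * a `^ p)%E.
Proof.
move=> a0 c0 p1; have pc : 0 < c `^ (1 - p) by rewrite powR_gt0.
case: a a0 => [r| |] //; last first.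
  by rewrite poweRyr ?gt_eqF ?(lt_le_trans ltr01) // gt0_muley ?lte_fin // addey // /mine; case: ifP.
rewrite lee_fin => r0; have [rc|cr] := leP r c.
  rewrite min_l ?lee_fin // lerDl.
  by rewrite mulr_ge0 ?powR_ge0.
have r1 : 0 < r by exact: lt_trans cr.
rewrite min_r ?lee_fin ?(ltW cr) //.
apply: (@le_trans _ _ (c `^ (1 - p) * r `^ p)); last by rewrite lerDr ltW.
rewrite -[leLHS]powRr1 // -{1}(subrK p 1) powRD; last by rewrite (gt_eqF r1) implybT.
rewrite ler_wpM2r ?powR_ge0 //.
rewrite -(opprB p 1) !powRN lef_pV2 ?posrE ?powR_gt0 //.
by apply: ge0_ler_powR; rewrite ?subr_ge0 ?nnegrE // ltW.
Qed.

Lemma Lnorm_pow g p K : 1 <= p -> ('N[P]_p%:E[g] <= K%:E)%E ->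
  (\int[P]_x (`|g x| `^ p) <= (K `^ p)%:E)%E.
Proof.
move=> p1 gK; have p0 : p != 0 by rewrite gt_eqF // (lt_le_trans ltr01).
rewrite -poweR_Lnorm // -poweR_EFin; apply: poweR_le => //.
  exact: le_trans ler01 p1.
exact: Lnorm_ge0.
Qed.

(** The part of the integral above the cut costs at most [c^(1-p) K^p], which tends to 0 with
    growing [c] as soon as [p > 1]. *)
Lemma integral_trunc g p c K : measurable_fun setT g -> (forall x, 0 <= g x)%E ->
  0 < c -> 1 <= p -> ('N[P]_p%:E[g] <= K%:E)%E ->
  (\int[P]_x g x <= \int[P]_x mine (g x) c%:E + (c `^ (1 - p) * K `^ p)%:E)%E.
Proof.
move=> mg g0 c0 p1 gK.
have mm : measurable_fun setT (fun x => mine (g x) c%:E).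
  exact: measurable_mine_cst.
have mp : measurable_fun setT (fun x => (g x) `^ p)%E.
  exact: (measurableT_comp (measurable_poweR p) mg).
have min0 x : (0 <= mine (g x) c%:E)%E by rewrite le_min g0 lee_fin ltW.
apply: (@le_trans _ _ (\int[P]_x (mine (g x) c%:E + (c `^ (1 - p))%:E * (g x) `^ p))%E).
  apply: ge0_le_integral => //; last by move=> x _; exact: le_min_poweR.
  by apply: emeasurable_funD => //; apply: measurable_funeM.
rewrite ge0_integralD //; last 2 first.
- by move=> x _; rewrite mule_ge0 ?poweR_ge0 // lee_fin powR_ge0.
- exact: measurable_funeM.
rewrite leeD2l // ge0_integralZl_EFin ?powR_ge0 //; last first.
  by move=> x _; rewrite poweR_ge0.
rewrite EFinM lee_wpmul2l ?lee_fin ?powR_ge0 //.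
apply: le_trans (Lnorm_pow p1 gK).
by under [leRHS]eq_integral => x _ do rewrite (gee0_abs (g0 x)).
Qed.

(** Cutting at the norm bound [c] itself: the truncated part is at most [c] and the tail at most
    [c^(1-p) c^p = c], whence the factor 2. *)
Lemma integral_le_Lnorm g p c : measurable_fun setT g -> (forall x, 0 <= g x)%E ->
  0 < c -> 1 <= p -> ('N[P]_p%:E[g] <= c%:E)%E -> (\int[P]_x g x <= (2 * c)%:E)%E.
Proof.
move=> mg g0 c0 p1 gc.
have := integral_trunc mg g0 c0 p1 gc.
rewrite -powRD; last by rewrite (gt_eqF c0) implybT.
rewrite subrK powRr1 ?(ltW c0) // => /le_trans; apply.
rewrite mulr2n mulrDl mul1r EFinD leeD2r //.
apply: integral_prob_le; first exact: measurable_mine_cst.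
  by move=> x; rewrite le_min g0 lee_fin ltW.
by move=> x; rewrite ge_min lexx orbT.
Qed.

Lemma Lnorm_ae_le f g p : 1 <= p -> measurable_fun setT f -> measurable_fun setT g ->
  (\forall x \ae P, (`|f x| <= `|g x|)%E) -> ('N[P]_p%:E[f] <= 'N[P]_p%:E[g])%E.
Proof.
move=> p1 mf mg fg; have p0 : 0 <= p by exact: le_trans ler01 p1.
rewrite unlock; apply: poweR_le; first by rewrite invr_ge0.
  by apply: integral_ge0 => x _; rewrite poweR_ge0.
have mp (h : T -> \bar R) : measurable_fun setT h -> measurable_fun setT (fun x => `|h x| `^ p)%E.
  by move=> mh; exact: (measurableT_comp (measurable_poweR p) (measurableT_comp (@abse_measurable R setT) mh)).
apply: ae_ge0_le_integral => //; try exact: mp; try by move=> x _; rewrite poweR_ge0.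
by apply: filterS fg => x h _; exact: poweR_le.
Qed.

End norms.

(** * Doob's maximal inequality and truncated maximal functions *)

Section maximal_inequality.
Context d (T : measurableType d) (R : realType) (P : probability T R).
Variables (F : nat -> set (set T)) (f : T -> \bar R) (g : nat -> T -> \bar R).
Hypothesis sF : forall n, sigma_algebra [set: T] (F n).
Hypothesis mF : forall n, F n `<=` measurable.
Hypothesis incF : forall n, F n `<=` F n.+1.
Hypothesis mf : measurable_fun setT f.
Hypothesis f0 : forall x, (0 <= f x)%E.
Hypothesis g0 : forall n x, (0 <= g n x)%E.
Hypothesis Fg : forall n (A : set (\bar R)), measurable A -> F n (g n @^-1` A).
Hypothesis intg : forall n A, F n A -> (\int[P]_(x in A) g n x = \int[P]_(x in A) f x)%E.

Lemma measurable_version n : measurable_fun setT (g n).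
Proof. by move=> _ A mA; rewrite setTI; exact/mF/Fg. Qed.

Lemma measurable_sup_version :
  measurable_fun setT (fun x => ereal_sup (range (fun n => g n x))).
Proof.
have := measurable_fun_esups measurable_version 0.
by congr (measurable_fun _ _); apply/funext => x; congr (ereal_sup _); apply/seteqP;
  split=> _ [n _ <-]; exists n.
Qed.

Lemma filtration_le n m : (n <= m)%N -> F n `<=` F m.
Proof.
elim: m => [|m IH]; first by rewrite leqn0 => /eqP ->.
rewrite leq_eqVlt => /orP[/eqP ->//|]; rewrite ltnS => /IH h.
exact: subset_trans h (@incF m).
Qed.

(** The event is split according to the first [n] with [g n > l]. That part belongs to [F n] because
    the filtration increases, so there the integral of [f] equals that of [g n], which is at least
    [l] times the measure. *)
Lemma doob_maximal_inequality (l : R) : 0 < l ->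
  (l%:E * P [set x | l%:E < ereal_sup (range (fun n => g n x))] <= \int[P]_x f x)%E.
Proof.
move=> l0; pose A n := [set x | (l%:E < g n x)%E].
have FA n : F n (A n).
  have := Fg n (emeasurable_itv `]l%:E, +oo[%E).
  by congr (F n _); apply/seteqP; split=> x; rewrite /A /= in_itv /= andbT.
have FD n : F n (seqDU A n).
  rewrite -(measurable_g_measurableTypeE (sF n)).
  have mA k : (k <= n)%N -> measurable (A k : set (g_sigma_algebraType (F n))).
    by move=> kn; rewrite measurable_g_measurableTypeE //; exact: filtration_le kn _ (FA k).
  apply: measurableD; first exact: mA.
  by apply: bigsetU_measurable => k _; apply: mA; exact: ltnW.
have mD n : measurable (seqDU A n) by exact/mF/FD.
have -> : [set x | l%:E < ereal_sup (range (fun n => g n x))]%E = \bigcup_n seqDU A n.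
  rewrite -seqDU_bigcup_eq; apply/seteqP; split=> x /=.
    by move/ereal_sup_gt => [_ [n _ <-] h]; exists n.
  by move=> [n _ h]; apply: lt_le_trans h _; apply: ereal_sup_ubound; exists n.
have mU : measurable (\bigcup_n seqDU A n) by exact: bigcup_measurable.
apply: (@le_trans _ _ (\int[P]_(x in \bigcup_n seqDU A n) f x)%E); last first.
  exact: ge0_subset_integral.
have l0' (x : T) : (\bigcup_n seqDU A n) x -> (0 <= cst l%:E x :> \bar R)%E.
  by rewrite lee_fin ltW.
rewrite -integral_cst // (ge0_integral_bigcup _ mD _ l0' (@trivIset_seqDU _ A)) //.
rewrite (ge0_integral_bigcup _ mD (measurable_funTS mf) (fun x _ => f0 x) (@trivIset_seqDU _ A)).
apply: lee_nneseries => [n _ _|n _].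
  by apply: integral_ge0 => x _; rewrite lee_fin ltW.
rewrite -(intg (FD n)); apply: ge0_le_integral => //.
- by move=> x _; rewrite lee_fin ltW.
- apply: measurable_funTS; exact: measurable_version.
- by move=> x [h _]; exact: ltW.
Qed.

(** Where the supremum is at most [e / c] the integrand is at most [e]; elsewhere it is at most 1,
    and the maximal inequality bounds the measure of that set. *)
Lemma integral_min_sup (c e : R) : 0 < c -> 0 < e ->
  (\int[P]_x mine (c%:E * ereal_sup (range (fun n => g n x))) 1%:E <=
   e%:E + (c / e)%:E * \int[P]_x f x)%E.
Proof.
move=> c0 e0; set s := fun x => ereal_sup (range (fun n => g n x)).
change (\int[P]_x mine (c%:E * s x) 1%:E <= e%:E + (c / e)%:E * \int[P]_x f x)%E.
have s0 x : (0 <= s x)%E.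
  by apply: le_trans (g0 0 x) _; apply: ereal_sup_ubound; exists 0.
have ms : measurable_fun setT s := measurable_sup_version.
pose A := [set x | ((e / c)%:E < s x)%E].
have mA : measurable A.
  have := ms measurableT _ (emeasurable_itv `](e / c)%:E, +oo[%E).
  by congr measurable; rewrite setTI; apply/seteqP; split=> x; rewrite /A /= in_itv /= andbT.
have m1 : measurable_fun setT (fun x => (\1_A x)%:E : \bar R).
  by apply/measurable_EFinP; exact: measurable_indic.
apply: (@le_trans _ _ (\int[P]_x (e%:E + (\1_A x)%:E))%E).
  apply: ge0_le_integral => //.
  - by move=> x _; rewrite le_min mule_ge0 ?lee01 // lee_fin ltW.
  - by apply: measurable_mine_cst; exact: measurable_funeM.
  - exact: emeasurable_funD.
  - move=> x _; rewrite indicE; case: (boolP (x \in A)) => xA.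
      by rewrite ge_min; apply/orP; right; rewrite -EFinD lee_fin lerDr ltW.
    rewrite adde0 ge_min; apply/orP; left.
    have : (s x <= (e / c)%:E)%E.
      by rewrite leNgt; apply: contra xA => xA; rewrite inE.
    move=> /(lee_wpmul2l (_ : 0 <= c%:E)%E) => /(_ _)/le_trans; apply; first by rewrite lee_fin ltW.
    by rewrite -EFinM mulrCA divff ?mulr1 // gt_eqF.
have e0' (x : T) : [set: T] x -> (0 <= e%:E :> \bar R)%E by rewrite lee_fin ltW.
have i0 (x : T) : [set: T] x -> (0 <= (\1_A x)%:E :> \bar R)%E by rewrite lee_fin.
rewrite (ge0_integralD _ measurableT e0' (measurable_cst _) i0 m1).
rewrite integral_prob_cst leeD2l // integral_indic // setIT.
suff h' : (P A <= (c / e)%:E * \int[P]_x f x)%E by exact: h'.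
have := doob_maximal_inequality (divr_gt0 e0 c0).
rewrite -/s -/A => h.
have -> : P A = ((c / e)%:E * ((e / c)%:E * P A))%E.
  by rewrite muleA -EFinM -[e / c]invf_div mulfV ?mul1e // gt_eqF ?divr_gt0.
by apply: lee_wpmul2l => //; rewrite lee_fin divr_ge0 // ltW.
Qed.

End maximal_inequality.

(** * Schnorr tests *)

Section tests.
Context {R : realType} {X : computablePolishType R} (nu : probability (Borel X) R).
Hypothesis hnu : computable_measure nu.
Implicit Types (f g : X -> \bar R) (p : R).

Lemma ulsc_of_index1 e f : lsc_index e f -> ulsc (fun=> f).
Proof. by move=> h; apply: (@ulsc_of_index _ _ (fun=> e)) => //; exact: rec_const. Qed.

Lemma index1_of_ulsc f : (forall x, f x != -oo%E) -> ulsc (fun=> f) ->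
  exists e, lsc_index e f.
Proof.
by move=> f0 h; have [e _ he] := index_of_ulsc (fun _ => f0) h; exists (e 0).
Qed.

Lemma measurable_lsc e f : lsc_index e f -> measurable_fun [set: Borel X] (f : Borel X -> \bar R).
Proof. by move=> /ulsc_of_index1 h; exact: (measurable_ulsc 0 h). Qed.

(** Rational superlevel sets determine a function, and [phi] is single-valued. It follows that there
    are only countably many tests. *)
Lemma lsc_index_inj e f g : lsc_index e f -> lsc_index e g -> f = g.
Proof.
suff h f' g' : lsc_index e f' -> lsc_index e g' -> forall x, (g' x <= f' x)%E.
  by move=> hf hg; apply/funext => x; apply/le_anti; rewrite !(h f g) ?(h g f).
move=> [f0 hf] [g0 hg] x; rewrite leNgt; apply/negP => fg.
have [k [h1 h2]] : exists k, (f' x <= (ratr (qnum k))%:E)%E /\ ((ratr (qnum k))%:E < g' x)%E.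
  move: (f0 x) fg; case: (f' x) => [r _ /ereal_rat_below[k [h1 h2]]|_|//]; last by rewrite ltNge leey.
  by exists k; rewrite lee_fin ltW.
have [j ej fj] := hf k; have [i ei gi] := hg k.
have : [set x | ((ratr (qnum k))%:E < g' x)%E] x by [].
rewrite gi -(phi_det ej ei) -fj /=.
by rewrite ltNge h1.
Qed.

Lemma Lp_plus_test p f : schnorr_test nu p f -> Lp_plus nu p f.
Proof.
move=> [e [f0 hl [r hr _]]]; split=> //; first exact: measurable_lsc hl.
by rewrite hr ltry.
Qed.

Lemma Lnorm1_ge0 f : (forall x, 0 <= f x)%E -> 'N[nu]_1[f]%E = (\int[nu]_x f x)%E.
Proof.
move=> f0; rewrite Lnorm1; apply: eq_integral => x _; exact: gee0_abs.
Qed.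

(** Each test is integrable, hence finite almost everywhere, and the union runs over countably many
    indices. *)
Lemma SR_ae : nu.-negligible (~` SR nu : set (Borel X)).
Proof.
pose A e := [set x : Borel X | exists f, test_index nu 1 e f /\ f x = +oo%E].
have sub : ~` SR nu `<=` \bigcup_e A e.
  move=> x /= /existsNP[f /not_implyP[[e ef] /negP]].
  rewrite -leNgt leye_eq => /eqP fx.
  by exists e => //; exists f.
apply: (@negligibleS _ (Borel X) R nu _ _ sub); apply: negligible_bigcup => e.
have [[f ef]|nf] := pselect (exists f, test_index nu 1 e f); last first.
  suff -> : A e = set0 by exact: negligible_set0.
  by rewrite -subset0 => x [f [ef _]]; apply: nf; exists f.
have [f0 hl [r hr _]] := ef; have mf := measurable_lsc hl.
have fint : nu.-integrable [set: Borel X] f.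
  by apply/integrableP; split=> //; rewrite -Lnorm1 hr ltry.
apply: negligibleS (integrable_ae measurableT fint) => x [g [eg gx]] /= h.
have fg : f = g by apply: lsc_index_inj hl _; case: eg.
by have := h Logic.I; rewrite fg gx.
Qed.

Lemma ge0_neqNy (a : \bar R) : (0 <= a)%E -> a != -oo%E.
Proof. by move=> a0; rewrite gt_eqF // (lt_le_trans (ltNyr 0)). Qed.

Lemma schnorr_test1 f : (forall x, 0 <= f x)%E -> ulsc (fun=> f) ->
  (\int[nu]_x f x < +oo)%E -> lcut (fun _ : nat => - fine (\int[nu]_x f x)%E) ->
  schnorr_test nu 1 f.
Proof.
move=> f0 hf fi hc.
have [e he] := index1_of_ulsc (fun x => ge0_neqNy (f0 x)) hf.
have hc' := lcut_integral hnu hf (fun _ => f0) (fun _ => fi).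
have [d _ hd] := real_index_of_lcut hc' hc.
exists (pr e (d 0)); split=> //; rewrite ?unpr1K ?unpr2K //.
exists (fine (\int[nu]_x f x)%E) => //.
by rewrite Lnorm1_ge0 // fineK // ge0_fin_numE // integral_ge0.
Qed.

Lemma schnorr_test1_integral f : schnorr_test nu 1 f -> [/\ ulsc (fun=> f),
  (\int[nu]_x f x < +oo)%E & lcut (fun _ : nat => - fine (\int[nu]_x f x)%E)].
Proof.
move=> [e [f0 /ulsc_of_index1 hf [r]]]; rewrite Lnorm1_ge0 // => -> hr.
have [_ hc] := @lcut_of_real_index R (fun=> e~r) (fun=> r) (rec_const _) (fun=> hr).
by rewrite ltry.
Qed.

Definition psums (t : nat -> X -> \bar R) (x : X) : \bar R :=
  ereal_sup (range (fun K => \sum_(i < K) t i x)%E).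

(** The geometric bound gives the partial sums of the integrals a computable modulus of convergence,
    which supplies the upper cut of the integral of the whole sum. *)
Lemma psums_test (t : nat -> X -> \bar R) (b : R) :
  ulsc t -> (forall s x, 0 <= t s x)%E ->
  (forall s, \int[nu]_x t s x <= (b * 2 ^- s)%:E)%E ->
  lcut (fun s => - fine (\int[nu]_x t s x)%E) ->
  schnorr_test nu 1 (psums t).
Proof.
move=> ht t0 tb hc.
have mt s := measurable_ulsc s ht.
have hs : ulsc (fun K x => \sum_(i < K) t i x)%E.
  apply: (@ulsc_sum _ _ (fun _ i => t i) id) => [n i x||].
  - exact: ge0_neqNy.
  - by apply: (ulsc_comp ht); rauto.
  - by rauto.
have ms K := measurable_ulsc K hs.
have s0 K x : (0 <= \sum_(i < K) t i x)%E by apply: sume_ge0.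
have hp : ulsc (fun=> psums t).
  by apply: (@ulsc_sup _ _ (fun _ K x => \sum_(i < K) t i x)%E); apply: (ulsc_comp hs); rauto.
have p0 x : (0 <= psums t x)%E.
  by apply: le_trans (s0 0 x) _; apply: ereal_sup_ubound; exists 0.
have tfin s : (\int[nu]_x t s x)%E \is a fin_num.
  by rewrite ge0_fin_numE ?integral_ge0 // (le_lt_trans (tb s)) ?ltry.
pose y s := fine (\int[nu]_x t s x)%E.
have yb s : y s <= b * 2 ^- s by rewrite -lee_fin fineK.
have y0 s : 0 <= y s by rewrite fine_ge0 // integral_ge0.
have b0 : 0 <= b by have := le_trans (y0 0) (yb 0); rewrite invr1 mulr1.
have ints K : (\int[nu]_x (\sum_(i < K) t i x) = (\sum_(i < K) y i)%:E)%E.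
  rewrite (@ge0_integral_sum _ (Borel X) R nu _ measurableT _ (fun i : 'I_K => t i)) //.
  by rewrite -sumEFin; apply: eq_bigr => i _; rewrite fineK.
(* Keeping the term [- 2 ^- L] in the geometric estimate is what closes the induction on [L]. *)
have geo K L : (K <= L)%N -> \sum_(i < L) y i <= \sum_(i < K) y i + 2 * b * (2 ^- K - 2 ^- L).
  elim: L => [|L IH]; first by rewrite leqn0 => /eqP ->; rewrite subrr mulr0 addr0.
  rewrite leq_eqVlt => /orP[/eqP ->|]; first by rewrite subrr mulr0 addr0.
  rewrite ltnS => /IH h; rewrite big_ord_recr /=.
  apply: le_trans (lerD h (yb L)) _.
  rewrite -addrA lerD2l exprS invfM.
  move: (2 ^- K) (2 ^- L) => u v; lra.
have Tb K : (\int[nu]_x psums t x <= (\sum_(i < K) y i + 2 * b * 2 ^- K)%:E)%E.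
  rewrite leNgt; apply/negP => h.
  have [x q q0 /ereal_sup_gt[_ [M _ <-] hM]|L KL] :=
    @integral_below _ (Borel X) R nu (psums t) _ p0 (measurable_ulsc 0 hp) s0 ms _ K _ h.
    exists M => m Mm; apply: le_trans (ltW hM) _.
    rewrite -(subnK Mm) addnC big_split_ord /=.
    by rewrite leeDl // sume_ge0.
  rewrite ints lte_fin => h'.
  have := geo _ _ KL; have : 0 <= 2 * b * 2 ^- L by rewrite mulr_ge0 ?mulr_ge0 ?invr_ge0 ?exprn_ge0.
  rewrite mulrBr; lra.
have Tfin : (\int[nu]_x psums t x < +oo)%E by apply: le_lt_trans (Tb 0) _; rewrite ltry.
have Tf : (\int[nu]_x psums t x)%E \is a fin_num by rewrite ge0_fin_numE ?integral_ge0.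
apply: schnorr_test1 => //.
(* [b] is an arbitrary real; a natural number above [2 b] takes its place in the computable error
   term. *)
have [b' hb'] : exists b' : nat, 2 * b <= b'%:R :> R.
  by exists (Num.truncn (2 * b)).+1; exact: ltW (Num.Theory.truncnS_gt _).
apply: (@lcut_approx _ (fun _ K => \sum_(i < K) - y i + ratr (- (b'%:R * 2 ^- K)))).
- apply: (@lcut_add _ (fun z => \sum_(i < z~r) - y i) (fun z => ratr (- (b'%:R * 2 ^- z~r)))).
    apply: (@lcut_sum _ (fun _ i => - y i) (fun z => z~r)); last by rauto.
    by apply: (lcut_comp hc); rauto.
  by apply: (@lcut_qrec _ (fun z => - (b'%:R * 2 ^- z~r))); rauto.
- move=> _ K; rewrite rmorphN /= ratrM ratr_nat ratr_exp2N sumrN -opprD lerN2.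
  rewrite -lee_fin fineK //; apply: le_trans (Tb K) _.
  by rewrite lee_fin lerD2l ler_wpM2r // invr_ge0 exprn_ge0.
- move=> _ e e0.
  have [K hK] := @lt_exp2N R (e / b'.+1%:R) ltac:(by rewrite divr_gt0).
  exists K; rewrite rmorphN /= ratrM ratr_nat ratr_exp2N sumrN.
  have : \sum_(i < K) y i <= fine (\int[nu]_x psums t x)%E.
    rewrite -lee_fin fineK // -ints; apply: ge0_le_integral => //.
    - exact: (measurable_ulsc 0 hp).
    - by move=> x _; apply: ereal_sup_ubound; exists K.
  have : b'%:R * 2 ^- K < e.
    move: hK; rewrite ltr_pdivlMr // mulrC; apply: le_lt_trans.
    by rewrite ler_wpM2r ?invr_ge0 ?exprn_ge0 // ler_nat.
  lra.
Qed.

Lemma psums_finite (t : nat -> X -> \bar R) x : (forall s, 0 <= t s x)%E ->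
  (psums t x < +oo)%E -> exists N, forall s, (N <= s)%N -> (t s x < 1)%E.
Proof.
move=> t0; apply: contraPP => /forallNP h.
have {}h N : exists2 s, (N <= s)%N & (1 <= t s x)%E.
  have /existsNP[s /not_implyP[Ns /negP]] := h N.
  by rewrite -leNgt; exists s.
apply/negP; rewrite -leNgt leye_eq; apply/eqP/eqyP => r r0.
have big (k : nat) : exists K, (k%:R%:E <= \sum_(i < K) t i x)%E.
  elim: k => [|k [K hK]]; first by exists 0; rewrite big_ord0.
  have [s Ks ts] := h K; exists s.+1.
  rewrite big_ord_recr /= -natr1 EFinD leeD //; apply: le_trans hK _.
  by rewrite -(subnK Ks) addnC big_split_ord /= leeDl // sume_ge0.
have [K hK] := big (Num.truncn r).+1.
apply: (@le_trans _ _ (\sum_(i < K) t i x)%E).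
  apply: le_trans hK; rewrite lee_fin; exact: ltW (Num.Theory.truncnS_gt _).
by apply: ereal_sup_ubound; exists K.
Qed.

End tests.

Section ereal_inequalities.
Context {R : realType}.

Lemma min_y1 : mine +oo%E 1%:E = 1%:E :> \bar R.
Proof. by rewrite min_r ?leey. Qed.

(** For use with [fh], [fu], [fd] the maximal functions of a function, of a simple function below it
    and of their difference, and with [w] a simple approximation to [fu]. The maximal functions may
    be infinite, hence the cases. *)
Lemma min_le_split (c w : R) (fh fu fd : \bar R) : 0 < c -> 0 <= w ->
  (0 <= fh)%E -> (0 <= fu)%E -> (0 <= fd)%E -> (fh <= fu + fd)%E ->
  (mine (c%:E * fh) 1%:E <= (Num.min (c * w) 1)%:E +
    (c%:E * `|w%:E - fu| + mine (c%:E * fd) 1%:E))%E.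
Proof.
move=> c0 w0 h0; have cw : 0 <= Num.min (c * w) 1 by rewrite le_min mulr_ge0 // ltW.
case: fu => [u| |] //; last first.
  move=> _ fd0 _; rewrite /= gt0_muley ?lte_fin // addye ?addey ?leey //.
  by rewrite gt_eqF // (lt_le_trans (ltNyr 0)) // le_min mule_ge0 // lee_fin ltW.
case: fd => [v| |] //; last first.
  move=> _ _ _; rewrite gt0_muley ?lte_fin // min_y1.
  apply: (@le_trans _ _ 1%:E); first by rewrite ge_min lexx orbT.
  rewrite -EFinB /= -EFinM -!EFinD lee_fin.
  by rewrite addrA lerDr addr_ge0 // mulr_ge0 ?normr_ge0 // ltW.
case: fh h0 => [r| |] //; rewrite !lee_fin => r0 u0 v0 h.
rewrite -EFinB /= -!EFinM.
have -> : mine (c * r)%:E 1%:E = (Num.min (c * r) 1)%:E by rewrite EFin_min.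
have -> : mine (c * v)%:E 1%:E = (Num.min (c * v) 1)%:E by rewrite EFin_min.
rewrite -!EFinD lee_fin.
have h1 : c * r <= c * u + c * v by rewrite -mulrDr ler_wpM2l // ltW.
have h2 : c * u - c * w <= c * `|w - u|.
  by rewrite -mulrBr ler_wpM2l ?(ltW c0) // distrC ler_norm.
have h3 : 0 <= c * `|w - u| by rewrite mulr_ge0 ?normr_ge0 // ltW.
have h4 : 0 <= c * w by rewrite mulr_ge0 // ltW.
have h5 : 0 <= c * v by rewrite mulr_ge0 // ltW.
move: (c * r) (c * u) (c * v) (c * w) (c * `|w - u|) h1 h2 h3 h4 h5 => r' u' v' w' a *.
by case: (leP r' 1); case: (leP w' 1); case: (leP v' 1) => *; lra.
Qed.

Lemma min_le_split2 (c w : R) (fh fu : \bar R) : 0 < c -> 0 <= w ->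
  (0 <= fu)%E -> (fu <= fh)%E ->
  ((Num.min (c * w) 1)%:E <= mine (c%:E * fh) 1%:E + c%:E * `|w%:E - fu|)%E.
Proof.
move=> c0 w0; case: fu => [u| |] //; last first.
  move=> _; rewrite leye_eq => /eqP ->.
  by rewrite !gt0_muley ?lte_fin // min_y1 addey ?leey.
rewrite lee_fin => u0; case: fh => [r| |] //; last first.
  move=> _; rewrite gt0_muley ?lte_fin // min_y1.
  rewrite -EFinB /= -EFinM -EFinD lee_fin.
  apply: (@le_trans _ _ (1 : R)); first by rewrite ge_min lexx orbT.
  by rewrite lerDl mulr_ge0 ?normr_ge0 // ltW.
rewrite lee_fin -EFinB /= -!EFinM => ur.
have -> : mine (c * r)%:E 1%:E = (Num.min (c * r) 1)%:E by rewrite EFin_min.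
rewrite -!EFinD lee_fin.
have h1 : c * u <= c * r by rewrite ler_wpM2l // ltW.
have h2 : c * w - c * u <= c * `|w - u|.
  by rewrite -mulrBr ler_wpM2l ?(ltW c0) // ler_norm.
have h3 : 0 <= c * `|w - u| by rewrite mulr_ge0 ?normr_ge0 // ltW.
move: (c * r) (c * u) (c * w) (c * `|w - u|) h1 h2 h3 => r' u' w' a *.
by case: (leP r' 1); case: (leP w' 1) => *; lra.
Qed.

End ereal_inequalities.

Section ae_integrals.
Context d (T : measurableType d) (R : realType) (P : probability T R).

Lemma integral_ae_leD (f g h : T -> \bar R) :
  measurable_fun setT f -> measurable_fun setT g -> measurable_fun setT h ->
  (forall x, 0 <= f x)%E -> (forall x, 0 <= g x)%E -> (forall x, 0 <= h x)%E ->
  (\forall x \ae P, (f x <= g x + h x)%E) ->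
  (\int[P]_x f x <= \int[P]_x g x + \int[P]_x h x)%E.
Proof.
move=> mf mg mh f0 g0 h0 fgh.
rewrite -ge0_integralD //; apply: ae_ge0_le_integral => //.
- by move=> x _; rewrite adde_ge0.
- exact: emeasurable_funD.
- by apply: filterS fgh.
Qed.

End ae_integrals.

(** With a natural [d] at least [1/(p-1)] and a natural [A] above [K^p], the choice
    [M i = (A 2^i)^d] gives [M^(p-1) >= A 2^i]. Only natural parameters enter, so [M] is recursive
    whatever [p] and [K] are. *)
Lemma trunc_bound (R : realType) (K p : R) : 1 < p -> exists M : nat -> nat,
  [/\ rec M, forall i, (0 < M i)%N & forall i, (M i)%:R `^ (1 - p) * K `^ p <= 2 ^- i].
Proof.
move=> p1; pose d := (Num.truncn (p - 1)^-1).+1.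
have dp : d%:R^-1 <= p - 1.
  rewrite -[leRHS]invrK lef_pV2 ?posrE ?ltr0n ?invr_gt0 ?subr_gt0 //.
  exact: ltW (Num.Theory.truncnS_gt _).
pose A := (Num.truncn (K `^ p)).+1.
have hA : K `^ p <= A%:R by exact: ltW (Num.Theory.truncnS_gt _).
exists (fun i => ((A * 2 ^ i) ^ d)%N); split.
- by rauto.
- by move=> i; rewrite expn_gt0 muln_gt0 expn_gt0.
- move=> i; set M := ((A * 2 ^ i) ^ d)%N.
have b1 : 1 <= (A * 2 ^ i)%:R :> R by rewrite ler1n muln_gt0 expn_gt0.
have M1 : 1 <= M%:R :> R by rewrite ler1n expn_gt0 muln_gt0 expn_gt0.
have h : (A * 2 ^ i)%:R <= M%:R `^ (p - 1) :> R.
  apply: (@le_trans _ _ (M%:R `^ d%:R^-1)); last by apply: ler_powR.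
  rewrite /M natrX -powR_mulrn; last exact: le_trans ler01 b1.
  by rewrite -powRrM mulfV ?pnatr_eq0 // powRr1 // (le_trans ler01 b1).
rewrite -(opprB p 1) powRN mulrC ler_pdivrMr ?powR_gt0 ?(lt_le_trans ltr01) //.
apply: le_trans hA _; rewrite mulrC ler_pdivlMr ?exprn_gt0 //.
by apply: le_trans h; rewrite natrM natrX.
Qed.

Section ae_sums.
Context d (T : measurableType d) (R : realType) (P : probability T R).

Lemma fine_integral_aeD (f g h : T -> \bar R) :
  measurable_fun setT f -> measurable_fun setT g -> measurable_fun setT h ->
  (forall x, 0 <= f x)%E -> (forall x, 0 <= g x)%E -> (forall x, 0 <= h x)%E ->
  (\int[P]_x h x)%E \is a fin_num -> (\forall x \ae P, h x = (f x + g x)%E) ->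
  fine (\int[P]_x h x)%E = fine (\int[P]_x f x)%E + fine (\int[P]_x g x)%E.
Proof.
move=> mf mg mh f0 g0 h0 hfin fgh.
have E : (\int[P]_x h x = \int[P]_x f x + \int[P]_x g x)%E.
  rewrite -ge0_integralD //; apply: ge0_ae_eq_integral => //.
  - exact: emeasurable_funD.
  - by move=> x _; rewrite adde_ge0.
  - by apply: filterS fgh.
move: hfin; rewrite E fin_numD => /andP[h1 h2].
by rewrite fineD.
Qed.

Lemma integral_sub_le (h : T -> \bar R) (f : T -> R) (e : R) :
  measurable_fun setT h -> measurable_fun setT f -> (forall x, 0 <= f x) ->
  (forall x, (f x)%:E <= h x)%E -> (\int[P]_x h x < +oo)%E ->
  fine (\int[P]_x h x)%E - e < fine (\int[P]_x (f x)%:E)%E ->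
  (\int[P]_x (h x - (f x)%:E) <= e%:E)%E.
Proof.
move=> mh /measurable_EFinP mf f0 fh hoo.
have h0 x : (0 <= h x)%E by apply: le_trans (fh x); rewrite lee_fin.
have d0 x : (0 <= h x - (f x)%:E)%E by rewrite sube_ge0 ?fh.
have md : measurable_fun setT (fun x => h x - (f x)%:E)%E by exact: emeasurable_funB.
rewrite (@fine_integral_aeD (EFin \o f) (fun x => h x - (f x)%:E)%E h) //; last first.
- by apply: aeW => x; rewrite [RHS]addeC (@subeK R).
- by rewrite ge0_fin_numE ?integral_ge0.
have dfin : (\int[P]_x (h x - (f x)%:E))%E \is a fin_num.
  rewrite ge0_fin_numE ?integral_ge0 //; apply: le_lt_trans hoo.
  by apply: ge0_le_integral => // x _; rewrite leeBlDr // leeDl // lee_fin.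
by rewrite -[X in (X <= _)%E](fineK dfin) lee_fin; lra.
Qed.

End ae_sums.

Section simple_approximations.
Context {R : realType} {X : computablePolishType R} (nu : probability (Borel X) R).
Variable B : nat -> set X.
Hypothesis hnu : computable_measure nu.
Hypothesis hB : computable_basis nu B.
Variable k_ : nat -> X -> \bar R.
Hypothesis hk : ulsc k_.
Hypothesis k0 : forall s x, (0 <= k_ s x)%E.
Hypothesis ki : forall s, (\int[nu]_x k_ s x < +oo)%E.
Hypothesis kc : lcut (fun s => - fine (\int[nu]_x k_ s x)%E).

Let kfin s : (\int[nu]_x k_ s x)%E \is a fin_num.
Proof. by rewrite ge0_fin_numE ?integral_ge0. Qed.

(** [z] codes an index [s] and a precision [m]. The search for a stage of nearly full integral is
    effective because the integrals of stages and the negated integral of [k_ s] are left-c.e.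
    Stages are sought from [m] on, so that pointwise convergence survives the selection. *)
Lemma simple_below : exists u : nat -> seq (nat * aterm),
  [/\ rec (fun z => simple_num (u z)), forall z, simple_nneg (u z),
      forall z x, ((simple_real B (u z) x)%:E <= k_ z~l x)%E,
      ulsc (fun z => simple_fun B (u z)) /\
      (forall s x (q : R), 0 <= q -> (q%:E < k_ s x)%E ->
         exists M, forall m, (M <= m)%N -> q <= simple_real B (u (pr s m)) x) &
      forall z, fine (\int[nu]_x k_ z~l x)%E - 2 ^- z~r <
                fine (\int[nu]_x (simple_real B (u z) x)%:E)%E].
Proof.
have [S [hS S0 lS SB Sapp]] := simple_stages hB hk k0.
have mS s i : measurable_fun [set: Borel X] (simple_fun B (S s i) : Borel X -> \bar R).
  exact: (measurable_simple_fun hB).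
have S0' s i x : (0 <= simple_fun B (S s i) x :> \bar R)%E.
  by rewrite lee_fin; exact: simple_real_ge0.
have Sle s i : (\int[nu]_x simple_fun B (S s i) x <= \int[nu]_x k_ s x)%E.
  by apply: ge0_le_integral => //; exact: measurable_ulsc.
have Sfin s i : (\int[nu]_x simple_fun B (S s i) x)%E \is a fin_num.
  rewrite ge0_fin_numE ?integral_ge0 //; apply: le_lt_trans (Sle s i) _.
  by rewrite -ge0_fin_numE // integral_ge0.
pose yS s i : R := fine (\int[nu]_x simple_fun B (S s i) x)%E.
have cS : lcut (fun z => yS z~l z~r).
  by apply: (lcut_integral hnu lS) => // z; rewrite -ge0_fin_numE ?integral_ge0.
have cd : lcut (fun z => yS z~l z~r + - fine (\int[nu]_x k_ z~l x)%E).
  by apply: lcut_add cS _; apply: (lcut_comp kc); rauto.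
have [|z|i hi iP] := @ce_select (fun z i => (z~r <= i)%N /\ ratr (- 2 ^- z~r) <
    yS z~l i + - fine (\int[nu]_x k_ z~l x)%E).
- apply: ce_and; first by rauto.
  by apply: (@ce_lcut2 _ (fun s i => yS s i + - fine (\int[nu]_x k_ s x)%E)
    (fun z => - 2 ^- z~l~r) (fun z => z~l~l) (fun z => z~r) cd); rauto.
- have e0 := @exp2N_gt0 R z~r.
  have [|i zi hi] := @integral_below _ (Borel X) R nu (k_ z~l) _ (k0 _)
    (measurable_ulsc _ hk) (S0' z~l) (mS z~l) (Sapp z~l) z~r
    (fine (\int[nu]_x k_ z~l x) - 2 ^- z~r)%:E.
    by rewrite -[ltRHS](fineK (kfin _)) lte_fin ltrBlDr ltrDl.
  exists i; rewrite rmorphN /= ratr_exp2N ltrBrDr addrC; split=> //.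
  by rewrite -lte_fin fineK.
exists (fun z => S z~l (i z)); split=> //.
- by apply: (@rec_comp2 (fun s i => simple_num (S s i))); rauto.
- by move=> z x; exact: SB.
- split; first by apply: (@ulsc_comp2 _ _ (fun s i => simple_fun B (S s i)) _ _ lS); rauto.
  move=> s x q q0 /(Sapp s x q q0)[M hM]; exists M => m Mm.
  have [mi _] := iP (pr s m); rewrite !unprK /= in mi *.
  by rewrite -lee_fin; apply: hM; exact: leq_trans mi.
- move=> z; have [_] := iP z; rewrite rmorphN /= ratr_exp2N /yS.
  by rewrite ltrBrDr addrC.
Qed.

End simple_approximations.

(** * Powers with a computable exponent *)

Section powers.
Context {R : realType}.

Lemma powR_near (x y a : R) : 0 <= x -> 0 < a -> x `^ a < y ->
  exists2 e, 0 < e & forall t, 0 < t -> `|t - a| < e -> x `^ t < y.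
Proof.
rewrite le_eqVlt => /orP[/eqP <- a0|x0 a0].
  rewrite powR0 ?gt_eqF // => y0; exists 1 => // t t0 _.
  by rewrite powR0 ?gt_eqF.
move=> xy; have ct : {for a, continuous (fun t : R => expR (t * ln x))}.
  apply: continuous_comp; last exact: continuous_expR.
  exact: mulrr_continuous.
have powE t : x `^ t = expR (t * ln x) by rewrite /powR gt_eqF.
have : \forall t \near a, expR (t * ln x) < y.
  by apply: (cvgr_lt _ ct); rewrite -powE.
move=> /nbhs_ballP[e /= e0 he]; exists e => // t _ te.
by rewrite powE; apply: he; rewrite /ball /= distrC.
Qed.

Lemma powR_qpos_lt (x y : R) k : 0 <= x -> 0 <= y ->
  (x `^ ratr (qpos k) < y) = (x ^+ k~l.+1 < y ^+ k~r.+1).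
Proof.
move=> x0 y0; rewrite -[LHS](@ltr_pXn2r _ k~r.+1) ?nnegrE ?powR_ge0 //.
rewrite -[in LHS]powR_mulrn ?powR_ge0 // -powRrM /qpos ratr_div_nat divfK ?pnatr_eq0 //.
by rewrite powR_mulrn.
Qed.

Lemma powR_le_max (x a b c : R) : 0 <= x -> 0 < a -> a <= b -> b <= c ->
  x `^ b <= x `^ a \/ x `^ b <= x `^ c.
Proof.
move=> x0 a0 ab bc; have [x1|x1] := leP 1 x; first by right; apply: ler_powR.
move: x0; rewrite le_eqVlt => /orP[/eqP <-|x0].
  by left; rewrite !powR0 ?gt_eqF // (lt_le_trans a0).
by left; apply: ger_powR => //; rewrite x0 ltW.
Qed.

(** By continuity in the exponent the inequality persists at rational exponents on both sides of
    [a]; conversely [x^a] is at most the larger of two such powers, as powers are monotone in the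
    exponent, upwards or downwards. Rational exponents reduce to integer powers. *)
Lemma powR_lt_qpos (x y a : R) : 0 <= x -> 0 <= y -> 0 < a ->
  x `^ a < y <-> exists k, exists l, ratr (qpos k) < a /\ a < ratr (qpos l) /\
    x ^+ k~l.+1 < y ^+ k~r.+1 /\ x ^+ l~l.+1 < y ^+ l~r.+1.
Proof.
move=> x0 y0 a0; split=> [xy|[k [l [ka [al [hk hl]]]]]]; last first.
  have := @powR_le_max x (ratr (qpos k)) a (ratr (qpos l)) x0 _ (ltW ka) (ltW al).
  rewrite ltr0q qpos_gt0 => /(_ isT)[] /le_lt_trans; apply; rewrite powR_qpos_lt //.
have [e e0 he] := powR_near x0 a0 xy.
have [|q1] := @rat_in_itvoo R (Num.max (a - e) 0) a; first by rewrite gt_max; lra.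
rewrite in_itv /= gt_max => /andP[/andP[q1e q10] q1a].
have [|q2] := @rat_in_itvoo R a (a + e); first by lra.
rewrite in_itv /= => /andP[q2a q2e].
have [k kE] := @qpos_surj q1 ltac:(by rewrite -(ltr0q R)).
have [l lE] := @qpos_surj q2 ltac:(by rewrite -(ltr0q R); lra).
exists k, l; rewrite -!powR_qpos_lt // kE lE; split=> //; split=> //; split.
  by apply: he => //; rewrite ltr_norml; lra.
by apply: he; rewrite ?ltr_norml; lra.
Qed.

Lemma qrec_expn F e : qrec F -> (forall n, 0 <= F n) -> rec e -> qrec (fun n => F n ^+ e n).
Proof.
move=> [f hf fE] F0 he.
pose a n := ((f n)~l - (f n)~r~l)%N; pose c n := (f n)~r~r.+1.
have FE n : F n = (a n)%:R / (c n)%:R.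
  rewrite fE qnum_def /a /c; have := F0 n; rewrite fE qnum_def.
  rewrite pmulr_lge0 ?invr_gt0 ?ltr0n // subr_ge0 ler_nat => h.
  by rewrite natrB.
apply: qrec_ext (_ : qrec (fun n => (a n ^ e n)%:R * ((c n ^ e n).-1.+1)%:R^-1)).
  move=> n; rewrite FE expr_div_n prednK ?expn_gt0 ?natrX //.
by rewrite /a /c; rauto.
Qed.

Lemma ce_powR_lt (a : R) F G : 0 < a -> lcut (fun=> a) -> lcut (fun=> - a) ->
  qrec F -> qrec G -> (forall n, 0 <= F n) -> (forall n, 0 <= G n) ->
  ce (fun n => ratr (F n) `^ a < ratr (G n)).
Proof.
move=> a0 ha ha' hF hG F0 G0.
apply: (@ce_ext (fun n => exists k, exists l, ratr (qpos k) < a /\ ratr (- qpos l) < - a /\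
  F n ^+ k~l.+1 < G n ^+ k~r.+1 /\ F n ^+ l~l.+1 < G n ^+ l~r.+1)).
  move=> n; rewrite powR_lt_qpos ?ler0q //.
  have E (i j : nat) : (F n ^+ i < G n ^+ j) = (ratr (F n) ^+ i < ratr (G n) ^+ j :> R).
    by rewrite -(ltr_rat R) !rmorphXn.
  by split=> -[k [l [h1 [h2 h3]]]]; exists k, l; move: h1 h2 h3; rewrite !E rmorphN ltrN2.
have h1 : ce (fun k => ratr (qpos k) < a) by apply: (@ce_lcut _ (fun=> a) (fun k => qpos k) (fun k => k) ha); rauto.
have h2 : ce (fun k => ratr (- qpos k) < - a) by apply: (@ce_lcut _ (fun=> - a) (fun k => - qpos k) (fun k => k) ha'); rauto.
apply: ce_ex; apply: ce_ex; apply: ce_and; last apply: ce_and; last apply: ce_and.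
- exact: (ce_comp h1 (rec_snd (rec_fst rec_id))).
- exact: (ce_comp h2 (rec_snd rec_id)).
- by apply: ce_dec; apply: dec_qlt; apply: qrec_expn => //; rauto.
- by apply: ce_dec; apply: dec_qlt; apply: qrec_expn => //; rauto.
Qed.

Lemma lcut_inv (a : R) : 0 < a -> lcut (fun=> a) -> lcut (fun=> - a) ->
  lcut (fun=> a^-1) /\ lcut (fun=> - a^-1).
Proof.
move=> a0 ha ha'; split.
  apply: (@lcut_ce _ (fun _ k => exists l, ratr (- qpos l) < - a /\ qnum k * qpos l < 1)).
    apply: ce_ex; apply: ce_and; last by rauto.
    by apply: (@ce_lcut _ (fun=> - a) (fun z => - qpos z~r) (fun k => k) ha'); rauto.
  move=> _ k; split=> [[l [h1]]|h].
    rewrite -(ltr_rat R) ratrM rmorph1 => h2.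
    have l0 : 0 < ratr (qpos l) :> R by rewrite ltr0q qpos_gt0.
    move: h1; rewrite rmorphN ltrN2 => h1.
    rewrite -[ltRHS]mul1r ltr_pdivlMr //.
    have [k0|k0] := leP 0 (ratr (qnum k) : R); last by rewrite (lt_trans _ ltr01) // nmulr_rlt0.
    by apply: le_lt_trans h2; rewrite ler_wpM2l // ltW.
  have [q aq qk] : exists2 q : rat, a < ratr q & ratr (qnum k) * ratr q < 1 :> R.
    have [k0|k0] := leP (ratr (qnum k) : R) 0.
      have [|q] := @rat_in_itvoo R a (a + 1); first by lra.
      rewrite in_itv /= => /andP[q1 q2]; exists q => //.
      by apply: le_lt_trans ltr01; rewrite mulr_le0_ge0 //; lra.
    have [|q] := @rat_in_itvoo R a (ratr (qnum k))^-1.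
      by rewrite -[ltLHS]invrK ltf_pV2 ?posrE ?invr_gt0.
    rewrite in_itv /= => /andP[q1 q2]; exists q => //.
    by rewrite mulrC -ltr_pdivlMr // mul1r.
  have [l lE] := @qpos_surj q ltac:(by rewrite -(ltr0q R) (lt_trans a0)).
  exists l; rewrite lE rmorphN ltrN2; split=> //.
  by rewrite -(ltr_rat R) ratrM rmorph1.
apply: (@lcut_ce _ (fun _ k => exists l, ratr (qpos l) < a /\ 1 < - qnum k * qpos l)).
  apply: ce_ex; apply: ce_and; last by rauto.
  by apply: (@ce_lcut _ (fun=> a) (fun z => qpos z~r) (fun k => k) ha); rauto.
have key k : (ratr (qnum k) < - a^-1) = (1 < - ratr (qnum k) * a :> R).
  by rewrite ltrNr -[a^-1]mul1r ltr_pdivrMr.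
move=> _ k; rewrite key; split=> [[l [h1]]|h].
  rewrite -(ltr_rat R) ratrM rmorph1 rmorphN /= => h2.
  have l0 : 0 < ratr (qpos l) :> R by rewrite ltr0q qpos_gt0.
  apply: (lt_le_trans h2); apply: ler_wpM2l; last exact: ltW.
  have := lt_trans ltr01 h2; rewrite pmulr_lgt0 //; exact: ltW.
have k0 : 0 < - ratr (qnum k) :> R by have := lt_trans ltr01 h; rewrite pmulr_lgt0.
have [|q] := @rat_in_itvoo R (- ratr (qnum k))^-1 a.
  by rewrite -[ltLHS]mul1r ltr_pdivrMr // mulrC.
rewrite in_itv /= => /andP[q1 q2].
have [l lE] := @qpos_surj q ltac:(by rewrite -(ltr0q R) (lt_trans _ q1) // invr_gt0).
exists l; rewrite lE; split=> //.
rewrite -(ltr_rat R) ratrM rmorph1 rmorphN /= mulrC -ltr_pdivrMr // mul1r //.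
Qed.

Lemma powR_inv_lt (a x y : R) : 0 < a -> 0 <= x -> 0 <= y ->
  (x `^ a^-1 < y) = (x < y `^ a).
Proof.
move=> a0 x0 y0; have an0 : a != 0 by rewrite gt_eqF.
have xE : (x `^ a^-1) `^ a = x by rewrite -powRrM mulVf // powRr1.
have yE : (y `^ a) `^ a^-1 = y by rewrite -powRrM mulfV // powRr1.
apply/idP/idP => h.
  by rewrite -xE; apply: gt0_ltr_powR; rewrite ?nnegrE ?powR_ge0.
by rewrite -yE; apply: gt0_ltr_powR; rewrite ?invr_gt0 ?nnegrE ?powR_ge0.
Qed.

(* Both cuts of [y ^ a] only need comparisons [r ^ (1/a) < s] and [s ^ a < r]
   between rationals. *)
Lemma lcut_powR (a y : R) : 0 < a -> lcut (fun=> a) -> lcut (fun=> - a) -> 0 <= y ->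
  lcut (fun=> y) -> lcut (fun=> - y) ->
  lcut (fun=> y `^ a) /\ lcut (fun=> - y `^ a).
Proof.
move=> a0 ha ha' y0 hy hy'; have [hv hv'] := lcut_inv a0 ha ha'.
have v0 : 0 < a^-1 by rewrite invr_gt0.
pose pos q : rat := if 0 <= q then q else 0.
have pos0 q : 0 <= pos q by rewrite /pos; case: ifP.
have posE q : 0 <= q -> pos q = q by rewrite /pos => ->.
have hpos F : qrec F -> qrec (fun n => pos (F n)) by move=> hF; rewrite /pos; rauto.
split.
  apply: (@lcut_ce _ (fun _ k => qnum k < 0 \/ exists l, ratr (qnum l) < y /\
      ratr (pos (qnum k)) `^ a^-1 < ratr (pos (qnum l)))).
    apply: ce_or; first by rauto.
    apply: ce_ex; apply: ce_and.
      by apply: (@ce_lcut _ (fun=> y) (fun z => qnum z~r) (fun k => k) hy); rauto.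
    by apply: ce_powR_lt => //; apply: hpos; rauto.
  move=> _ k; have [k0|k0] := ltP (qnum k) 0.
    split=> [_|_]; last by left.
    by apply: (@lt_le_trans _ _ 0); rewrite ?ltrq0 ?powR_ge0.
  have k0' : 0 <= ratr (qnum k) :> R by rewrite ler0q.
  rewrite -powR_inv_lt //; split=> [[|[l [ly]]]|h]; first by [].
    rewrite (posE _ k0) /pos; case: ifP => l0; first by move=> /lt_trans; apply.
    by rewrite rmorph0 ltNge powR_ge0.
  have [l [l1 l2]] := qnum_dense h; right; exists l; split=> //.
  rewrite !posE // -(ler0q R); exact: le_trans (powR_ge0 _ _) (ltW l1).
apply: (@lcut_ce _ (fun _ k => exists l, ratr (- qnum l) < - y /\
    ratr (pos (qnum l)) `^ a < ratr (pos (- qnum k)))).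
  apply: ce_ex; apply: ce_and.
    by apply: (@ce_lcut _ (fun=> - y) (fun z => - qnum z~r) (fun k => k) hy'); rauto.
  by apply: ce_powR_lt => //; apply: hpos; rauto.
move=> _ k; split=> [[l []]|h].
  rewrite rmorphN ltrN2 => yl.
  have l0 : 0 <= qnum l by rewrite -(ler0q R); exact: le_trans y0 (ltW yl).
  rewrite (posE _ l0) /pos; case: ifP => k0 h; last first.
    by move: h; rewrite rmorph0 ltNge powR_ge0.
  rewrite ltrNr; move: h; rewrite rmorphN => h; apply: le_lt_trans h.
  by apply: ge0_ler_powR; rewrite ?nnegrE ?ler0q ?(ltW a0) // ltW.
have k0 : 0 < - ratr (qnum k) :> R by rewrite ltrNr in h; exact: le_lt_trans (powR_ge0 _ _) h.
have : y < (- ratr (qnum k)) `^ a^-1.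
  by rewrite -powR_inv_lt ?invrK // ?(ltW k0) // ltrNr.
move=> /qnum_dense[l [l1 l2]]; exists l; split; first by rewrite rmorphN ltrN2.
have l0 : 0 <= qnum l by rewrite -(ler0q R); exact: le_trans y0 (ltW l1).
rewrite (posE _ l0) posE; last by rewrite -(ler0q R) rmorphN ltW.
by rewrite rmorphN -[a in _ `^ a]invrK powR_inv_lt ?invr_gt0 ?ler0q ?(ltW k0).
Qed.

End powers.

(** * From [L_1] tests to [L_p] tests *)

Section power_tests.
Context {R : realType} {X : computablePolishType R} (nu : probability (Borel X) R) (p : R).
Hypothesis hnu : computable_measure nu.
Hypothesis p1 : 1 <= p.
Hypothesis hp : computable_real p.

Let p0 : 0 < p. Proof. exact: lt_le_trans ltr01 p1. Qed.

(** The norm is the [1/p]-th power of the integral of [t], computable by [lcut_powR]. Exceeding [q]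
    means that [t] exceeds [q^p], hence exceeds some rational above [q^p], a c.e. condition. *)
Lemma power_test (t : X -> \bar R) : (forall x, 0 <= t x)%E -> ulsc (fun=> t) ->
  (\int[nu]_x t x < +oo)%E -> lcut (fun _ : nat => - fine (\int[nu]_x t x)%E) ->
  schnorr_test nu p (fun x => t x `^ p^-1)%E.
Proof.
move=> t0 ht ti hc; have [ep hep] := hp.
have [cp cp'] := @lcut_of_real_index R (fun=> ep) (fun=> p) (rec_const ep) (fun=> hep).
have [cv cv'] := lcut_inv p0 cp cp'.
have v0 : 0 < p^-1 by rewrite invr_gt0.
have pw0 x : (0 <= t x `^ p^-1)%E by exact: poweR_ge0.
have hc' := lcut_integral hnu ht (fun _ => t0) (fun _ => ti).
have tfin : (\int[nu]_x t x)%E \is a fin_num by rewrite ge0_fin_numE ?integral_ge0.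
have y0 : 0 <= fine (\int[nu]_x t x)%E by rewrite fine_ge0 // integral_ge0.
have [c1 c2] := lcut_powR v0 cv cv' y0 (lcut_comp hc' (rec_const 0)) (lcut_comp hc (rec_const 0)).
have [d _ hd] := real_index_of_lcut c1 c2.
have hl : ulsc (fun=> (fun x => t x `^ p^-1)%E).
  pose pos q : rat := if 0 <= q then q else 0.
  have pos0 q : 0 <= pos q by rewrite /pos; case: ifP.
  have : uopen (fun z => if (qnum z~r < 0) then [set: X] else
      [set x | exists l, ratr (pos (qnum z~r)) `^ p < ratr (pos (qnum l)) :> R /\
        [set x | ((ratr (qnum l))%:E < t x)%E] x]).
    apply: uopen_guard2; first by rauto.
    apply: (@uopen_ex _ _ (fun _ l => [set x | ((ratr (qnum l))%:E < t x)%E])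
      (fun z l => ratr (pos (qnum z~r)) `^ p < ratr (pos (qnum l)))).
      by apply: (@ulsc_lt _ _ _ (fun z => qnum z~r) (fun=> 0) ht); rauto.
    by apply: ce_powR_lt => //; rewrite /pos; rauto.
  apply: uopen_iff => z x /=; case: ifP => h.
    by split=> // _; apply: lt_le_trans (pw0 x); rewrite lte_fin ltrq0.
  have q0 : 0 <= qnum z~r by rewrite leNgt h.
  have q0' : 0 <= ratr (qnum z~r) :> R by rewrite ler0q.
  have -> : pos (qnum z~r) = qnum z~r by rewrite /pos q0.
  have -> : ((ratr (qnum z~r))%:E < t x `^ p^-1)%E =
            ((ratr (qnum z~r) `^ p)%:E < t x)%E.
    case: (t x) (t0 x) => [r| |] //; last first.
      by rewrite poweRyr ?gt_eqF // !ltry.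
    by rewrite lee_fin => r0; rewrite poweR_EFin !lte_fin -[p in RHS]invrK powR_inv_lt.
  split=> [[l []]|/ereal_rat_below[l [h1 h2]]].
    rewrite /pos; case: ifP => l0; last by rewrite rmorph0 ltNge powR_ge0.
    by move=> h1; apply: lt_trans; rewrite lte_fin.
  exists l; rewrite /pos; case: ifP => // /negP[].
  by rewrite -(ler0q R); exact: le_trans (powR_ge0 _ _) (ltW h1).
have [e he] := index1_of_ulsc (fun x => ge0_neqNy (pw0 x)) hl.
exists (pr e (d 0)); split=> //; rewrite ?unpr1K ?unpr2K //.
exists (fine (\int[nu]_x t x)%E `^ p^-1) => //.
rewrite unlock -poweR_EFin fineK //; congr (_ `^ _)%E; apply: eq_integral => x _.
by rewrite gee0_abs // -poweRrM mulVf ?gt_eqF // poweRe1.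
Qed.

Lemma indic_test (U : set X) : ce_open U -> (exists e, ereal_index e (nu U)) ->
  schnorr_test nu p (fun y => (\1_U y)%:E).
Proof.
move=> [e eU] [d [r dU hr]].
have hU : uopen (fun=> U) by apply: (@uopen_of_index _ _ (fun=> e)); [exact: rec_const|].
have mU : measurable (U : set (Borel X)) by exact: (measurable_uopen 0 hU).
have intU : (\int[nu]_x (\1_U x)%:E = nu U)%E.
  by rewrite integral_indic // setIT.
have [_ c2] := @lcut_of_real_index R (fun=> d) (fun=> r) (rec_const d) (fun=> hr).
(* An indicator is its own [1/p]-th power, which reduces the claim to the case of an [L_1] test. *)
have -> : (fun y => (\1_U y)%:E) = (fun y => (\1_U y)%:E `^ p^-1)%E :> (X -> \bar R).
  apply/funext => y; rewrite indicE poweR_EFin; case: (y \in U); first by rewrite powR1.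
  by rewrite powR0 ?invr_eq0 ?gt_eqF.
apply: power_test.
- by move=> y; rewrite lee_fin.
- exact: ulsc_indic.
- by rewrite intU dU ltry.
- by apply: lcut_ext c2 => _; rewrite intU dU.
Qed.

End power_tests.

(** * Open sets of computable measure between level sets *)

Section level_sets.
Context {R : realType} {X : computablePolishType R} (nu : probability (Borel X) R).
Variables (B : nat -> set X).
Hypothesis hnu : computable_measure nu.
Hypothesis hB : computable_basis nu B.

Lemma cell_le (O : nat -> set X) N M v x : (N <= M)%N -> cell B O M v x -> cell B O N v x.
Proof. by move=> NM h i iN; apply: h; exact: leq_trans NM. Qed.

(** Provides one cell depth that decides the first [K] simple functions of a computable sequence
    simultaneously. *)
Lemma rec_bound (c : nat -> nat) : rec c ->
  exists2 N, rec N & forall K k, (k < K)%N -> (c k < N K)%N.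
Proof.
move=> hc; have [||N hN NP] := @ce_select (fun K N => forall k, (k < K)%N -> (c k < N)%N).
- by rauto.
- move=> K; exists (\max_(k < K) c k).+1 => k kK.
  by rewrite ltnS; exact: (leq_bigmax (Ordinal kK)).
by exists N.
Qed.

(* If the [v k] increase to [t] with [\int (t - v k) <= 4^-k], the measure of
   [U = \bigcup_k (v k > a + 1 - 2^-k)] is computable even though the one of a
   level set of [t] need not be: a point of [U] that is not caught by the first
   [k] stages satisfies [t - v k > 2^-(k+1)]. *)
Lemma level_between (t : X -> \bar R) (a : nat) : schnorr_test nu 1 t ->
  exists U : set X, [/\ ce_open U, exists e, ereal_index e (nu U),
    forall x, (a.+1%:R%:E < t x)%E -> U x & forall x, U x -> (a%:R%:E < t x)%E].
Proof.
move=> tt; have Lt := Lp_plus_test tt; have [mt t0 _] := Lt.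
have [ht tint tc] := schnorr_test1_integral tt.
have [u [hu u0 ut [lu upt] ku]] := simple_below hnu hB ht (fun _ => t0) (fun _ => tint) tc.
pose v k := u (pr 0 (2 * k)%N).
have hv : rec (fun k => simple_num (v k)).
  by apply: (@rec_comp (fun z => simple_num (u z))) => //; rauto.
have vt k x : ((simple_real B (v k) x)%:E <= t x)%E by exact: ut.
pose c k : rat := a%:R + 1 - 2 ^- k.
have hc : qrec c by rewrite /c; rauto.
have cE k : ratr (c k) = a.+1%:R - 2 ^- k :> R.
  by rewrite /c rmorphB rmorphD /= ratr_exp2N ratr_nat rmorph1 natr1.
pose V k := [set x | ratr (c k) < simple_real B (v k) x].
have hV : uopen V.
  have := @ulsc_lt _ _ _ c (fun k => pr 0 (2 * k)%N) lu hc ltac:(rauto).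
  by apply: uopen_iff => k x; rewrite /V /= lte_fin.
pose U := [set x | exists k, V k x].
have hU : uopen (fun=> U).
  apply: uopen_iff (@uopen_ex _ _ (fun _ k => V k) (fun _ _ => True) _ (ce_const True)) => [_ x|].
    by split=> [[k []]|[k]]; exists k.
  by apply: (uopen_comp hV); rauto.
pose UK K := [set x | exists2 k, (k < K)%N & V k x].
have mUK K : measurable (UK K : set (Borel X)).
  have -> : UK K = \bigcup_(k in `I_K) V k by apply/seteqP; split=> x [k]; exists k.
  by apply: bigcup_measurable => k _; exact: measurable_uopen hV.
have mU : measurable (U : set (Borel X)) by exact: (measurable_uopen 0 hU).
have [N hN NP] := rec_bound hv.
have [f hf fE] := simple_eval_qrec.
have [Q [hO BO hneg]] := basis_outer hB.
have cUK : lcut (fun K => - fine (nu (UK K))).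
  pose cv k := simple_num (v k); have {}hv : rec cv := hv.
  pose phi K w : rat := if bex K (fun k => c k < f w (cv k)) then 1 else 0.
  have [|||||||_] := @cuts_cells _ _ nu B hnu hB phi N (fun K x => \1_(UK K) x) (fun=> 1%N) Q hO hneg.
  - by rewrite /phi; rauto.
  - by [].
  - by rauto.
  - by move=> K; exact: measurable_indic.
  - by move=> K x.
  - by move=> K x; rewrite indicE; case: (_ \in _).
  - move=> K w x cx; rewrite indicE /phi.
    have -> : (x \in UK K) = bex K (fun k => c k < f w (cv k)).
      apply/idP/bexP => [|[k kK ck]]; rewrite inE.
        move=> [k kK Vk]; exists k => //; move: Vk.
        rewrite /V /= /simple_real (simple_fun_cell BO (cell_le (NP K k kK) cx)) /=.
        by rewrite ltr_rat /cv fE.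
      exists k => //; rewrite /V /= /simple_real (simple_fun_cell BO (cell_le (NP K k kK) cx)) /=.
      by rewrite ltr_rat -fE.
    by case: ifP; rewrite ?rmorph1 ?rmorph0.
  apply: lcut_ext => K; congr (- fine _).
  by rewrite integral_indic // setIT.
(* Markov's inequality: an integral of at most [4^-k] against the threshold [2^-(k+1)] leaves a set
   of measure at most [2 * 2^-k]. *)
have nuU_le k : fine (nu U) <= fine (nu (UK k.+1)) + 2 * 2 ^- k.
  pose D := [set x | ((2 ^- k.+1)%:E <= t x - (simple_real B (v k) x)%:E)%E].
  have mvk : measurable_fun [set: Borel X] (fun x : Borel X => (simple_real B (v k) x)%:E : \bar R).
    exact: (measurable_simple_fun hB).
  have md : measurable_fun [set: Borel X] (fun x : Borel X => t x - (simple_real B (v k) x)%:E : \bar R)%E.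
    exact: emeasurable_funB.
  have d0 x : (0 <= t x - (simple_real B (v k) x)%:E)%E by rewrite sube_ge0 ?vt.
  have intd : (\int[nu]_x (t x - (simple_real B (v k) x)%:E) <= (2 ^- (2 * k))%:E)%E.
    apply: (@integral_sub_le _ (Borel X) R nu) => //.
    - exact: (measurable_simple_real hB).
    - by move=> x; rewrite simple_real_ge0 ?u0.
    - by have := ku (pr 0 (2 * k)%N); rewrite unpr2K.
  have sub : U `<=` UK k.+1 `|` D.
    move=> x [i Vi]; have [ik|ki] := ltnP i k.+1; first by left; exists i.
    have [Vk|nVk] := pselect (V k x); first by left; exists k.
    right; rewrite /D /=.
    have h1 : ((ratr (c i))%:E < t x)%E by apply: lt_le_trans (vt i x); rewrite lte_fin.
    have h2 : simple_real B (v k) x <= ratr (c k) by rewrite leNgt; apply/negP.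
    move: h1 h2; rewrite !cE; case: (t x) (t0 x) => [r| |] //; last by move=> *; rewrite addye // leey.
    rewrite lte_fin -EFinB !lee_fin => _ h1 h2.
    have h3 : 2 ^- i <= 2 ^- k.+1 :> R.
      by rewrite lef_pV2 ?posrE ?exprn_gt0 // ler_eXn2l ?ltr1n.
    have h4 : 2 ^- k = 2 * 2 ^- k.+1 :> R by rewrite exprS invfM mulrA divff ?mul1r.
    move: (2 ^- k.+1) (2 ^- i) (2 ^- k) h3 h4 h1 h2 => x1 x2 x3; lra.
  have mD : measurable (D : set (Borel X)).
    have := md measurableT _ (emeasurable_itv `[(2 ^- k.+1)%:E, +oo[%E).
    by congr measurable; rewrite setTI; apply/seteqP; split=> x; rewrite /D /= in_itv /= andbT.
  have hD : (nu D <= (2 * 2 ^- k)%:E)%E.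
    have e0 := @exp2N_gt0 R k.+1.
    have := @le_integral_abse _ (Borel X) R nu _ measurableT _ _ md e0.
    have -> : [set: Borel X] `&` [set x | ((2 ^- k.+1)%:E <= `|t x - (simple_real B (v k) x)%:E|)%E] = D.
      by rewrite setTI; apply/seteqP; split=> x; rewrite /D /= gee0_abs.
    have -> : (\int[nu]_x `|t x - (simple_real B (v k) x)%:E| = \int[nu]_x (t x - (simple_real B (v k) x)%:E))%E.
      by apply: eq_integral => x _; rewrite gee0_abs.
    move=> /le_trans/(_ intd) h.
    have nD : nu D \is a fin_num by rewrite fin_num_measure.
    have {}h : ((2 ^- k.+1)%:E * nu D <= (2 ^- (2 * k))%:E)%E := h.
    move: h; rewrite -(fineK nD) -EFinM !lee_fin => h.
    have h4 : 2 ^- k.+1 = 2^-1 * 2 ^- k :> R by rewrite exprS invfM.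
    have h5 : 2 ^- (2 * k) = 2 ^- k * 2 ^- k :> R by rewrite mulnC exprM expr2 invfM.
    move: h; rewrite h4 h5 => h.
    have k0 := @exp2N_gt0 R k.
    rewrite -(ler_pM2l k0); move: h; rewrite -mulrA mulrCA; lra.
  have : (nu U <= nu (UK k.+1) + nu D)%E.
    apply: le_trans (_ : nu (UK k.+1 `|` D) <= _)%E; last exact: measureU2.
    by apply: le_measure; rewrite ?inE //; exact: measurableU.
  have fU A : measurable (A : set (Borel X)) -> nu A \is a fin_num by exact: fin_num_measure.
  rewrite -(fineK (fU _ mU)) -(fineK (fU _ (mUK k.+1))) => /le_trans h.
  by rewrite -lee_fin EFinD; apply: h; rewrite leeD2l.
have nuU_ge k : fine (nu (UK k)) <= fine (nu U).
  apply: fine_le; rewrite ?fin_num_measure //.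
  by apply: le_measure; rewrite ?inE // => x [i _ Vi]; exists i.
have cU : lcut (fun _ : nat => - fine (nu U)).
  apply: (@lcut_approx _ (fun _ k => - fine (nu (UK k.+1)) + ratr (- (2 * 2 ^- k)))).
  - apply: lcut_add; last by apply: (@lcut_qrec _ (fun z => - (2 * 2 ^- z~r))); rauto.
    by apply: (@lcut_comp _ _ (fun z => z~r.+1) cUK); rauto.
  - move=> _ k; rewrite rmorphN /= ratrM ratr_exp2N (ratr_nat R 2).
    by have := nuU_le k; lra.
  - move=> _ e e0; have [k hk] := @lt_exp2N R (e / 2) ltac:(lra); exists k.
    rewrite rmorphN /= ratrM ratr_exp2N (ratr_nat R 2).
    by have := nuU_ge k.+1; lra.
have [d _ hd] := real_index_of_lcut (lcut_nu hnu hU) cU.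
have [e _ he] := index_of_uopen hU.
exists U; split.
- by exists (e 0).
- by exists (d 0), (fine (nu U)) => //; rewrite fineK // fin_num_measure.
- move=> x /ereal_rat_below[k [h1 h2]].
  have k0 : 0 <= ratr (qnum k) :> R by apply: le_trans (ltW h1); rewrite ler0n.
  have [M hM] := upt 0 x _ k0 h2; exists M; rewrite /V /=.
  apply: lt_le_trans (hM (2 * M)%N _); last by rewrite leq_pmull.
  apply: lt_trans h1; rewrite cE ltrBlDr ltrDl invr_gt0 exprn_gt0 //.
- move=> x [k Vk]; apply: lt_le_trans (vt k x); rewrite lte_fin.
  apply: le_lt_trans Vk; rewrite cE -natr1 -addrA lerDl subr_ge0.
  by rewrite invf_le1 ?exprn_gt0 // exprn_ege1 // ler1n.
Qed.

End level_sets.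

Section finite_limits.
Context {R : realType}.
Implicit Types (u : nat -> \bar R) (l : \bar R).

Lemma finite_limP u l : finite_lim u l <-> l \is a fin_num /\
  forall e : R, 0 < e -> exists N, forall n, (N <= n)%N -> (`|u n - l| < e%:E)%E.
Proof.
split=> [[lfin]|[lfin h]].
  rewrite -(fineK lfin) => /fine_cvgP[ufin /cvgrPdist_lt hu]; split=> // e e0.
  have [N _ hN] := filterI ufin (hu e e0).
  exists N => n Nn; have [h1 h2] := hN n Nn.
  by rewrite -(fineK h1) -EFinB lte_fin distrC.
split=> //; rewrite -(fineK lfin); apply/fine_cvgP; split.
  have [N hN] := h 1 ltr01; exists N => // n Nn; have := hN n Nn.
  by rewrite -(fineK lfin); case: (u n).
apply/cvgrPdist_lt => e e0; have [N hN] := h e e0; exists N => // n Nn /=.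
have := hN n Nn; rewrite -{1}(fineK lfin); case: (u n) => [r| |] //=.
by rewrite lte_fin distrC.
Qed.

End finite_limits.

(** * Convergence on Schnorr random points *)

Section convergence_on_SR.
Context {R : realType} {X : computablePolishType R}.
Variables (nu : probability (Borel X) R) (B : nat -> set X).
Variables (F : nat -> set (set X)) (p : R) (E : nat -> (X -> \bar R) -> X -> \bar R).
Variables (XR : set X) (C : set (X -> \bar R)).
Hypothesis hnu : computable_measure nu.
Hypothesis hB : computable_basis nu B.
Hypothesis hF : filtration F.
Hypothesis p1 : 1 <= p.
Hypothesis hp : computable_real p.
Hypothesis hE : forall n f, Lp_plus nu p f ->
  (forall x, (0 <= E n f x)%E) /\ cond_exp_version nu (F n) f (E n f).
Hypothesis hXR : SR nu `<=` XR.
Hypothesis hlsc : exists h, forall n e f, Lp_plus nu p f -> lsc_index e f ->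
  yields h (pr n e) (fun j => lsc_index j (E n f)).
Hypothesis hmono : forall n f g, Lp_plus nu p f -> Lp_plus nu p g ->
  (forall x, XR x -> (f x <= g x)%E) -> forall x, XR x -> (E n f x <= E n g x)%E.
Hypothesis hscale : forall n f (c : R), Lp_plus nu p f -> 0 <= c ->
  forall x, XR x -> (c%:E * E n f x = E n (fun y => c%:E * f y) x)%E.
Hypothesis hadd : forall n f g, Lp_plus nu p f -> Lp_plus nu p g ->
  forall x, XR x -> (E n (fun y => f y + g y) x = E n f x + E n g x)%E.
Hypothesis hflat : exists h, forall s, simple_nneg s -> yields h (simple_num s)
  (fun j => Lp_point_index nu B p j (flat E (simple_fun B s))).
Hypothesis happ : approximated_from_below nu XR p C.
Hypothesis hlim : forall f, C f -> forall x, XR x -> finite_lim (fun n => E n f x) (f x).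

Lemma XR_ae (Q : X -> Prop) : (forall x, XR x -> Q x) -> \forall x \ae nu, Q x.
Proof.
move=> h; apply: negligibleS (SR_ae nu) => x /= nQ sx; exact/nQ/h/hXR.
Qed.

Lemma Lp_plus_le f g : Lp_plus nu p g ->
  measurable_fun [set: Borel X] (f : Borel X -> \bar R) ->
  (forall x, 0 <= f x)%E -> (forall x, XR x -> (f x <= g x)%E) -> Lp_plus nu p f.
Proof.
move=> [mg g0 gfin] mf f0 fg; split=> //.
apply: le_lt_trans (@Lnorm_ae_le _ (Borel X) R nu f g p p1 mf mg _) gfin.
by apply: XR_ae => x /fg; rewrite !gee0_abs.
Qed.

Lemma Lp_plus_fin f : Lp_plus nu p f -> (\int[nu]_x f x < +oo)%E.
Proof.
move=> [mf f0 ff].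
have [K [K0 hK]] : exists K : R, 0 < K /\ ('N[nu]_p%:E[f] <= K%:E)%E.
  have : ('N[nu]_p%:E[f])%E \is a fin_num by rewrite ge0_fin_numE ?Lnorm_ge0.
  move=> /fineK <-; exists (Num.max 1 (fine ('N[nu]_p%:E[f])%E)).
  by rewrite lt_max ltr01 lee_fin le_max lexx orbT.
apply: le_lt_trans (@integral_le_Lnorm _ (Borel X) R nu f p K mf f0 K0 p1 hK) _.
exact: ltry.
Qed.

Lemma E_ge0 n f x : Lp_plus nu p f -> (0 <= E n f x)%E.
Proof. by move=> hf; have [] := hE n hf. Qed.

Lemma flat_ge f n x : (E n f x <= flat E f x)%E.
Proof. by apply: ereal_sup_ubound; exists n. Qed.

Lemma flat_ge0 f x : Lp_plus nu p f -> (0 <= flat E f x)%E.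
Proof. by move=> hf; apply: le_trans (E_ge0 0 x hf) (flat_ge _ _ _). Qed.

Lemma measurable_flat f : Lp_plus nu p f ->
  measurable_fun [set: Borel X] (flat E f : Borel X -> \bar R).
Proof.
move=> hf; have [hF1 _] := hF.
apply: (@measurable_sup_version _ (Borel X) R F (fun n => E n f)) => n.
  by have [] := hF1 n.
by have [_ []] := hE n hf.
Qed.

Lemma integral_min_flat f (c e : R) : Lp_plus nu p f -> 0 < c -> 0 < e ->
  (\int[nu]_x mine (c%:E * flat E f x) 1%:E <= e%:E + (c / e)%:E * \int[nu]_x f x)%E.
Proof.
move=> hf; have [hF1 hF2] := hF; have [mf f0 _] := hf.
apply: (@integral_min_sup _ (Borel X) R nu F f (fun n => E n f)) => //.
- by move=> n; have [] := hF1 n.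
- by move=> n; have [] := hF1 n.
- by move=> n x; exact: E_ge0.
- by move=> n; have [_ []] := hE n hf.
- by move=> n; have [_ []] := hE n hf.
Qed.

Lemma flat_mono f g : Lp_plus nu p f -> Lp_plus nu p g ->
  (forall x, XR x -> (f x <= g x)%E) -> forall x, XR x -> (flat E f x <= flat E g x)%E.
Proof.
move=> hf hg fg x xX; apply: ge_ereal_sup => _ [n _ <-].
exact: le_trans (hmono n hf hg fg xX) (flat_ge _ _ _).
Qed.

Lemma flat_add f g : Lp_plus nu p f -> Lp_plus nu p g -> forall x, XR x ->
  (flat E (fun y => f y + g y)%E x <= flat E f x + flat E g x)%E.
Proof.
move=> hf hg x xX; apply: ge_ereal_sup => _ [n _ <-].
by rewrite hadd // leeD // flat_ge.
Qed.

(** The points of [L_p] given by the hypothesis on [flat] are turned into simple approximations in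
    [L_1]; the factor 2 is that of [integral_le_Lnorm]. *)
Lemma flat_simple_approx (u : nat -> seq (nat * aterm)) :
  rec (fun z => simple_num (u z)) -> (forall z, simple_nneg (u z)) ->
  (forall z, Lp_plus nu p (simple_fun B (u z))) ->
  exists w : nat -> nat -> seq (nat * aterm),
  [/\ rec (fun y => simple_num (w y~l y~r)),
      forall z m, simple_nneg (w z m) &
      forall z m, (\int[nu]_x `|(simple_real B (w z m) x)%:E - flat E (simple_fun B (u z)) x|
                   <= (2 * 2 ^- m)%:E)%E].
Proof.
move=> hu u0 Lu; have [h hh] := hflat.
have [z|J hJ JP] := @yields_select (fun=> h) (fun z => simple_num (u z))
  (fun z j => Lp_point_index nu B p j (flat E (simple_fun B (u z)))) (rec_const h) hu.
  exact: hh.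
have [y|K hK KP] := @yields_select (fun y => J y~l) (fun y => y~r)
  (fun y k => exists s, [/\ simple_num s = k, simple_nneg s &
    ('N[nu]_p%:E[(fun x => simple_fun B s x - flat E (simple_fun B (u y~l)) x)]
       <= (2 ^- y~r)%:E)%E]) ltac:(rauto) ltac:(rauto).
  by have [_] := JP y~l; apply.
have [w hw] := choice KP.
exists (fun z m => w (pr z m)); split.
- by apply: rec_ext hK => y; rewrite prK; case: (hw y).
- by move=> z m; case: (hw (pr z m)).
move=> z m; case: (hw (pr z m)); rewrite !unprK /= => _ _ hN.
set g := fun x => (_ - _)%E in hN.
have mg : measurable_fun [set: Borel X] (g : Borel X -> \bar R).
  apply: emeasurable_funB; last exact: measurable_flat.
  exact: (measurable_simple_fun hB).
apply: (@integral_le_Lnorm _ (Borel X) R nu (abse \o g) p (2 ^- m)) => //.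
- exact: (measurableT_comp (@abse_measurable R setT) mg).
- by move=> x; exact: abse_ge0.
- by rewrite Lnorm_abse.
Qed.

Section flat_integrals.
Variable k_ : nat -> X -> \bar R.
Hypothesis hk : ulsc k_.
Hypothesis k0 : forall s x, (0 <= k_ s x)%E.
Hypothesis Lk : forall s, Lp_plus nu p (k_ s).
Hypothesis kc : lcut (fun s => - fine (\int[nu]_x k_ s x)%E).

(** [flat] is only sublinear, so the integral is enclosed between two computable bounds:
    subadditivity with the maximal inequality gives the upper one, monotonicity the lower one. All
    pointwise relations hold on [XR], hence almost everywhere. *)
Lemma lcut_min_flat :
  lcut (fun s => - fine (\int[nu]_x mine ((2 ^+ s)%:E * flat E (k_ s) x) 1%:E)%E).
Proof.
have [u [hu u0 uk _ ku]] := simple_below hnu hB hk k0 (fun s => Lp_plus_fin (Lk s)) kc.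
have mu z : measurable_fun [set: Borel X] (simple_fun B (u z) : Borel X -> \bar R).
  exact: (measurable_simple_fun hB).
have u0' z x : (0 <= simple_fun B (u z) x :> \bar R)%E.
  by rewrite lee_fin; exact: simple_real_ge0.
have Lu z : Lp_plus nu p (simple_fun B (u z)).
  by apply: (Lp_plus_le (Lk z~l)) => // x _; exact: uk.
pose d z x := (k_ z~l x - (simple_real B (u z) x)%:E)%E.
have d0 z x : (0 <= d z x)%E by rewrite sube_ge0 ?uk.
have md z : measurable_fun [set: Borel X] (d z : Borel X -> \bar R).
  exact: (emeasurable_funB (measurable_ulsc z~l hk) (mu z)).
have Ld z : Lp_plus nu p (d z).
  apply: (Lp_plus_le (Lk z~l)) => // x _.
  by rewrite /d leeBlDr // leeDl // lee_fin simple_real_ge0.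
have kud z x : k_ z~l x = (simple_fun B (u z) x + d z x)%E.
  by rewrite /d addeC subeK.
have intd z : (\int[nu]_x d z x <= (2 ^- z~r)%:E)%E.
  apply: (@integral_sub_le _ (Borel X) R nu) => //.
  - exact: (measurable_ulsc _ hk).
  - exact: (measurable_simple_real hB).
  - by move=> x; exact: simple_real_ge0.
  - exact: (Lp_plus_fin (Lk z~l)).
have [w [hw w0 hwP]] := flat_simple_approx hu u0 Lu.
(* The remainder has integral at most [2^-(2l+s)]; the maximal inequality with [e = 2^-l] multiplies
   it by [2^(s+l)], leaving [2^-l]. Below, precision [l + s] makes up for the scaling by [2^s]. *)
pose z s l := pr s (2 * l + s)%N.
pose wr s l := simple_real B (w (z s l) (l + s)%N).
have cz : lcut (fun y => - fine (\int[nu]_x (Num.min (2 ^+ y~l * wr y~l y~r x) 1)%:E)%E).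
  have hc : rec (fun y => simple_num (w (z y~l y~r) (y~r + y~l)%N)).
    by apply: (@rec_comp2 (fun a b => simple_num (w a b))) => //; rewrite /z; rauto.
  have hq : qrec (fun y => (2 ^ y~l)%:R) by rauto.
  have [_] := cuts_simple hnu hB hc (fun n => w0 _ _) hq (fun n => ler0n _ _) (rec_const 1).
  apply: lcut_ext => y; congr (- fine _); apply: eq_integral => x _.
  by rewrite ratr_nat natrX.
have mfl f : Lp_plus nu p f -> measurable_fun [set: Borel X] (flat E f : Borel X -> \bar R).
  exact: measurable_flat.
pose c s : R := 2 ^+ s.
have c0 s : 0 < c s by rewrite exprn_gt0.
pose fm s f x := mine ((c s)%:E * flat E f x)%E 1%:E.
have fm0 s f x : Lp_plus nu p f -> (0 <= fm s f x)%E.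
  move=> Lf; rewrite le_min lee01 andbT; apply: mule_ge0; first by rewrite lee_fin ltW.
  exact: flat_ge0.
have mfm s f : Lp_plus nu p f -> measurable_fun [set: Borel X] (fm s f : Borel X -> \bar R).
  by move=> Lf; apply: measurable_mine_cst; apply: measurable_funeM; exact: mfl.
have fmfin s f : Lp_plus nu p f -> (\int[nu]_x fm s f x)%E \is a fin_num.
  move=> Lf; apply: (@integral_prob_fin _ (Borel X) R nu _ 1) => [|x|x].
  - exact: mfm.
  - exact: fm0.
  - by rewrite ge_min lexx orbT.
pose wm s l x : \bar R := (Num.min (c s * wr s l x) 1)%:E.
have wr0 s l x : 0 <= wr s l x by exact: simple_real_ge0.
have wm0 s l x : (0 <= wm s l x)%E by rewrite lee_fin le_min ler01 andbT mulr_ge0 // ltW.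
have mwm s l : measurable_fun [set: Borel X] (wm s l : Borel X -> \bar R).
  apply/measurable_EFinP; apply: measurable_minr => //; apply: measurable_funM => //.
  exact: (measurable_simple_real hB).
have wmfin s l : (\int[nu]_x wm s l x)%E \is a fin_num.
  apply: (@integral_prob_fin _ (Borel X) R nu _ 1) => [|x|x] //.
  by rewrite lee_fin ge_min lexx orbT.
pose a s l x : \bar R := ((c s)%:E * `|(wr s l x)%:E - flat E (simple_fun B (u (z s l))) x|)%E.
have a0 s l x : (0 <= a s l x)%E by rewrite mule_ge0 // lee_fin ltW.
have mabs s l : measurable_fun [set: Borel X] ((fun x =>
    `|(wr s l x)%:E - flat E (simple_fun B (u (z s l))) x|%E) : Borel X -> \bar R).
  apply: (measurableT_comp (@abse_measurable R setT)).
  apply: emeasurable_funB; last exact: mfl.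
  exact: (measurable_simple_fun hB).
have ma s l : measurable_fun [set: Borel X] (a s l : Borel X -> \bar R).
  exact: measurable_funeM.
have inta s l : (\int[nu]_x a s l x <= (2 * 2 ^- l)%:E)%E.
  rewrite (@ge0_integralZl_EFin _ (Borel X) R nu _ measurableT _ (fun x _ => abse_ge0 _) (mabs s l) _ (ltW (c0 s))).
  apply: (@le_trans _ _ ((c s)%:E * (2 * 2 ^- (l + s))%:E)%E).
    by apply: lee_wpmul2l; [rewrite lee_fin ltW|exact: hwP].
  rewrite -EFinM lee_fin exprD invfM -/(c s).
  have c1 : c s != 0 by rewrite gt_eqF.
  have c2 : 2 ^+ l != 0 :> R by rewrite gt_eqF // exprn_gt0.
  by rewrite le_eqVlt; apply/orP; left; apply/eqP; field; rewrite c1 c2.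
have intfd s l : (\int[nu]_x fm s (d (z s l)) x <= (2 * 2 ^- l)%:E)%E.
  have l0 := @exp2N_gt0 R l.
  apply: le_trans (integral_min_flat (Ld (z s l)) (c0 s) l0) _.
  rewrite mulr2n mulrDl mul1r EFinD leeD2l //.
  apply: (@le_trans _ _ ((c s / 2 ^- l)%:E * (2 ^- (2 * l + s))%:E)%E).
    apply: lee_wpmul2l; first by rewrite lee_fin divr_ge0 // ltW.
    by have := intd (z s l); rewrite /z unpr2K.
  rewrite -EFinM lee_fin invrK mul2n -addnn !exprD !invfM -/(c s).
  have c1 : c s != 0 by rewrite gt_eqF.
  have c2 : 2 ^+ l != 0 :> R by rewrite gt_eqF // exprn_gt0.
  by rewrite le_eqVlt; apply/orP; left; apply/eqP; field; rewrite c1 c2.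
have up s l : fine (\int[nu]_x fm s (k_ s) x)%E <= fine (\int[nu]_x wm s l x)%E + 4 * 2 ^- l.
  have h : (\int[nu]_x fm s (k_ s) x <= \int[nu]_x wm s l x +
      \int[nu]_x (a s l x + fm s (d (z s l)) x))%E.
    apply: (@integral_ae_leD _ (Borel X) R nu) => //.
    - exact: mfm.
    - apply: emeasurable_funD; first exact: ma.
      exact: mfm.
    - by move=> x; exact: fm0.
    - by move=> x; rewrite adde_ge0 ?fm0.
    - apply: XR_ae => x xX; apply: min_le_split => //.
      + exact: flat_ge0.
      + exact: flat_ge0.
      + exact: flat_ge0.
      + have := flat_add (Lu (z s l)) (Ld (z s l)) xX.
        have -> : (fun y => simple_fun B (u (z s l)) y + d (z s l) y)%E = k_ s.
          by apply/funext => y; rewrite -kud /z unpr1K.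
        by [].
  have h2 : (\int[nu]_x (a s l x + fm s (d (z s l)) x) <= (4 * 2 ^- l)%:E)%E.
    rewrite (@ge0_integralD _ (Borel X) R nu _ measurableT) //; last 2 first.
    - by move=> x _; exact: fm0.
    - exact: mfm.
    have -> : (4 * 2 ^- l)%:E = ((2 * 2 ^- l)%:E + (2 * 2 ^- l)%:E)%E :> \bar R.
      by rewrite -EFinD; congr EFin; move: (2 ^- l) => t; lra.
    exact: leeD.
  rewrite -lee_fin EFinD !fineK ?fmfin //.
  by apply: le_trans h _; rewrite leeD2l.
have lo s l : fine (\int[nu]_x wm s l x)%E <= fine (\int[nu]_x fm s (k_ s) x)%E + 2 * 2 ^- l.
  rewrite -lee_fin EFinD !fineK ?fmfin //.
  apply: (@le_trans _ _ (\int[nu]_x fm s (k_ s) x + \int[nu]_x a s l x)%E); last by rewrite leeD2l.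
  apply: (@integral_ae_leD _ (Borel X) R nu) => //.
  - exact: mfm.
  - by move=> x; exact: fm0.
  - apply: XR_ae => x xX; apply: min_le_split2 => //.
      exact: flat_ge0.
    apply: flat_mono => // y _.
    by have := uk (z s l) y; rewrite /z unpr1K.
apply: (@lcut_approx _ (fun s l => - fine (\int[nu]_x wm s l x)%E + ratr (- (4 * 2 ^- l)))).
- apply: lcut_add; first exact: cz.
  by apply: (@lcut_qrec _ (fun y => - (4 * 2 ^- y~r))); rauto.
- move=> s l; rewrite rmorphN /= ratrM ratr_exp2N (ratr_nat R 4).
  have := up s l; rewrite -/(fm s (k_ s)); lra.
(* Six is the sum of the 4 in the added error term and the 2 lost in [lo]. *)
- move=> s e e0; have [l hl] := @lt_exp2N R (e / 6) ltac:(lra).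
  exists l; rewrite rmorphN /= ratrM ratr_exp2N (ratr_nat R 4).
  have := lo s l; lra.
Qed.

End flat_integrals.

(** The remainder is defined everywhere as the positive part of [f - g_s] and equals [f - f_s] only
    on [XR], where [f_s] is finite because it is a finite limit. Its integral is the difference of
    those of [f] and [f_s], the former being a limit of the integrals of the [f_t] with error at
    most [2 * 2^-t]. *)
Lemma approx_data f : schnorr_test nu p f ->
  exists (f_ h_ : nat -> X -> \bar R) (j : nat -> nat),
  [/\ [/\ rec j, forall s, test_index nu p (j s) (f_ s) & forall s, C (f_ s)],
      ulsc h_ /\ forall s x, (0 <= h_ s x)%E,
      forall x, XR x -> f x = ereal_sup (range (f_ ^~ x)) /\
        forall s, f_ s x \is a fin_num /\ f x = (f_ s x + h_ s x)%E &
      (forall s, Lp_plus nu p (h_ s) /\ ('N[nu]_p%:E[h_ s] <= (2 ^- s)%:E)%E) /\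
      lcut (fun s => - fine (\int[nu]_x h_ s x)%E)].
Proof.
move=> hf; have Lf := Lp_plus_test hf; have [mf f0 ffin] := Lf.
have [h [h' hh]] := happ; have [e ef] := hf.
have [f_ [g_ [[d _ dP] Cf fup fN [[d' _ dP'] gP]]]] := hh e f ef.
have [s|j hj jP] := @yields_select (fun=> d) id (fun s j => test_index nu p j (f_ s)) (rec_const d) rec_id.
  exact: dP.
have [s|i hi iP] := @yields_select (fun=> d') id (fun s j => usc_index j (g_ s)) (rec_const d') rec_id.
  exact: dP'.
have hg : ulsc (fun s x => - g_ s x)%E.
  by apply: (@ulsc_of_index _ _ i) => // s; exact: iP.
have hf_ : ulsc f_.
  apply: (@ulsc_of_index _ _ (fun s => (j s)~l)); first by rauto.
  by move=> s; case: (jP s).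
have hfc : ulsc (fun=> f) by case: ef => _ /ulsc_of_index1.
have gy s x : g_ s x != +oo%E.
  by have [h1 _] := iP s; have := h1 x; rewrite eqe_oppLR.
pose h_ s x := maxe (f x - g_ s x)%E 0%E.
have hh_ : ulsc h_ by apply: ulsc_posdiff => // n x; exact: ge0_neqNy.
have h0 s x : (0 <= h_ s x)%E by rewrite le_max lexx orbT.
have f_le s x : XR x -> (f_ s x <= f x)%E.
  by move=> xX; have [_ ->] := fup x xX; apply: ereal_sup_ubound; exists s.
have f_fin s x : XR x -> f_ s x \is a fin_num.
  by move=> xX; have [] := hlim (Cf s) xX.
have h_E s x : XR x -> h_ s x = (f x - f_ s x)%E.
  move=> xX; rewrite /h_; have [_ ->] := gP s; last exact: xX.
  by rewrite max_l // sube_ge0 ?f_le // f_fin.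
have fE s x : XR x -> f x = (f_ s x + h_ s x)%E.
  by move=> xX; rewrite h_E // addeC subeK // f_fin.
have f_0 s x : (0 <= f_ s x)%E by case: (jP s).
have mf_ s := measurable_ulsc s hf_; have mh_ s := measurable_ulsc s hh_.
have Lf_ s : Lp_plus nu p (f_ s).
  by apply: (Lp_plus_le Lf) => // x; exact: f_le.
have Nh s : ('N[nu]_p%:E[h_ s] <= (2 ^- s)%:E)%E.
  apply: le_trans (fN s).
  apply: (@Lnorm_ae_le _ (Borel X) R nu) => //; first exact: emeasurable_funB.
  apply: XR_ae => x xX; rewrite h_E //.
  by rewrite -abseN fin_num_oppeB ?f_fin // addeC.
have Lh s : Lp_plus nu p (h_ s).
  by split=> //; apply: le_lt_trans (Nh s) _; rewrite ltry.
have fin g : Lp_plus nu p g -> (\int[nu]_x g x)%E \is a fin_num.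
  by move=> Lg; rewrite ge0_fin_numE ?(Lp_plus_fin Lg) // integral_ge0 => // x _; case: Lg.
pose y s : R := fine (\int[nu]_x f_ s x)%E.
have cy : lcut y by apply: (lcut_integral hnu hf_) => // s; exact: (Lp_plus_fin (Lf_ s)).
(* For [p = 1] the integral is the norm. For [p > 1] it is at most the integral of [min(f_s, M k)]
   plus [2^-k] by [trunc_bound], and the integral of [min(f_s, M k)] is [M k] minus that of the lsc
   function [max(M k - g_s, 0)]. *)
have cy' : lcut (fun s => - y s).
  move: p1; rewrite le_eqVlt => /orP[/eqP pE|p_gt1].
    have [||_] := @lcut_of_real_index R (fun s => (j s)~r) y; [by rauto| |by []].
    move=> s; have [_ _ [r rE hr]] := jP s.
    suff -> : y s = r by [].
    by rewrite /y -(Lnorm1_ge0 nu (f_0 s)) pE rE.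
  have [K [K0 hK]] : exists K : R, 0 <= K /\ ('N[nu]_p%:E[f] <= K%:E)%E.
    have : ('N[nu]_p%:E[f])%E \is a fin_num by rewrite ge0_fin_numE ?Lnorm_ge0.
    by move=> /fineK <-; exists (fine ('N[nu]_p%:E[f])%E); rewrite fine_ge0 ?Lnorm_ge0.
  have [M [hM M0 MP]] := trunc_bound K p_gt1.
  pose m z x := maxe ((M z~r)%:R%:E - g_ z~l x)%E 0%E : \bar R.
  have hm : ulsc m.
    apply: (@ulsc_posdiff _ _ (fun z _ => (M z~r)%:R%:E)) => //.
      apply: ulsc_ext (ulsc_qrec (_ : qrec (fun z => (M z~r)%:R))) => [z x|]; last by rauto.
      by rewrite ratr_nat.
    by apply: (ulsc_comp hg); rauto.
  have m0 z x : (0 <= m z x)%E by rewrite le_max lexx orbT.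
  have mm z x : (m z x <= (M z~r)%:R%:E)%E.
    rewrite ge_max lee_fin ler0n andbT.
    have [g0 _] := gP z~l.
    by rewrite leeBlDr ?leeDl //; case: (g_ _ x) (g0 x) (gy z~l x).
  have mfin z : (\int[nu]_x m z x)%E \is a fin_num.
    by apply: (@integral_prob_fin _ (Borel X) R nu _ (M z~r)%:R) => //; exact: measurable_ulsc.
  have cm : lcut (fun z => fine (\int[nu]_x m z x)%E).
    by apply: (lcut_integral hnu hm) => // z; rewrite -ge0_fin_numE ?integral_ge0.
  pose mn s k x := mine (f_ s x) (M k)%:R%:E.
  have mn0 s k x : (0 <= mn s k x)%E by rewrite le_min f_0 lee_fin ler0n.
  have mmn s k : measurable_fun [set: Borel X] (mn s k : Borel X -> \bar R).
    exact: measurable_mine_cst.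
  have mnfin s k : (\int[nu]_x mn s k x)%E \is a fin_num.
    apply: (@integral_prob_fin _ (Borel X) R nu _ (M k)%:R) => // x.
    by rewrite ge_min lexx orbT.
  have mnE s k : fine (\int[nu]_x mn s k x)%E = (M k)%:R - fine (\int[nu]_x m (pr s k) x)%E.
    have := @fine_integral_aeD _ (Borel X) R nu (mn s k) (m (pr s k)) (cst (M k)%:R%:E).
    have E0 : (\int[nu]_x cst (M k)%:R%:E x = (M k)%:R%:E)%E.
      exact: (@integral_prob_cst _ (Borel X) R nu).
    rewrite E0 /= => ->; rewrite ?addrK //.
    - exact: measurable_ulsc.
    - apply: XR_ae => x xX; rewrite /mn /m !unprK /=.
      have [_ ->] := gP s; last exact: xX.
      have := f_fin s x xX; case: (f_ s x) (f_0 s x) => [r| |] // r0 _.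
      have -> : mine r%:E (M k)%:R%:E = (Num.min r (M k)%:R)%:E by rewrite EFin_min.
      rewrite -EFinB.
      have -> : maxe ((M k)%:R - r)%:E 0%E = (Num.max ((M k)%:R - r) 0)%:E by rewrite EFin_max.
      rewrite -EFinD; congr EFin; case: (leP r); case: (leP ((M k)%:R - r)); lra.
  apply: (@lcut_approx _ (fun s k => (fine (\int[nu]_x m (pr s k) x)%E + ratr (- (M k)%:R)) + ratr (- 2 ^- k))).
  - apply: lcut_add; last by apply: (@lcut_qrec _ (fun z => - 2 ^- z~r)); rauto.
    apply: lcut_add; last by apply: (@lcut_qrec _ (fun z => - (M z~r)%:R)); rauto.
    by apply: lcut_ext cm => z; rewrite prK.
  - move=> s k; rewrite !rmorphN /= ratr_exp2N ratr_nat.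
    have hKs : ('N[nu]_p%:E[f_ s] <= K%:E)%E.
      apply: le_trans hK; apply: (@Lnorm_ae_le _ (Borel X) R nu) => //.
      by apply: XR_ae => x xX; rewrite !gee0_abs // f_le.
    have M0' : 0 < (M k)%:R :> R by rewrite ltr0n.
    have := @integral_trunc _ (Borel X) R nu (f_ s) p _ K (mf_ s) (f_0 s) M0' p1 hKs.
    rewrite -(fineK (fin _ (Lf_ s))) -/(mn s k) -(fineK (mnfin s k)) -EFinD lee_fin mnE.
    have := MP k; rewrite -/(y s); lra.
  - move=> s eps e0; have [k hk] := lt_exp2N e0; exists k.
    rewrite !rmorphN /= ratr_exp2N ratr_nat.
    have : fine (\int[nu]_x mn s k x)%E <= y s.
      apply: fine_le; [exact: mnfin|exact: fin|].
      apply: ge0_le_integral => //.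
      by move=> x _; rewrite ge_min lexx.
    rewrite mnE; lra.
pose yh s : R := fine (\int[nu]_x h_ s x)%E.
have yhE s : fine (\int[nu]_x f x)%E = y s + yh s.
  apply: (@fine_integral_aeD _ (Borel X) R nu) => //; first exact: fin.
  by apply: XR_ae => x xX; exact: fE.
have yh0 s : 0 <= yh s by rewrite fine_ge0 // integral_ge0.
have yhb s : yh s <= 2 * 2 ^- s.
  have e0 := @exp2N_gt0 R s.
  have := @integral_le_Lnorm _ (Borel X) R nu (h_ s) p _ (mh_ s) (h0 s) e0 p1 (Nh s).
  by rewrite -(fineK (fin _ (Lh s))) lee_fin.
have cyh : lcut (fun s => - yh s).
  apply: (@lcut_approx _ (fun s t => y s + - y t + ratr (- (2 * 2 ^- t)))).
  - apply: lcut_add; last by apply: (@lcut_qrec _ (fun z => - (2 * 2 ^- z~r))); rauto.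
    by apply: lcut_add; [apply: (lcut_comp cy)|apply: (lcut_comp cy')]; rauto.
  - move=> s t; rewrite rmorphN /= ratrM ratr_exp2N (ratr_nat R 2).
    have := yhE s; have := yhE t; have := yhb t; lra.
  - move=> s eps e0; have [t ht] := @lt_exp2N R (eps / 2) ltac:(lra); exists t.
    rewrite rmorphN /= ratrM ratr_exp2N (ratr_nat R 2).
    have := yhE s; have := yhE t; have := yh0 t; lra.
exists f_, h_, j; split=> //.
move=> x xX; split; first by have [] := fup x xX.
by move=> s; split; [exact: f_fin|exact: fE].
Qed.


Lemma ulsc_flat (h_ : nat -> X -> \bar R) : ulsc h_ -> (forall s, Lp_plus nu p (h_ s)) ->
  ulsc (fun s => flat E (h_ s)).
Proof.
move=> hh Lh; have [h hI] := hlsc.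
have h0 s x : h_ s x != -oo%E by apply: ge0_neqNy; case: (Lh s).
have [e he eP] := index_of_ulsc h0 hh.
have [z|j hj jP] := @yields_select (fun=> h) (fun z => pr z~r (e z~l))
  (fun z j => lsc_index j (E z~r (h_ z~l))) (rec_const h) ltac:(rauto).
  by apply: hI.
by apply: (@ulsc_sup _ _ (fun s n => E n (h_ s))); exact: ulsc_of_index hj jP.
Qed.

Lemma flat_small (h_ : nat -> X -> \bar R) x :
  ulsc h_ -> (forall s, Lp_plus nu p (h_ s) /\ ('N[nu]_p%:E[h_ s] <= (2 ^- s)%:E)%E) ->
  lcut (fun s => - fine (\int[nu]_x h_ s x)%E) -> SR nu x ->
  exists N, forall s, (N <= s)%N -> (flat E (h_ (4 * s)%N) x < (2 ^- s)%:E)%E.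
Proof.
move=> hh Lh hc SRx; pose k_ s := h_ (4 * s)%N.
have h4 : rec (fun s => (4 * s)%N) by rauto.
have hk : ulsc k_ := ulsc_comp hh h4.
have Lk s : Lp_plus nu p (k_ s) by case: (Lh (4 * s)%N).
have kc : lcut (fun s => - fine (\int[nu]_x k_ s x)%E).
  exact: (lcut_comp hc h4).
have k0 s y : (0 <= k_ s y)%E by case: (Lk s).
pose t s y := mine ((2 ^+ s)%:E * flat E (k_ s) y)%E 1%:E : \bar R.
have c0 s : 0 < 2 ^+ s :> R by rewrite exprn_gt0.
have ht : ulsc t.
  have := @ulsc_min R X (fun s y => (ratr (2 ^ s)%:R)%:E * flat E (k_ s) y)%E (fun=> 1).
  move=> H; apply: ulsc_ext (H _ _) => [s y||]; last 2 first.
  - exact: qrec_const.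
  - apply: (@ulsc_scale _ _ (fun s => flat E (k_ s)) (fun s => (2 ^ s)%:R)); first by rauto.
      by move=> s; rewrite ltr0n expn_gt0.
    exact: ulsc_flat.
  by rewrite ratr_nat natrX rmorph1.
have t0 s y : (0 <= t s y)%E.
  rewrite le_min lee01 andbT; apply: mule_ge0; first by rewrite lee_fin ltW.
  exact: flat_ge0.
(* With [c = 2^s] and [e = 2^-s] the factor [c / e] is [4^s], while the integral of [h_(4s)] is at
   most [2 * 16^-s]: in total [2^-s + 2 * 4^-s], at most [3 * 2^-s]. *)
have tb s : (\int[nu]_x t s x <= (3 * 2 ^- s)%:E)%E.
  have e0 := @exp2N_gt0 R s.
  apply: le_trans (integral_min_flat (Lk s) (c0 s) e0) _.
  have e1 := @exp2N_gt0 R (4 * s).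
  have [mk _ _] := Lk s; have [_ Nk] := Lh (4 * s)%N.
  have h := @integral_le_Lnorm _ (Borel X) R nu (k_ s) p _ mk (k0 s) e1 p1 Nk.
  apply: (@le_trans _ _ ((2 ^- s)%:E + (2 ^+ s / 2 ^- s)%:E * (2 * 2 ^- (4 * s))%:E)%E).
    by rewrite leeD2l //; apply: lee_wpmul2l => //; rewrite lee_fin divr_ge0 // ltW.
  rewrite -EFinM -EFinD lee_fin.
  have -> : 2 ^+ s / 2 ^- s * (2 * 2 ^- (4 * s)) = 2 * (2 ^- s * 2 ^- s) :> R.
    rewrite mulnC exprM invrK; move: (2 ^+ s) (c0 s) => u u0.
    by field; rewrite gt_eqF.
  have : 2 ^- s <= 1 :> R by rewrite invf_le1 // exprn_ege1 // ler1n.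
  by move: (2 ^- s) e0 => u u0 u1; nra.
have tc := lcut_min_flat hk k0 Lk kc.
have [N hN] := psums_finite (fun s => t0 s x) (SRx _ (psums_test hnu ht t0 tb tc)).
exists N => s /hN; rewrite /t gt_min [X in _ || X]ltxx orbF => h.
have := flat_ge0 x (Lk s) => f0; move: h f0; rewrite -/(k_ s).
case: (flat E (k_ s) x) => [r| |] //; last by rewrite gt0_muley ?lte_fin.
by rewrite -EFinM !lte_fin => h _; rewrite -[ltRHS]mul1r ltr_pdivlMr // mulrC.
Qed.

(** The common core of convergence and rates: both [E n h_s] and [h_s] lie between 0 and the maximal
    function of [h_s], so passing from [f_s] to [f] costs at most the value of that maximal function
    at [x]. *)
Lemma SR_decomposition f x : schnorr_test nu p f -> SR nu x ->
  exists (f_ h_ : nat -> X -> \bar R) (j : nat -> nat) (N : nat),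
  [/\ rec j, forall s, test_index nu p (j s) (f_ s) /\ C (f_ s),
      f x \is a fin_num &
      forall s, (N <= s)%N -> forall n (e : R), (`|E n (f_ s) x - f_ s x| < e%:E)%E ->
        (`|E n f x - f x| < (e + 2 ^- s)%:E)%E].
Proof.
move=> hf SRx; have xX := hXR SRx.
have [f_ [h_ [j [[hj jP Cf] [hh h0] hfX [Lh hc]]]]] := approx_data hf.
have [N hN] := flat_small hh Lh hc SRx.
have [fsup fx] := hfX x xX.
have Lf := Lp_plus_test hf.
have Lf_ s : Lp_plus nu p (f_ s) by apply: Lp_plus_test; exists (j s).
have Lhs s : Lp_plus nu p (h_ s) by case: (Lh s).
have f_0 s y : (0 <= f_ s y)%E by case: (Lf_ s).
have Lsum s : Lp_plus nu p (fun y => f_ s y + h_ s y)%E.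
  apply: (Lp_plus_le Lf) => [|y|y yX].
  - by apply: emeasurable_funD; [case: (Lf_ s)|case: (Lhs s)].
  - by rewrite adde_ge0.
  - by have [_ /(_ s)[_ ->]] := hfX y yX.
(* [f] and [f_s + h_s] agree only on [XR], whereas [E] takes pointwise functions; monotonicity on
   [XR], used in both directions, bridges the difference. *)
have EfE n s : E n f x = (E n (f_ s) x + E n (h_ s) x)%E.
  rewrite -hadd //; apply/le_anti/andP; split; apply: hmono => // y yX;
  by have [_ /(_ s)[_ ->]] := hfX y yX.
have flat_h0 s : (0 <= flat E (h_ s) x)%E by apply: flat_ge0.
have f_fin s : f_ s x \is a fin_num by case: (fx s).
have f_up s : (f x <= f_ s x + flat E (h_ s) x)%E.
  rewrite fsup; apply: ge_ereal_sup => _ [t _ <-].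
  have [lim_fin lim_t] := hlim (Cf t) xX; have [_ lim_s] := hlim (Cf s) xX.
  have [fhoo|] := eqVneq (flat E (h_ s) x) +oo%E.
    by rewrite fhoo addey ?leey // ge0_neqNy.
  move=> fhoo; have fhfin : flat E (h_ s) x \is a fin_num by rewrite ge0_fin_numE ?ltey.
  have lim2 : (fun n => E n (f_ s) x + flat E (h_ s) x)%E @ \oo --> (f_ s x + flat E (h_ s) x)%E.
    by apply: cvgeD => //; [rewrite fin_num_adde_defl|exact: cvg_cst].
  apply: (lee_cvg_to lim_t lim2); apply: nearW => n.
  apply: le_trans (_ : E n f x <= _)%E.
    apply: hmono => // y yX; have [-> _] := hfX y yX.
    by apply: ereal_sup_ubound; exists t.
  by rewrite (EfE n s) leeD2l // flat_ge.
have h_up s : (h_ s x <= flat E (h_ s) x)%E.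
  by have := f_up s; rewrite (fx s).2 leeD2lE.
exists (fun s => f_ (4 * s)%N), (fun s => h_ (4 * s)%N), (fun s => j (4 * s)%N), N; split.
- by rauto.
- by move=> s; split; [exact: jP|exact: Cf].
- rewrite (fx (4 * N)%N).2 fin_numD f_fin /= ge0_fin_numE //.
  apply: le_lt_trans (h_up _) _; apply: lt_trans (hN N (leqnn N)) _.
  exact: ltry.
move=> s Ns n e; rewrite (EfE n (4 * s)%N) (fx (4 * s)%N).2.
have := hN s Ns; have := flat_ge (h_ (4 * s)%N) n x; have := h_up (4 * s)%N.
have := h0 (4 * s)%N x; have := E_ge0 n x (Lhs (4 * s)%N); have := f_fin (4 * s)%N.
case: (f_ (4 * s)%N x) => [a| |] // _.
case: (flat E (h_ (4 * s)%N) x) => [b| |] //; last first.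
  by move=> h1 _ _ h2; have := le_trans h1 h2.
case: (E n (h_ (4 * s)%N) x) => [c| |] //; case: (h_ (4 * s)%N x) => [d| |] //.
case: (E n (f_ (4 * s)%N) x) => [g| |] //.
rewrite -?EFinD -?EFinB /= !lee_fin !lte_fin => c0 d0 db cb b1.
rewrite !ltr_norml => /andP[g1 g2]; apply/andP; split; lra.
Qed.

Lemma convergence_SR f x : schnorr_test nu p f -> SR nu x ->
  finite_lim (fun n => E n f x) (f x).
Proof.
move=> hf SRx; have [f_ [h_ [j [N [_ jC fin H]]]]] := SR_decomposition hf SRx.
apply/finite_limP; split=> // e e0.
have [M hM] := @lt_exp2N R (e / 2) ltac:(lra).
pose s := maxn N M; have [_ Cs] := jC s.
have /finite_limP[_ /(_ (e / 2) ltac:(lra))[K hK]] := hlim Cs (hXR SRx).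
exists K => n /hK /(H s (leq_maxl _ _)) /lt_le_trans; apply; rewrite lee_fin.
have : 2 ^- s <= 2 ^- M :> R.
  by rewrite lef_pV2 ?posrE ?exprn_gt0 // ler_eXn2l ?ltr1n // leq_maxr.
lra.
Qed.


Lemma SR_of_limits x : XR x ->
  (forall f, schnorr_test nu p f -> exists l, finite_lim (fun n => E n f x) l) ->
  (forall U : set X, ce_open U -> (exists e, ereal_index e (nu U)) ->
    finite_lim (fun n => E n (fun y => (\1_U y)%:E) x) (\1_U x)%:E) -> SR nu x.
Proof.
move=> xX hf hU t tt; rewrite ltey; apply/eqP => tx.
have Lt := Lp_plus_test tt; have [mt t0 _] := Lt.
have [ht tfin tc] := schnorr_test1_integral tt.
have ft := power_test hnu p1 hp t0 ht tfin tc.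
have p0 : 0 < p by exact: lt_le_trans ltr01 p1.
have [l [lfin lim]] := hf _ ft; rewrite -(fineK lfin) in lim.
(* With this [a], the root [a^(1/p)] is at least [|l| + 1], while comparing limits will give
   [a^(1/p) <= l]. *)
have [a ha] : exists a : nat, (`|fine l| + 1) `^ p < a%:R.
  by exists (Num.bound ((`|fine l| + 1) `^ p)); exact: archi_boundP (powR_ge0 _ _).
have [U [eU cU tU Ut]] := level_between hnu hB a tt.
have Ux : U x by apply: tU; rewrite tx ltry.
have [_ limU] := hU U eU cU; rewrite indicE mem_set //= in limU.
have c0 : 0 <= a%:R `^ p^-1 :> R by exact: powR_ge0.
have LU := Lp_plus_test (indic_test hnu p1 hp eU cU).
have Lf := Lp_plus_test ft.
have le_f y : ((a%:R `^ p^-1)%:E * (\1_U y)%:E <= t y `^ p^-1)%E.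
  rewrite indicE; case: (boolP (y \in U)) => [|_]; last by rewrite mule0 poweR_ge0.
  rewrite inE mule1 => /Ut; case: (t y) => [r| |] //; last first.
    by rewrite poweRyr ?leey // invr_eq0 gt_eqF.
  by rewrite lte_fin poweR_EFin lee_fin => ar; rewrite ge0_ler_powR ?nnegrE ?invr_ge0 ?ler0n ?ltW //;
     exact: le_lt_trans ar.
have LcU : Lp_plus nu p (fun y => (a%:R `^ p^-1)%:E * (\1_U y)%:E)%E.
  apply: (Lp_plus_le Lf) => [|y|y _]; last exact: le_f.
    by apply: measurable_funeM; case: LU.
  by rewrite mule_ge0 // lee_fin.
have limcU : (fun n => (a%:R `^ p^-1)%:E * E n (fun y => (\1_U y)%:E) x)%E @ \oo -->
    ((a%:R `^ p^-1)%:E * 1%:E)%E by exact: cvgeZl.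
have := lee_cvg_to limcU lim; rewrite mule1 lee_fin => h.
have : a%:R `^ p^-1 <= fine l.
  by apply: h; apply: nearW => n; rewrite hscale //; apply: hmono.
have : `|fine l| + 1 <= a%:R `^ p^-1.
  by rewrite leNgt powR_inv_lt ?ler0n ?addr_ge0 // -leNgt ltW.
by have := ler_norm (fine l); lra.
Qed.

Lemma SR_iff_lim x : SR nu x <-> XR x /\ forall f, schnorr_test nu p f ->
  finite_lim (fun n => E n f x) (f x).
Proof.
split=> [SRx|[xX h]]; first by split=> [|f hf]; [exact: hXR|exact: convergence_SR].
apply: SR_of_limits => // [f hf|U eU cU]; first by exists (f x); exact: h.
by apply: (h (fun y => (\1_U y)%:E)); exact: indic_test.
Qed.

Lemma SR_iff_lim_indic x : SR nu x <-> [/\ XR x,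
  forall f, schnorr_test nu p f -> exists l, finite_lim (fun n => E n f x) l &
  forall U : set X, ce_open U -> (exists e, ereal_index e (nu U)) ->
    finite_lim (fun n => E n (fun y => (\1_U y)%:E) x) (\1_U x)%:E].
Proof.
split=> [SRx|[xX hf hU]]; last exact: SR_of_limits.
split=> [|f hf|U eU cU]; first exact: hXR.
  by exists (f x); exact: convergence_SR.
by apply: (@convergence_SR (fun y => (\1_U y)%:E)) => //; exact: indic_test.
Qed.

(** * Borel sets on the random points *)

Let F_oo := \bigcup_n F n.
Let tail_equal (A : set X) := exists2 A' : set X, <<s F_oo >> A' & A `&` SR nu = A' `&` SR nu.

Let near_fin (y : \bar R) (l e : R) : (`|y - l%:E| < e%:E)%E ->
  ((l - e)%:E < y)%E /\ (y < (l + e)%:E)%E.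
Proof.
by case: y => [r| |] //; rewrite -EFinB !lte_fin ltr_distl => /andP[].
Qed.

(** On [SR] the values [E[1_U|n]] tend to 0 or 1, so membership in [U] means that they eventually
    exceed 1/2, an event in the generated sigma-algebra. *)
Lemma tail_equal_indic (U : set X) : ce_open U -> (exists e, ereal_index e (nu U)) ->
  tail_equal U.
Proof.
move=> eU cU; have tU := indic_test hnu p1 hp eU cU.
pose V n := E n (fun y => (\1_U y)%:E) @^-1` `]2^-1%:E, +oo[.
have mV n : measurable (V n : set (g_sigma_algebraType F_oo)).
  by apply: sub_gen_smallest; exists n => //; have [_ [h _]] := hE n (Lp_plus_test tU);
     apply: h; exact: emeasurable_itv.
exists (\bigcup_N \bigcap_(n in [set n | (N <= n)%N]) V n).
  apply: (@bigcup_measurable _ (g_sigma_algebraType F_oo)) => N _.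
  by apply: bigcap_measurable => //; exists N => /=.
apply/seteqP; split=> x [h SRx]; split=> //;
  have /finite_limP[_ lim] := @convergence_SR (fun y => (\1_U y)%:E) x tU SRx;
  have [N hN] := lim 2^-1 ltac:(by rewrite invr_gt0).
  exists N => // n /= /hN; rewrite indicE mem_set //= /V /= in_itv /= andbT.
  by move=> /near_fin[+ _]; congr (_ < _)%E; congr EFin; lra.
case: h => M _ hM; have := hM (maxn M N) (leq_maxl _ _); have := hN _ (leq_maxr M N).
rewrite /V /= in_itv /= andbT indicE; case: (boolP (x \in U)); rewrite ?inE // => _.
by move=> /near_fin[_]; rewrite add0r => h /(lt_trans h); rewrite ltxx.
Qed.

Lemma tail_equal_sigma : sigma_algebra [set: X] tail_equal.
Proof.
have mT (A : set X) : <<s F_oo >> A <-> measurable (A : set (g_sigma_algebraType F_oo)) by [].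
split.
- by exists set0 => //; apply/mT.
- move=> A [A' /mT mA' AE]; exists (~` A'); first by apply/mT; exact: measurableC.
  have iff x : SR nu x -> A x <-> A' x.
    move=> SRx; have e : (A x /\ SR nu x) = (A' x /\ SR nu x) := congr1 (@^~ x) AE.
    by split=> h; [have := conj h SRx; rewrite e|have := conj h SRx; rewrite -e]; case.
  by rewrite setTD; apply/seteqP; split=> x [nA SRx]; split=> // /(iff x SRx).
- move=> A_ hA; have /choice[A' hA'] : forall n, exists A' : set X, <<s F_oo >> A' /\
      A_ n `&` SR nu = A' `&` SR nu by move=> n; have [A'] := hA n; exists A'.
  exists (\bigcup_n A' n).
    by apply/mT; apply: bigcupT_measurable => n; apply/mT; case: (hA' n).
  by rewrite !setI_bigcupl; apply: eq_bigcupr => n _; case: (hA' n).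
Qed.

(** Only basic sets require effectivity, namely a computable measure. From them, countable unions
    give the balls and then, over an arbitrary index set, all open sets; these generate the Borel
    sets. *)
Lemma tail_equal_borel (A : set (Borel X)) : measurable A -> tail_equal A.
Proof.
have cup (D : set nat) (A_ : nat -> set X) : (forall n, tail_equal (A_ n)) ->
    tail_equal (\bigcup_(n in D) A_ n).
  move=> h; have [h0 _ hU] := tail_equal_sigma; rewrite bigcup_mkcond.
  by apply: hU => n; case: ifP.
have tB n : tail_equal (B n).
  (* The one-element list [[:: n]] specializes the computability of measures of finite unions to
     [B n]. *)
  have [[h0 hh0] _ [h1 hh1] _] := hB.
  have [e _ he] := hh0 n; have [d _ hd] := hh1 [:: n].
  apply: tail_equal_indic; first by exists e.
  exists d; move: hd; congr (ereal_index d (nu _)).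
  by apply/seteqP; split=> [x [i]|x Bx]; [rewrite /= inE => /eqP ->|exists n; rewrite //= inE].
apply: smallest_sub; first exact: tail_equal_sigma.
move=> O /open_cballs[D ->]; apply: (cup) => b.
have [W _ hW] := basis_cover hB (@uopen_cball R X).
have -> : cball b = \bigcup_(i in [set i | W b i]) B i :> set X.
  by apply/seteqP; split=> x; [move=> /hW[i []]|move=> [i ? ?]; apply/hW]; exists i.
exact: cup.
Qed.

(** For tolerance [eps], choose [s] with [2^-s <= eps/2] and use the rate of the approximation with
    index [s + N] at [eps/2]. The number [N] depends on [f] and [x] but is finite information, so it
    is built into the program. *)
Lemma rate_of_rates x f : (forall x, SR nu x -> weakly_computes_rates nu p E C x) ->
  SR nu x -> schnorr_test nu p f -> weakly_computes x (is_rate (fun n => E n f x) (f x)).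
Proof.
move=> hrates SRx hf a ax; have [c hc] := hrates x SRx a ax.
have [f_ [h_ [j [N [hj jC _ bound]]]]] :=
  SR_decomposition hf SRx.
have /choice[m_ hm_] : forall s, exists m, is_rate (fun n => E n (f_ s) x) (f_ s x) m /\
    forall k, Defs.eval a c (pr (j s) k) (m (qpos k)).
  by move=> s; have [ht Cs] := jC s; have [m m1 m2] := hc _ _ Cs ht; exists m.
(* Taking the least [s] makes it depend on the rational [qpos k] alone: a rational has many codes,
   while a rate is a function of the rational. *)
pose P k s := (2 ^- s <= qpos k / 2) && ~~ bex s (fun i => 2 ^- i <= qpos k / 2).
have [||s hs sP] := @ce_select P.
- by rewrite /P; rauto.
- move=> k; have : exists s, 2 ^- s <= qpos k / 2.
    have [m hm] := @lt_exp2N R (ratr (qpos k / 2)) ltac:(by rewrite ltr0q divr_gt0 ?qpos_gt0).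
    by exists m; rewrite -(ler_rat R) ratr_exp2N ltW.
  move=> ex; exists (ex_minn ex); rewrite /P; case: ex_minnP => s -> min /=.
  by apply/bexP => -[i si /min]; rewrite leqNgt si.
have sE k l : qpos k = qpos l -> s k = s l.
  move=> kl; have := sP k; have := sP l; rewrite /P kl => /andP[h1 /bexP h2] /andP[h3 /bexP h4].
  by have [sl|ls|//] := ltngtP (s k) (s l); [case: h2; exists (s k)|case: h4; exists (s l)].
(* This code of the half may depend on [k], since the rates are applied to its value only. *)
have [||g hg gP] := @ce_select (fun k l => qpos l == qpos k / 2).
- by rauto.
- move=> k; have [l hl] := @qpos_surj (qpos k / 2) ltac:(by rewrite divr_gt0 ?qpos_gt0).
  by exists l; rewrite hl.
(* Any code of [q] serves, by [sE]. A nonpositive [q] has no code and gets the default 0, on which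
   [is_rate] imposes nothing. *)
pose t q := (s (xget 0%N [set k | qpos k = q]) + N)%N.
have tE k : t (qpos k) = (s k + N)%N.
  rewrite /t (sE _ k) //; apply: (@xgetPex _ 0%N [set l | qpos l = qpos k]).
  by exists k.
exists (fun q => m_ (t q) (q / 2)).
  move=> q q0 n; have [k kq] := qpos_surj q0; rewrite -kq tE => hn.
  have [rt _] := hm_ (s k + N)%N.
  have q2 : 0 < qpos k / 2 by rewrite divr_gt0 ?qpos_gt0.
  apply: lt_le_trans (bound _ (leq_addl _ _) _ _ (rt _ q2 n hn)) _.
  rewrite lee_fin; have : 2 ^- s k <= ratr (qpos k / 2) :> R.
    by have /andP[h _] := sP k; rewrite -ratr_exp2N ler_rat.
  have : 2 ^- (s k + N) <= 2 ^- s k :> R.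
    by rewrite lef_pV2 ?posrE ?exprn_gt0 // ler_eXn2l ?ltr1n // leq_addr.
  rewrite ratrM ratrV (ratr_nat R 2); lra.
have [d hd] : rec (fun k => pr (j (s k + N)%N) (g k)) by rauto.
exists (CComp c d) => k /=; exists (pr (j (s k + N)%N) (g k)); first exact: hd.
by have [_] := hm_ (s k + N)%N; rewrite tE -(eqP (gP k)).
Qed.

End convergence_on_SR.

Theorem theorem6p2 (R : realType) (X : computablePolishType R)
    (nu : probability (Borel X) R) (B : nat -> set X)
    (F : nat -> set (set X)) (p : R)
    (E : nat -> (X -> \bar R) -> X -> \bar R)
    (XR : set X) (C : set (X -> \bar R)) :
  computable_measure nu ->
  computable_basis nu B ->
  filtration F ->
  1 <= p -> computable_real p ->
  (forall n f, Lp_plus nu p f ->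
     (forall x, (0 <= E n f x)%E) /\ cond_exp_version nu (F n) f (E n f)) ->
  SR nu `<=` XR ->
  (exists h, forall n e f, Lp_plus nu p f -> lsc_index e f ->
     yields h (pr n e) (fun j => lsc_index j (E n f))) ->
  (forall n f g, Lp_plus nu p f -> Lp_plus nu p g ->
     (forall x, XR x -> (f x <= g x)%E) ->
     forall x, XR x -> (E n f x <= E n g x)%E) ->
  (forall n f (c : R), Lp_plus nu p f -> 0 <= c ->
     forall x, XR x -> (c%:E * E n f x = E n (fun y => c%:E * f y) x)%E) ->
  (forall n f g, Lp_plus nu p f -> Lp_plus nu p g ->
     forall x, XR x -> (E n (fun y => f y + g y) x = E n f x + E n g x)%E) ->
  (exists h, forall n s, simple_nneg s ->
     yields h (pr n (simple_num s))
       (fun j => Lp_point_index nu B p j (E n (simple_fun B s)))) ->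
  (exists h, forall s, simple_nneg s ->
     yields h (simple_num s)
       (fun j => Lp_point_index nu B p j (flat E (simple_fun B s)))) ->
  C `<=` schnorr_test nu p ->
  approximated_from_below nu XR p C ->
  (forall f, C f -> forall x, XR x -> finite_lim (fun n => E n f x) (f x)) ->
  [/\ forall x, SR nu x <->
        XR x /\ forall f, schnorr_test nu p f ->
          finite_lim (fun n => E n f x) (f x),
      forall x, SR nu x <->
        [/\ XR x,
            forall f, schnorr_test nu p f ->
              exists l, finite_lim (fun n => E n f x) l &
            forall U : set X, ce_open U -> (exists e, ereal_index e (nu U)) ->
              finite_lim (fun n => E n (fun y => (\1_U y)%:E) x)
                (\1_U x)%:E],
      forall A : set (Borel X), measurable A ->
        exists2 A' : set X, <<s \bigcup_n F n >> A' &
          A `&` SR nu = A' `&` SR nu &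
      (forall x, SR nu x -> weakly_computes_rates nu p E C x) ->
      forall x f, SR nu x -> schnorr_test nu p f ->
        weakly_computes x (is_rate (fun n => E n f x) (f x))].
Proof.
move=> hnu hB hF p1 hp hE hXR hlsc hmono hscale hadd _ hflat _ happ hlim; split.
- by move=> x; apply: (SR_iff_lim hnu hB hF p1 hp hE hXR hlsc hmono hscale hadd hflat happ hlim).
- by move=> x; apply: (SR_iff_lim_indic hnu hB hF p1 hp hE hXR hlsc hmono hscale hadd hflat happ hlim).
- move=> A mA.
  exact: (tail_equal_borel hnu hB hF p1 hp hE hXR hlsc hmono hadd hflat happ hlim).
- move=> hrates x f; exact: (rate_of_rates hnu hB hF p1 hE hXR hlsc hmono hadd hflat happ hlim).
Qed.
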